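(* Let $(f,\xi)$ be an equiaffine pair representing a line congruence, let $p$ be a point of the parameter domain with $\delta(p)>0$, and let $\lambda_i$ ($i\in\{1,2\}$) be an eigenvalue of the shape operator with $\lambda_i(p)\neq0$. Put $Z_i=f(p)+\lambda_i(p)^{-1}\xi(p)$. Assume that the $i$-ridge set is a regular curve, in the sense that the function $d\lambda_i(w_i)$ has non-zero differential at each of its zeros, where $w_i$ is a smooth nowhere zero field of eigenvectors of $S$ for $\lambda_i$. Then $p$ is an $A_3$ point of the support function $\rho(\cdot,Z_i)$ if and only if $p$ is an $i$-ridge point and the principal direction associated with $\lambda_i$ at $p$ is not tangent to the $i$-ridge curve.
   Context: A line congruence is given by a pair $(f,\xi)$, where $f:U\to\mathbb{R}^3$ is a smooth immersion of an open set $U\subset\mathbb{R}^2$ and $\xi:U\to\mathbb{R}^3$ is smooth and transversal to $f$; the lines are $t\mapsto f(u,v)+t\xi(u,v)$. Write $D_X\xi=-f_*(SX)+\tau(X)\xi$ and $D_Xf_*Y=f_*(\nabla_XY)+h(X,Y)\xi$, with shape operator $S=\begin{pmatrix}a&b\\ c&d\end{pmatrix}$, $1$-form $\tau$ and symmetric bilinear form $h$. The pair is equiaffine if $\tau=0$ and $h$ is non-degenerate. Let $\delta=(a-d)^2+4bc$; where $\delta>0$, $S$ has two distinct real eigenvalues $\lambda_1,\lambda_2$, smooth functions on $\{\delta>0\}$, whose eigenvectors are called principal directions. A point is an $i$-ridge point if $F_i=f+\lambda_i^{-1}\xi$ is not an immersion there; equivalently (since $\tau=0$) $d\lambda_i(X)=0$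 for $X$ an eigenvector of $S$ for $\lambda_i$. The $i$-ridge curve is the set of $i$-ridge points. For an equiaffine pair, the co-normal $\nu$ is defined by $\nu\cdot f_u=\nu\cdot f_v=0$, $\nu\cdot\xi=1$, and the support function is $\rho(u,v,Z)=\nu(u,v)\cdot(Z-f(u,v))$, $Z\in\mathbb{R}^3$. The point $p$ is an $A_k$ point of $\rho(\cdot,Z)$ if $p$ is a critical point of $(u,v)\mapsto\rho(u,v,Z)$ and the germ at $p$ is, up to an additive constant and a smooth change of coordinates in the source, $\pm x^{k+1}\pm y^2$. *)

(* Defs.v *)
From HB Require Import structures.
From mathcomp Require Import all_boot all_order all_algebra.
From mathcomp Require Import all_classical all_reals all_analysis.

Set Implicit Arguments.
Unset Strict Implicit.
Unset Printing Implicit Defensive.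

Import Order.TTheory GRing.Theory Num.Theory.
Import numFieldNormedType.Exports.

Local Open Scope classical_set_scope.
Local Open Scope ring_scope.

(* Points and tangent vectors of R^2 are row vectors, so matrices act on the
   right: S X is written X *m S, as for jacobian and eigenvalue. *)

Section Smoothness.
Context {R : realType}.
Variables V W : normedModType R.

(* C^n on an open set D of a finite-dimensional space V. *)
Fixpoint Cn (n : nat) (D : set V) (g : V -> W) : Prop :=
  match n with
  | 0 => forall x, D x -> {for x, continuous g}
  | m.+1 => (forall x, D x -> differentiable g x) /\
            (forall v, Cn m D (fun x => 'D_v g x))
  end.

Definition smooth (D : set V) (g : V -> W) : Prop := forall n, Cn n D g.

Definition immersion_at (g : V -> W) (x : V) : Prop :=
  differentiable g x /\ injective ('d g x : V -> W).

End Smoothness.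

Section Congruences.
Context {R : realType}.
Local Notation plane := 'rV[R]_2.
Local Notation space := 'rV[R]_3.

Definition dot (x y : space) : R := \sum_(k < 3) x 0 k * y 0 k.

(* Values of the 1-form and of the bilinear form with given components. *)
Definition eval1 (t : 'cV[R]_2) (X : plane) : R := (X *m t) 0 0.
Definition eval2 (B : 'M[R]_2) (X Y : plane) : R := (X *m B *m Y^T) 0 0.

Definition line_congruence (U : set plane) (f xi : plane -> space) : Prop :=
  [/\ open U, smooth U f, smooth U xi,
      forall q, U q -> immersion_at f q
    & forall q, U q -> forall X : plane, xi q <> 'D_X f q].

(* D_X xi = - f_*(S X) + tau(X) xi  and  D_X (f_* Y) = f_*(nabla_X Y) + h(X,Y) xi.
   The second equation is imposed for constant vector fields Y; nabla q X Y is
   then the connection on such fields.  By transversality these equations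
   determine S, tau, nabla and h on U. *)
Definition structure_equations (U : set plane) (f xi : plane -> space)
    (S : plane -> 'M[R]_2) (tau : plane -> 'cV[R]_2)
    (nabla : plane -> plane -> plane -> plane) (h : plane -> 'M[R]_2) : Prop :=
  forall q, U q ->
  [/\ forall X : plane,
        'D_X xi q = - 'D_(X *m S q) f q + eval1 (tau q) X *: xi q,
      forall X Y : plane,
        'D_X (fun r => 'D_Y f r) q =
          'D_(nabla q X Y) f q + eval2 (h q) X Y *: xi q
    & (h q)^T = h q].

Definition equiaffine (U : set plane) (tau : plane -> 'cV[R]_2)
    (h : plane -> 'M[R]_2) : Prop :=
  forall q, U q -> tau q = 0 /\ h q \in unitmx.

Definition delta (A : 'M[R]_2) : R :=
  (A 0 0 - A 1 1) ^+ 2 + 4 * A 0 1 * A 1 0.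

Definition hyperbolic_locus (U : set plane) (S : plane -> 'M[R]_2) : set plane :=
  [set q | U q /\ 0 < delta (S q)].

Definition eigenvector (A : 'M[R]_2) (l : R) (w : plane) : Prop :=
  w != 0 /\ w *m A = l *: w.

(* Any smooth labelling of the two eigenvalues on {delta > 0} is allowed. *)
Definition shape_eigenvalues (U : set plane) (S : plane -> 'M[R]_2)
    (lambda : 'I_2 -> plane -> R) : Prop :=
  [/\ forall i, smooth (hyperbolic_locus U S) (lambda i),
      forall q, hyperbolic_locus U S q ->
        forall i, eigenvalue (S q) (lambda i q)
    & forall q, hyperbolic_locus U S q -> lambda 0 q != lambda 1 q].

Definition focal_map (f xi : plane -> space) (l : plane -> R) (q : plane) : space :=
  f q + (l q)^-1 *: xi q.

Definition ridge (U : set plane) (S : plane -> 'M[R]_2)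
    (f xi : plane -> space) (l : plane -> R) : set plane :=
  [set q | [/\ hyperbolic_locus U S q, l q != 0
             & ~ immersion_at (focal_map f xi l) q]].

(* d l(w) has non-zero differential at each of its zeros.  An eigenvector field
   w need not exist globally on {delta > 0}, and whether the differential is
   non-zero at a zero does not depend on w, so all local fields are used. *)
Definition regular_ridge (U : set plane) (S : plane -> 'M[R]_2)
    (l : plane -> R) : Prop :=
  forall (V : set plane) (w : plane -> plane),
    open V -> V `<=` hyperbolic_locus U S -> smooth V w ->
    (forall q, V q -> eigenvector (S q) (l q) (w q)) ->
  forall q, V q -> 'D_(w q) l q = 0 ->
  exists X : plane, 'D_X (fun r => 'D_(w r) l r) q != 0.

(* w is the velocity at p of a smooth curve lying in C. *)
Definition tangent_vector (C : set plane) (p w : plane) : Prop :=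
  exists (e : R) (c : R -> plane),
    [/\ 0 < e, smooth (ball (0 : R) e) c,
        forall t, ball (0 : R) e t -> C (c t),
        c 0 = p & 'D_1 c 0 = w].

Definition conormal (U : set plane) (f xi nu : plane -> space) : Prop :=
  forall q, U q ->
    (forall X : plane, dot (nu q) ('D_X f q) = 0) /\ dot (nu q) (xi q) = 1.

Definition support_function (f nu : plane -> space) (q : plane) (Z : space) : R :=
  dot (nu q) (Z - f q).

Definition critical_point (g : plane -> R) (p : plane) : Prop :=
  differentiable g p /\ forall X : plane, 'D_X g p = 0.

(* phi is a smooth diffeomorphism from V onto W with inverse psi. *)
Definition diffeomorphism (V W : set plane) (phi psi : plane -> plane) : Prop :=
  [/\ open V, open W, smooth V phi & smooth W psi] /\
  [/\ forall q, V q -> W (phi q) /\ psi (phi q) = q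
    & forall x, W x -> V (psi x) /\ phi (psi x) = x].

Definition A_point (k : nat) (g : plane -> R) (p : plane) : Prop :=
  critical_point g p /\
  exists (V W : set plane) (phi psi : plane -> plane) (c : R) (s1 s2 : bool),
    [/\ diffeomorphism V W phi psi, V p, phi p = 0
      & forall q, V q ->
          g q = c + (-1) ^+ s1 * phi q 0 0 ^+ k.+1 + (-1) ^+ s2 * phi q 0 1 ^+ 2].

End Congruences.

(* Main.v *)
(* Write g for the support function at Z_i, w for an eigenvector field of S for
   l = lambda_i near p, and m = dl(w).  Differentiating nu twice expresses the
   Hessian of g as (1 - g S) h plus a term linear in dg; since p is critical and
   g p = 1 / l p, the kernel of the Hessian at p is spanned by w p.  Let gamma
   be a curve through p tangent to w along which dg = U theta with U(0) = 0 and
   theta(w p) <> 0.  Differentiating dg along gamma in the directions w and E,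
   with E an eigenvector for the other eigenvalue, gives at 0: U' = 0, then
   U'' = 0 iff m p = 0, and in that case U''' = 0 iff dm(w p) = 0.
   In an A_3 chart take gamma to be the first axis, where U = t^3.  Conversely
   take gamma in the curve {dg(E) = 0}, with U = dg(w): the first derivative of
   g along gamma not vanishing at 0 is the fourth, and Hadamard division yields
   the normal form +-x^4 +- y^2.  Since m vanishes exactly on the ridge, where it
   has non-zero differential, dm(w p) <> 0 says that w p is transverse to it. *)
From HB Require Import structures.
Require Import Defs.
From mathcomp Require Import all_boot all_order all_algebra.
From mathcomp Require Import all_classical all_reals all_analysis.
From mathcomp Require Import ring lra.
Set Implicit Arguments.
Unset Strict Implicit.
Unset Printing Implicit Defensive.
Import Order.TTheory GRing.Theory Num.Theory.
Import numFieldNormedType.Exports.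
Local Open Scope classical_set_scope.
Local Open Scope ring_scope.

(** * Smooth maps *)

Section Differentials.
Context {R : realType} {V W : normedModType R}.
Implicit Types (f g : V -> W) (x v : V).

(** Any continuous linear [df] with error o(v) is the differential, by uniqueness. This epsilon form
    is the one that can be checked for inverse functions and for integrals with a parameter, where
    the differential is known in advance. *)
Lemma differentiable_linear_bound f x (df : {linear V -> W}) : continuous df ->
  (forall e, 0 < e -> \forall v \near (0 : V), `|f (v + x) - f x - df v| <= e * `|v|) ->
  differentiable f x.
Proof.
move=> dfc H.
have E : f \o shift x = cst (f x) + df +o_ (0 : V) id.
  apply/eqaddoP => e e0; have := H e e0.
  apply: filterS => v /=.
  by rewrite [X in _ -> `|X| <= _](_ : _ = f (v + x) - f x - df v) // -addrA -opprD.
by apply/diff_locallyP; rewrite (diff_unique dfc E).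
Qed.

Lemma derive_linear_bound f x (df : {linear V -> W}) v : continuous df ->
  (forall e, 0 < e -> \forall v \near (0 : V), `|f (v + x) - f x - df v| <= e * `|v|) ->
  'D_v f x = df v.
Proof.
move=> dfc H; rewrite (deriveE _ (differentiable_linear_bound dfc H)).
have E : f \o shift x = cst (f x) + df +o_ (0 : V) id.
  apply/eqaddoP => e e0; have := H e e0.
  apply: filterS => w /=.
  by rewrite [X in _ -> `|X| <= _](_ : _ = f (w + x) - f x - df w) // -addrA -opprD.
by rewrite (diff_unique dfc E).
Qed.

Lemma differential_bound f x e : differentiable f x -> 0 < e ->
  \forall v \near (0 : V), `|f (v + x) - f x - 'd f x v| <= e * `|v|.
Proof.
move=> /diff_locally /eqaddoP E e0; have := E _ e0.
apply: filterS => v /=.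
by rewrite [X in `|X| <= _ -> _](_ : _ = f (v + x) - f x - 'd f x v) // -addrA -opprD.
Qed.

Lemma near_eq_differentiable f g x : (\near x, f x = g x) ->
  differentiable f x -> differentiable g x.
Proof.
move=> fg df; apply: (@differentiable_linear_bound _ _ ('d f x)).
  exact: diff_continuous.
move=> e e0; have := differential_bound df e0.
have fg0 : \forall v \near (0 : V), f (v + x) = g (v + x).
  by move: fg; rewrite (near_shift 0 x) subr0.
apply: filterS2 fg0 => v <-.
by rewrite (nbhs_singleton fg).
Qed.

End Differentials.

Section Calculus.
Context {R : realType} {V : normedModType R}.

Lemma open_near (W : normedModType R) (D : set V) (f g : V -> W) x :
  open D -> D x -> {in D, f =1 g} -> \near x, f x = g x.
Proof.
move=> oD Dx fg; have := open_nbhs_nbhs (conj oD Dx).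
by apply: filterS => y Dy; apply: fg; rewrite inE.
Qed.

(** Openness turns agreement on [D] into agreement near each of its points, so derivatives of every
    order agree. The rules below use it to replace a derivative by a formula valid only on [D]. *)
Lemma Cn_ext (W : normedModType R) n (D : set V) (f g : V -> W) :
  open D -> {in D, f =1 g} -> Cn n D f -> Cn n D g.
Proof.
move=> oD; elim: n f g => [|n IH] f g fg.
  move=> H x Dx; have nfg := open_near oD Dx fg.
  have : f y @[y --> x] --> f x by exact: H.
  rewrite (nbhs_singleton nfg); apply: cvg_trans.
  by apply: near_eq_cvg; apply: filterS nfg => y ->.
move=> [df H]; split=> [x Dx|v].
  exact: near_eq_differentiable (open_near oD Dx fg) (df x Dx).
apply: IH (H v) => x; rewrite inE => Dx.
exact: near_eq_derive (open_near oD Dx fg).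
Qed.

Lemma Cn_sub (W : normedModType R) n (D D' : set V) (f : V -> W) :
  D' `<=` D -> Cn n D f -> Cn n D' f.
Proof.
move=> DD; elim: n f => [|n IH] f /=; first by move=> H x /DD; exact: H.
by move=> [df H]; split=> [x /DD|v]; [exact: df | exact/IH].
Qed.

(** In an induction on the order, product and chain rules multiply a derivative of order [n] by an
    undifferentiated factor known to order [n.+1]; this lowers the latter. *)
Lemma CnS (W : normedModType R) n (D : set V) (f : V -> W) : Cn n.+1 D f -> Cn n D f.
Proof.
elim: n f => [|n IH] f [df H].
  by move=> x Dx; exact/differentiable_continuous/df.
by split=> // v; exact/IH/H.
Qed.

Lemma Cn_cst (W : normedModType R) n (D : set V) (c : W) : Cn n D (fun=> c).
Proof.
elim: n c => [|n IH] c; first by move=> x _; exact: cst_continuous.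
split=> [x _|v]; first exact: differentiable_cst.
by rewrite (_ : (fun x => 'D_v (fun=> c) x) = fun=> 0) //; apply/funext => x; exact: derive_cst.
Qed.

Lemma Cn_linear (W : normedModType R) n (D : set V) (f : {linear V -> W}) :
  continuous f -> Cn n D f.
Proof.
case: n => [|n] fc; first by move=> x _; exact: fc.
split=> [x _|v]; first exact: linear_differentiable.
rewrite (_ : (fun x => 'D_v f x) = fun=> f v); first exact: Cn_cst.
by apply/funext => x; rewrite deriveE ?diff_lin //; exact: linear_differentiable.
Qed.

Lemma CnD (W : normedModType R) n (D : set V) (f g : V -> W) : open D ->
  Cn n D f -> Cn n D g -> Cn n D (fun x => f x + g x).
Proof.
move=> oD; elim: n f g => [|n IH] f g.
  by move=> Hf Hg x Dx; apply: continuousD; [exact: Hf|exact: Hg].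
move=> [df Hf] [dg Hg]; split=> [x Dx|v].
  by apply: differentiableD; [exact: df|exact: dg].
apply: Cn_ext (IH _ _ (Hf v) (Hg v)) => // x; rewrite inE => Dx.
by rewrite -deriveD //; apply: diff_derivable; [exact: df|exact: dg].
Qed.

Lemma CnM n (D : set V) (f g : V -> R) : open D ->
  Cn n D f -> Cn n D g -> Cn n D (fun x => f x * g x).
Proof.
move=> oD; elim: n f g => [|n IH] f g.
  by move=> Hf Hg x Dx; apply: continuousM; [exact: Hf|exact: Hg].
move=> cf cg; have [df Hf] := cf; have [dg Hg] := cg; split=> [x Dx|v].
  by apply: differentiableM; [exact: df|exact: dg].
have := CnD oD (IH _ _ (CnS cf) (Hg v)) (IH _ _ (CnS cg) (Hf v)).
apply: Cn_ext => // x; rewrite inE => Dx.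
by rewrite -deriveM //; apply: diff_derivable; [exact: df|exact: dg].
Qed.

Lemma CnZ (W : normedModType R) n (D : set V) (k : V -> R) (w : W) : open D ->
  Cn n D k -> Cn n D (fun x => k x *: w).
Proof.
move=> oD; elim: n k => [|n IH] k.
  by move=> Hk x Dx; apply: continuousZr_tmp; exact: Hk.
move=> [dk Hk]; split=> [x Dx|v]; first exact/differentiableZl/dk.
apply: Cn_ext (IH _ (Hk v)) => // x; rewrite inE => Dx.
by rewrite !deriveE ?diffZl //; [exact: dk| exact/differentiableZl/dk | exact: dk].
Qed.

Lemma Cn_sum (W : normedModType R) n (D : set V) (I : Type) (r : seq I) (P : pred I)
    (f : I -> V -> W) : open D ->
  (forall i, Cn n D (f i)) -> Cn n D (fun x => \sum_(i <- r | P i) f i x).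
Proof.
move=> oD H; elim: r => [|i r IH].
  by under eq_fun do rewrite big_nil; exact: Cn_cst.
under eq_fun do rewrite big_cons.
by case: (P i) => //; exact: CnD.
Qed.

Lemma Cn_prod n (D : set V) (I : Type) (r : seq I) (P : pred I)
    (f : I -> V -> R) : open D ->
  (forall i, Cn n D (f i)) -> Cn n D (fun x => \prod_(i <- r | P i) f i x).
Proof.
move=> oD H; elim: r => [|i r IH].
  by under eq_fun do rewrite big_nil; exact: Cn_cst.
under eq_fun do rewrite big_cons.
by case: (P i) => //; exact: CnM.
Qed.

Lemma CnV n (D : set V) (f : V -> R) : open D -> (forall x, D x -> f x != 0) ->
  Cn n D f -> Cn n D (fun x => (f x)^-1).
Proof.
move=> oD f0; elim: n => [|n IH] cf.
  by move=> x Dx; apply: continuousV; [exact: f0|exact: cf].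
have [df Hf] := cf; split=> [x Dx|v]; first exact: differentiableV (df x Dx) (f0 x Dx).
have cV := IH (CnS cf).
have := CnM oD (Cn_cst n D (-1 : R)) (CnM oD (CnM oD cV cV) (Hf v)).
apply: Cn_ext => // x; rewrite inE => Dx.
rewrite deriveV ?f0 //; last exact/diff_derivable/df.
by rewrite -exprVn expr2 scaleNr mulN1r.
Qed.

End Calculus.

(** * Chain rules *)

Section Composition.
Context {R : realType}.

Lemma derive_comp_linear (V M : normedModType R) (l : {linear M -> R}) (f : V -> M) x v :
  continuous l -> differentiable f x -> 'D_v (l \o f) x = l ('D_v f x).
Proof.
move=> lc df; have dl y : differentiable l y by exact: linear_differentiable.
rewrite (deriveE _ (differentiable_comp df (dl _))) (diff_comp df (dl _)) /=.
by rewrite (diff_lin _ lc) (deriveE _ df).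
Qed.

Lemma Cn_comp_linear (V M : normedModType R) n (D : set V) (l : {linear M -> R}) (f : V -> M) :
  open D -> continuous l -> Cn n D f -> Cn n D (fun x => l (f x)).
Proof.
move=> oD lc; elim: n f => [|n IH] f.
  by move=> Hf x Dx; apply: continuous_comp; [exact: Hf|exact: lc].
move=> [df Hf]; split=> [x Dx|u].
  by apply: differentiable_comp; [exact: df|exact: linear_differentiable].
apply: Cn_ext (IH _ (Hf u)) => // x; rewrite inE => Dx.
by rewrite -derive_comp_linear //; exact: df.
Qed.

(* A finite family of vectors [e i] with continuous coordinate functionals [l i]:
   the chain rule is needed both on R and on row vectors. *)
Lemma derive_comp_coord (V M : normedModType R) (I : finType)
    (e : I -> M) (l : I -> {linear M -> R}) (g : M -> R) (f : V -> M) x v :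
  (forall y, y = \sum_i l i y *: e i) ->
  differentiable f x -> differentiable g (f x) ->
  'D_v (g \o f) x = \sum_i l i ('D_v f x) * 'D_(e i) g (f x).
Proof.
move=> el df dg.
rewrite deriveE; last exact: differentiable_comp.
rewrite diff_comp //= -(deriveE _ df) [in LHS](el ('D_v f x)) raddf_sum.
by apply: eq_bigr => i _; rewrite [LHS]linearZ (deriveE _ dg).
Qed.

(** The chain rule differentiates [g] in the direction ['D_v f x], which moves with [x]. Expanding
    it in the fixed family [e] leaves derivatives along constant vectors, the only ones that [Cn]
    iterates. *)
Lemma Cn_comp_coord (V M : normedModType R) n (D : set V) (E : set M) (I : finType)
    (e : I -> M) (l : I -> {linear M -> R}) (g : M -> R) (f : V -> M) :
  open D -> (forall y, y = \sum_i l i y *: e i) -> (forall i, continuous (l i)) ->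
  (forall x, D x -> E (f x)) -> Cn n D f -> Cn n E g -> Cn n D (fun x => g (f x)).
Proof.
move=> oD el lc DE; elim: n g => [|n IH] g.
  move=> Hf Hg x Dx; apply: continuous_comp; first exact: Hf.
  exact/Hg/DE.
move=> cf [dg Hg]; have [df Hf] := cf; split=> [x Dx|v].
  by apply: differentiable_comp; [exact: df|exact/dg/DE].
apply: (@Cn_ext _ _ _ _ _ (fun x => \sum_i l i ('D_v f x) * 'D_(e i) g (f x))) => //.
  by move=> x; rewrite inE => Dx; rewrite -(derive_comp_coord _ el) //; [exact: df|exact/dg/DE].
apply: Cn_sum => // i; apply: CnM => //; first exact: (Cn_comp_linear oD (lc i) (Hf v)).
exact: (IH _ (CnS cf) (Hg (e i))).
Qed.

Definition coord_mx m n (i : 'I_m) (j : 'I_n) (A : 'M[R]_(m, n)) : R := A i j.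

Lemma coord_mx_is_linear m n i j : linear (@coord_mx m n i j).
Proof. by move=> a A B; rewrite /coord_mx !mxE. Qed.

HB.instance Definition _ m n i j :=
  GRing.isLinear.Build R 'M[R]_(m, n) R _ (@coord_mx m n i j) (coord_mx_is_linear i j).

Lemma coord_mx_continuous m n i j : continuous (@coord_mx m n i j).
Proof. exact: coord_continuous. Qed.

Lemma Cn_coord (V : normedModType R) m k n (D : set V) (f : V -> 'M[R]_(m, k)) i j : open D ->
  Cn n D f -> Cn n D (fun x => f x i j).
Proof.
by move=> oD; apply: (Cn_comp_linear (l := @coord_mx m k i j)) => //; exact: coord_mx_continuous.
Qed.

Lemma Cn_mx (V : normedModType R) m k n (D : set V) (f : V -> 'M[R]_(m, k)) : open D ->
  (forall i j, Cn n D (fun x => f x i j)) -> Cn n D f.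
Proof.
move=> oD H.
apply: (@Cn_ext _ _ _ _ _ (fun x => \sum_i \sum_j f x i j *: delta_mx i j)) => //.
  by move=> x _; rewrite -matrix_sum_delta.
by apply: Cn_sum => // i; apply: Cn_sum => // j; exact: CnZ.
Qed.

Lemma Cn_comp_rV (V : normedModType R) k n (D : set V) (E : set 'rV[R]_k)
    (g : 'rV[R]_k -> R) (f : V -> 'rV[R]_k) :
  open D -> (forall x, D x -> E (f x)) -> Cn n D f -> Cn n E g -> Cn n D (fun x => g (f x)).
Proof.
move=> oD; apply: (Cn_comp_coord (e := fun j => delta_mx 0 j) (l := @coord_mx 1 k 0)) => //.
  by move=> y; rewrite {1}[y]row_sum_delta.
by move=> i; exact: coord_mx_continuous.
Qed.

Lemma Cn_compR (V : normedModType R) n (D : set V) (E : set R) (g : R -> R) (f : V -> R) :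
  open D -> (forall x, D x -> E (f x)) -> Cn n D f -> Cn n E g -> Cn n D (fun x => g (f x)).
Proof.
move=> oD; apply: (@Cn_comp_coord V R n D E unit (fun=> 1) (fun=> (idfun : {linear R -> R})) g f) => //.
  by move=> y; rewrite (big_pred1 tt) ?[_ *: _]mulr1 //; case.
by move=> _ x.
Qed.

Lemma derive_comp (V M W : normedModType R) (g : M -> W) (f : V -> M) x v :
  differentiable f x -> differentiable g (f x) ->
  'D_v (fun y => g (f y)) x = 'D_('D_v f x) g (f x).
Proof.
move=> df dg; rewrite -[fun y => _]/(g \o f) (deriveE _ (differentiable_comp df dg)).
by rewrite (diff_comp df dg) /= (deriveE _ df) (deriveE _ dg).
Qed.

End Composition.

Section Smooth.
Context {R : realType} {V : normedModType R}.
Implicit Types (D : set V) (f g : V -> R).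

Lemma smooth_ext (W : normedModType R) D (f g : V -> W) :
  open D -> {in D, f =1 g} -> smooth D f -> smooth D g.
Proof. by move=> oD fg H n; exact: Cn_ext (H n). Qed.

Lemma smooth_sub (W : normedModType R) D D' (f : V -> W) :
  D' `<=` D -> smooth D f -> smooth D' f.
Proof. by move=> DD H n; exact: Cn_sub (H n). Qed.

Lemma smooth_cst (W : normedModType R) D (c : W) : smooth D (fun=> c).
Proof. by move=> n; exact: Cn_cst. Qed.

Lemma smooth_linear (W : normedModType R) D (f : {linear V -> W}) :
  continuous f -> smooth D f.
Proof. by move=> fc n; exact: Cn_linear. Qed.

Lemma smoothD (W : normedModType R) D (f g : V -> W) : open D ->
  smooth D f -> smooth D g -> smooth D (fun x => f x + g x).
Proof. by move=> oD Hf Hg n; exact: CnD. Qed.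

Lemma smoothM D f g : open D -> smooth D f -> smooth D g -> smooth D (fun x => f x * g x).
Proof. by move=> oD Hf Hg n; exact: CnM. Qed.

Lemma smoothN D f : open D -> smooth D f -> smooth D (fun x => - f x).
Proof.
move=> oD Hf; apply: smooth_ext (smoothM oD (smooth_cst D (-1 : R)) Hf) => // x _.
by rewrite mulN1r.
Qed.

Lemma smoothB D f g : open D -> smooth D f -> smooth D g -> smooth D (fun x => f x - g x).
Proof. by move=> oD Hf Hg; apply: smoothD => //; exact: smoothN. Qed.

Lemma smoothV D f : open D -> (forall x, D x -> f x != 0) ->
  smooth D f -> smooth D (fun x => (f x)^-1).
Proof. by move=> oD f0 H n; exact: CnV. Qed.

Lemma smoothX D f n : open D -> smooth D f -> smooth D (fun x => f x ^+ n).
Proof.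
move=> oD H; elim: n => [|n IH]; first exact: smooth_cst.
by under eq_fun do rewrite exprS; exact: smoothM.
Qed.

Lemma smooth_sum (W : normedModType R) D (I : Type) (r : seq I) (P : pred I) (f : I -> V -> W) :
  open D -> (forall i, smooth D (f i)) -> smooth D (fun x => \sum_(i <- r | P i) f i x).
Proof. by move=> oD H n; apply: Cn_sum => // i; exact: H. Qed.

Lemma smooth_prod D (I : Type) (r : seq I) (P : pred I) (f : I -> V -> R) :
  open D -> (forall i, smooth D (f i)) -> smooth D (fun x => \prod_(i <- r | P i) f i x).
Proof. by move=> oD H n; apply: Cn_prod => // i; exact: H. Qed.

Lemma smoothZ (W : normedModType R) D f (w : W) : open D ->
  smooth D f -> smooth D (fun x => f x *: w).
Proof. by move=> oD H n; exact: CnZ. Qed.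

Lemma smooth_derive (W : normedModType R) D (f : V -> W) v :
  smooth D f -> smooth D (fun x => 'D_v f x).
Proof. by move=> H n; have [_ /(_ v)] := H n.+1. Qed.

Lemma smooth_differentiable (W : normedModType R) D (f : V -> W) x :
  smooth D f -> D x -> differentiable f x.
Proof. by move=> H; have [+ _] := H 1%N; exact. Qed.

Lemma smooth_derivable (W : normedModType R) D (f : V -> W) x v :
  smooth D f -> D x -> derivable f x v.
Proof. by move=> H Dx; exact/diff_derivable/(smooth_differentiable H). Qed.

Lemma smooth_continuous (W : normedModType R) D (f : V -> W) x :
  smooth D f -> D x -> {for x, continuous f}.
Proof. by move=> H; exact: (H 0%N). Qed.

Lemma smooth_coord D m k (f : V -> 'M[R]_(m, k)) i j : open D ->
  smooth D f -> smooth D (fun x => f x i j).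
Proof. by move=> oD H n; exact: Cn_coord. Qed.

Lemma smooth_mx D m k (f : V -> 'M[R]_(m, k)) : open D ->
  (forall i j, smooth D (fun x => f x i j)) -> smooth D f.
Proof. by move=> oD H n; apply: Cn_mx => // i j; exact: H. Qed.

Lemma smooth_comp_rV k D (E : set 'rV[R]_k) (g : 'rV[R]_k -> R) (f : V -> 'rV[R]_k) :
  open D -> (forall x, D x -> E (f x)) -> smooth D f -> smooth E g ->
  smooth D (fun x => g (f x)).
Proof. by move=> oD DE Hf Hg n; exact: Cn_comp_rV DE (Hf n) (Hg n). Qed.

Lemma smooth_compR D (E : set R) (g : R -> R) f :
  open D -> (forall x, D x -> E (f x)) -> smooth D f -> smooth E g ->
  smooth D (fun x => g (f x)).
Proof. by move=> oD DE Hf Hg n; exact: Cn_compR DE (Hf n) (Hg n). Qed.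

Lemma smooth_mulmx D m k l (A : V -> 'M[R]_(m, k)) (B : V -> 'M[R]_(k, l)) : open D ->
  smooth D A -> smooth D B -> smooth D (fun x => A x *m B x).
Proof.
move=> oD HA HB; apply: smooth_mx => // i j.
under eq_fun do rewrite mxE.
by apply: smooth_sum => // r; apply: smoothM => //; exact: smooth_coord.
Qed.

Lemma smooth_det D n (A : V -> 'M[R]_n) : open D -> smooth D A -> smooth D (fun x => \det (A x)).
Proof.
move=> oD HA; rewrite /determinant; apply: smooth_sum => // s.
apply: smoothM => //; first exact: smooth_cst.
by apply: smooth_prod => // i; exact: smooth_coord.
Qed.

Lemma smooth_invmx D n (A : V -> 'M[R]_n) : open D -> smooth D A ->
  (forall x, D x -> A x \in unitmx) -> smooth D (fun x => invmx (A x)).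
Proof.
move=> oD HA uA; apply: smooth_mx => // i j.
apply: (@smooth_ext _ _ (fun x => (\det (A x))^-1 * cofactor (A x) j i)) => //.
  by move=> x; rewrite inE => Dx; rewrite /invmx uA // !mxE.
apply: smoothM => //.
  apply: smoothV => //; last exact: smooth_det.
  by move=> x Dx; rewrite -unitfE -unitmxE uA.
rewrite /cofactor; apply: smoothM => //; first exact: smooth_cst.
apply: smooth_det => //; apply: smooth_mx => // r s.
by under eq_fun do rewrite !mxE; exact: smooth_coord.
Qed.

Lemma smooth_id D : smooth D id.
Proof.
have ci : continuous (idfun : {linear V -> V}) by move=> x.
exact: (smooth_linear D ci).
Qed.

End Smooth.

Lemma mulmxr_continuous (R : realType) m n k (A : 'M[R]_(n, k)) :
  continuous (fun x : 'M[R]_(m, n) => x *m A).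
Proof.
move=> x; have oT : open [set: 'M[R]_(m, n)] := openT.
have := smooth_mulmx oT (smooth_id _) (smooth_cst _ A).
by move=> H; exact: (smooth_continuous H I).
Qed.

Section SmoothSqrt.
Context {R : realType}.

(** The derivative is a rational function of the square root itself, so the order climbs by
    induction. Square roots will turn the Hadamard quotients of the normal form into coordinates. *)
Lemma smooth_sqrt : smooth [set x : R | 0 < x] Num.sqrt.
Proof.
have oP : open [set x : R | 0 < x] by exact: open_gt.
move=> n; elim: n => [|n IH].
  by move=> x _; exact: sqrt_continuous.
have ds (x : R) : 0 < x -> is_derive x 1 Num.sqrt (2 * Num.sqrt x)^-1.
  by move=> x0; exact: is_derive1_sqrt.
have df (x : R) : 0 < x -> differentiable Num.sqrt x.
  by move=> x0; apply/derivable1_diffP; have [] := ds x x0.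
split=> [x x0|v]; first exact: df.
apply: (@Cn_ext _ _ _ _ _ (fun x => v * (2 * Num.sqrt x)^-1)) => //.
  move=> x; rewrite inE => x0; rewrite (deriveE _ (df x x0)) -[v]mulr1 [in RHS]linearZ /=.
  by rewrite -deriveE ?derive_val; [have [_ ->] := ds x x0; rewrite mulr1 | exact: df].
apply: CnM => //; first exact: Cn_cst.
apply: CnV => //; first by move=> x x0; rewrite mulf_neq0 ?pnatr_eq0 // gt_eqF ?sqrtr_gt0.
by apply: CnM => //; exact: Cn_cst.
Qed.

Lemma smooth_sqrt_comp (V : normedModType R) (D : set V) (f : V -> R) : open D ->
  (forall x, D x -> 0 < f x) -> smooth D f -> smooth D (fun x => Num.sqrt (f x)).
Proof. by move=> oD f0 H; exact: (smooth_compR oD f0 H smooth_sqrt). Qed.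

End SmoothSqrt.

(** * Mean value theorem and inverse functions *)

Section MeanValue.
Context {R : realType} {V : normedModType R}.
Implicit Types (f : V -> R) (x u v : V).

Lemma is_derive_line (W : normedModType R) (f : V -> W) x v t :
  differentiable f (t *: v + x) ->
  is_derive t 1 (fun s : R => f (s *: v + x)) ('D_v f (t *: v + x)).
Proof.
move=> df.
have dz : differentiable (fun s : R => s *: v) t by exact: differentiableZl.
have dl : differentiable (fun s : R => s *: v + x) t.
  by apply: differentiableD => //; exact: differentiable_cst.
have dc : differentiable (fun s : R => f (s *: v + x)) t := differentiable_comp dl df.
apply: DeriveDef; first exact: diff_derivable.
rewrite (deriveE _ dc) (deriveE _ df).
transitivity (('d f (t *: v + x) \o 'd (fun s : R => s *: v + x) t) 1).
  by rewrite -(diff_comp dl df).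
rewrite /=; congr ('d f _ _).
rewrite (_ : (fun s : R => s *: v + x) = (fun s : R => s *: v) + cst x) //.
rewrite (diffD dz (differentiable_cst x t)) /= diff_cst /= addr0.
by rewrite (diffZl v (@ex_diff _ _ _ _ _ _ _ (is_diff_id t))) diff_val scale1r.
Qed.

Lemma mean_value_line f x v :
  (forall t, 0 <= t <= 1 -> differentiable f (t *: v + x)) ->
  exists2 c, 0 <= c <= 1 & f (v + x) - f x = 'D_v f (c *: v + x).
Proof.
move=> df.
have [||c] := @MVT R (fun t => f (t *: v + x)) (fun t => 'D_v f (t *: v + x)) 0 1 ltr01.
- move=> t; rewrite in_itv /= => /andP[t0 t1].
  by apply: is_derive_line; apply: df; rewrite !ltW.
- apply: derivable_within_continuous => t; rewrite in_itv /= => t01.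
  by have [] := is_derive_line (df t t01).
rewrite in_itv /= => /andP[c0 c1]; rewrite scale1r scale0r add0r subr0 mulr1 => ->.
by exists c => //; rewrite !ltW.
Qed.

Lemma deriveZv (W : normedModType R) (f : V -> W) x v s :
  differentiable f x -> 'D_(s *: v) f x = s *: 'D_v f x.
Proof. by move=> df; rewrite !(deriveE _ df) linearZ. Qed.

Lemma deriveDv (W : normedModType R) (f : V -> W) x u v :
  differentiable f x -> 'D_(u + v) f x = 'D_u f x + 'D_v f x.
Proof. by move=> df; rewrite !(deriveE _ df) linearD. Qed.

Lemma in_ball_segment x u v r s t : 0 <= s <= 1 -> 0 <= t <= 1 -> `|u| + `|v| < r ->
  ball x r (s *: u + (t *: v + x)).
Proof.
move=> /andP[s0 s1] /andP[t0 t1] uv.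
rewrite -ball_normE /= distrC addrA addrK.
apply: le_lt_trans uv; apply: (le_trans (ler_normD _ _)).
by rewrite !normrZ !ger0_norm // lerD // ler_piMl.
Qed.

(** Two mean value steps: in the direction [u] for the increment of [f] along [v], then in the
    direction [v]. The left side is symmetric in [u] and [v], the right side is not visibly so. *)
Lemma second_difference f x u v r : smooth (ball x r) f -> `|u| + `|v| < r ->
  exists2 z, ball x r z &
    f (u + (v + x)) - f (u + x) - f (v + x) + f x = 'D_v (fun y => 'D_u f y) z.
Proof.
move=> sf uv.
have oB : open (ball x r) by exact: ball_open.
have B s t : 0 <= s <= 1 -> 0 <= t <= 1 -> ball x r (s *: u + (t *: v + x)).
  by move=> s01 t01; exact: in_ball_segment.
have i0 : 0 <= (0 : R) <= 1 by rewrite lexx ler01.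
have i1 : 0 <= (1 : R) <= 1 by rewrite lexx ler01.
have d1 t : 0 <= t <= 1 -> differentiable (fun y => f (v + y)) (t *: u + x).
  move=> t01; apply: (@differentiable_comp _ _ _ _ (fun y => v + y) f).
    exact: differentiableD.
  apply: (smooth_differentiable sf).
  by have := B _ _ t01 i1; rewrite scale1r addrCA.
have d0 t : 0 <= t <= 1 -> differentiable f (t *: u + x).
  move=> t01; apply: (smooth_differentiable sf).
  by have := B _ _ t01 i0; rewrite scale0r add0r.
have [t t01] := @mean_value_line (fun y => f (v + y) - f y) x u
  (fun t t01 => differentiableB (d1 t t01) (d0 t t01)).
have D1 : 'D_u (fun y => f (v + y)) (t *: u + x) = 'D_u f (v + (t *: u + x)).
  have := is_derive_line (d1 t t01); have := @is_derive_line _ f (v + x) u t.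
  rewrite [t *: u + (v + x)]addrCA => /(_ _) H1 H2.
  have dd : differentiable f (v + (t *: u + x)).
    apply: (smooth_differentiable sf).
    by have := B _ _ t01 i1; rewrite scale1r addrCA.
  have [_ <-] := H2; have [_ <-] := H1 dd.
  by rewrite (_ : (fun s : R => f (v + _)) = (fun s => f (s *: u + (v + x)))) //;
    apply/funext => s; rewrite addrCA.
rewrite deriveB ?D1; [|exact/diff_derivable/d1|exact/diff_derivable/d0].
have [|s s01 ->] := @mean_value_line (fun y => 'D_u f y) (t *: u + x) v.
  move=> s s01; apply: (smooth_differentiable (smooth_derive u sf)).
  by rewrite addrCA; exact: B.
move=> E; exists (s *: v + (t *: u + x)); first by rewrite addrCA; exact: B.
rewrite -E [u + (v + x)]addrCA; ring.
Qed.

Lemma dist_common_approx (c d A e : R) :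
  `|c - A| < e / 2 -> `|d - A| < e / 2 -> `|c - d| <= e.
Proof.
move=> cA dA; have := ler_normB (c - A) (d - A).
have -> : c - A - (d - A) = c - d by ring.
lra.
Qed.

Lemma near3_ball (P Q S : set V) x : nbhs x P -> nbhs x Q -> nbhs x S ->
  exists2 r, 0 < r & forall y, ball x r y -> [/\ P y, Q y & S y].
Proof.
move=> HP HQ HS; have /nbhs_ballP[r /= r0 H] : nbhs x (P `&` (Q `&` S)).
  by apply: filterI => //; exact: filterI.
by exists r => // y /H[? []].
Qed.

(** The two orders of differentiation, taken at two possibly different points of a small
    parallelogram, both equal the same symmetric second difference; continuity of the second
    derivatives brings both points to [x]. *)
Lemma derive_comm (D : set V) f x u v : open D -> D x -> smooth D f ->
  'D_u (fun y => 'D_v f y) x = 'D_v (fun y => 'D_u f y) x.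
Proof.
move=> oD Dx sf; apply/eqP; rewrite -subr_eq0 -normr_le0; apply/ler_addgt0Pl => e e0.
rewrite addr0.
set a := 'D_u _ x; set b := 'D_v _ x.
have e2 : 0 < e / 2 by rewrite divr_gt0.
have ca : \forall y \near x, `|a - 'D_u (fun y => 'D_v f y) y| < e / 2.
  by have /cvgrPdist_lt/(_ _ e2) := smooth_continuous (smooth_derive u (smooth_derive v sf)) Dx.
have cb : \forall y \near x, `|b - 'D_v (fun y => 'D_u f y) y| < e / 2.
  by have /cvgrPdist_lt/(_ _ e2) := smooth_continuous (smooth_derive v (smooth_derive u sf)) Dx.
have DN : \forall y \near x, D y by exact: open_nbhs_nbhs.
have [r r0 Br] := near3_ball DN ca cb.
(* The parallelogram with sides [s *: u] and [s *: v] then stays in the ball; adding 1 keeps the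
   denominator positive when both vectors vanish. *)
pose s := r / 2 / (`|u| + `|v| + 1).
have n0 : 0 < `|u| + `|v| + 1 by rewrite ltr_wpDl // addr_ge0.
have s0 : 0 < s by rewrite !divr_gt0.
have sr : `|s *: u| + `|s *: v| < r.
  rewrite !normrZ !gtr0_norm // -mulrDr (@le_lt_trans _ _ (r / 2)) //; last by lra.
  by rewrite /s mulrAC ler_pdivrMr // ler_pM2l; lra.
have oB : open (ball x r) by exact: ball_open.
have sfB : smooth (ball x r) f by apply: smooth_sub sf => y /Br[].
have scale w1 w2 z : ball x r z ->
    'D_(s *: w2) (fun y => 'D_(s *: w1) f y) z = s * s * 'D_w2 (fun y => 'D_w1 f y) z.
  move=> Bz; have d2 := smooth_differentiable (smooth_derive w1 sfB) Bz.
  rewrite (@near_eq_derive _ _ _ _ (fun y => s *: 'D_w1 f y)); last first.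
    apply: open_near oB Bz _ => y; rewrite inE => By.
    exact/deriveZv/(smooth_differentiable sfB By).
  rewrite (deriveZv _ _ (differentiableZ s d2)) deriveZ; last exact: diff_derivable.
  by rewrite -mulrA.
have [z1 B1 E1] := second_difference sfB sr.
have sr' : `|s *: v| + `|s *: u| < r by rewrite addrC.
have [z2 B2 E2] := second_difference sfB sr'.
have : 'D_u (fun y => 'D_v f y) z2 = 'D_v (fun y => 'D_u f y) z1.
  have ss0 : s * s != 0 by rewrite mulf_neq0 // gt_eqF.
  have e1 := scale u v z1 B1; have e2' := scale v u z2 B2.
  apply: (mulfI ss0); apply: (eq_trans (esym e2')); apply: (eq_trans _ e1).
  apply: (eq_trans (esym E2)); apply: (eq_trans _ E1).
  by rewrite [s *: v + (s *: u + x)]addrCA; congr (_ + _); rewrite addrAC.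
have [_ _ b1] := Br _ B1; have [_ a2 _] := Br _ B2 => AB.
by rewrite AB in a2; exact: dist_common_approx a2 b1.
Qed.

End MeanValue.

Lemma near_open_comp (T U : topologicalType) (F : T -> U) (W : set U) x :
  {for x, continuous F} -> open W -> W (F x) -> \forall y \near x, W (F y).
Proof. by move=> c oW Wx; exact: (c _ (open_nbhs_nbhs (conj oW Wx))). Qed.

Section RowNorm.
Context {R : realType} {k : nat}.
Implicit Types (x : 'rV[R]_k).

Lemma norm_coord_le x j : `|x 0 j| <= `|x|.
Proof. by rewrite [leRHS]/Num.Def.normr /= mx_normrE; exact: (le_bigmax _ _ (0, j)). Qed.

Lemma rV_norm_le x r : 0 <= r -> (forall j, `|x 0 j| <= r) -> `|x| <= r.
Proof.
move=> r0 H; rewrite [leLHS]/Num.Def.normr /= mx_normrE bigmax_le // => -[i j] _ /=.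
by rewrite (ord1 i).
Qed.

Lemma derive_row_sum (W : normedModType R) (f : 'rV[R]_k -> W) x v : differentiable f x ->
  'D_v f x = \sum_j v 0 j *: 'D_(delta_mx 0 j) f x.
Proof.
move=> df; rewrite (deriveE _ df) {1}[v]row_sum_delta raddf_sum.
by apply: eq_bigr => j _; rewrite [LHS]linearZ (deriveE _ df).
Qed.

End RowNorm.

Lemma derive_coord (R : realType) (V : normedModType R) m n (f : V -> 'M[R]_(m, n)) x v i j :
  derivable f x v -> ('D_v f x) i j = 'D_v (fun y => f y i j) x.
Proof. by move=> df; rewrite derive_mx // mxE. Qed.

Lemma unitmx_injective (K : fieldType) n (A : 'M[K]_n) :
  (forall v : 'rV_n, v *m A = 0 -> v = 0) -> A \in unitmx.
Proof.
move=> H; rewrite -row_free_unit -kermx_eq0; apply/eqP/row_matrixP => i.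
by rewrite row0; apply: H; rewrite -row_mul mulmx_ker row0.
Qed.

Lemma derive_mulmx (R : realType) (V : normedModType R) m n k (f : V -> 'M[R]_(m, n))
    (A : 'M[R]_(n, k)) x v :
  differentiable f x -> 'D_v (fun y => f y *m A) x = 'D_v f x *m A.
Proof.
move=> df; have := @diff_comp _ _ _ _ f (mulmxr A) x df.
have lc : continuous (mulmxr A : {linear 'M[R]_(m, n) -> 'M[R]_(m, k)}) by exact: mulmxr_continuous.
have dl := linear_differentiable (f x) lc.
move=> /(_ dl) E; have dc := differentiable_comp df dl.
by rewrite (deriveE _ dc) E /= (diff_lin _ lc) (deriveE _ df).
Qed.

(* Joins completeness with the norm: the contraction principle asks for a
   completeNormedModType. *)
HB.instance Definition _ (R : realType) m n :=
  Uniform_isComplete.Build 'M[R]_(m, n) cauchy_cvg.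

(** * Inverse function theorem *)

Section InverseFunction.
Context {R : realType} {k : nat}.
Local Notation rV := 'rV[R]_k.

Definition partials (F : rV -> rV) (x : rV) : 'M[R]_k := \matrix_i 'D_(delta_mx 0 i) F x.

Lemma mul_partials (F : rV -> rV) x v : differentiable F x -> v *m partials F x = 'D_v F x.
Proof.
move=> dF; rewrite (derive_row_sum v dF) mulmx_sum_row.
by apply: eq_bigr => i _; rewrite rowK.
Qed.

Lemma partials_unitmx (F : rV -> rV) x : differentiable F x ->
  (forall v, 'D_v F x = 0 -> v = 0) -> partials F x \in unitmx.
Proof. by move=> dF H; apply: unitmx_injective => v; rewrite mul_partials //; exact: H. Qed.

Lemma smooth_partials (D : set rV) (F : rV -> rV) : open D -> smooth D F -> smooth D (partials F).
Proof.
move=> oD sF; apply: smooth_mx => // i j; under eq_fun do rewrite mxE.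
by apply: smooth_coord => //; exact: smooth_derive.
Qed.

Lemma ball_convex (p x y : rV) r t : ball p r x -> ball p r y -> 0 <= t <= 1 ->
  ball p r (t *: (x - y) + y).
Proof.
rewrite -!ball_normE /= => Bx By /andP[t0 t1].
rewrite (_ : p - _ = t *: (p - x) + (1 - t) *: (p - y)); last first.
  by rewrite !scalerBr !scalerBl !scale1r; apply/rowP => i; rewrite !mxE; ring.
apply: (le_lt_trans (ler_normD _ _)); rewrite !normrZ !ger0_norm ?subr_ge0 //.
have [->|t00] := eqVneq t 0; first by rewrite mul0r add0r subr0 mul1r.
have tp : 0 < t by rewrite lt_def t00.
have : t * `|p - x| < t * r by rewrite ltr_pM2l.
have : (1 - t) * `|p - y| <= (1 - t) * r by rewrite ler_wpM2l ?subr_ge0 // ltW.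
lra.
Qed.

(** In the sup norm, [k] partial derivatives bounded by 1 / (2 (k + 1)) contribute at most one half.
    Taking [k.+1] keeps the bound positive also for [k = 0]. *)
Lemma lipschitz_ball (G : rV -> rV) p r : smooth (ball p r) G ->
  (forall x i j, ball p r x -> `|('D_(delta_mx 0 i) G x) 0 j| <= (2 * k.+1%:R)^-1) ->
  (forall x v, ball p r x -> `|'D_v G x| <= 2^-1 * `|v|) /\
  (forall x y, ball p r x -> ball p r y -> `|G x - G y| <= 2^-1 * `|x - y|).
Proof.
move=> sG HG.
have Hc x v j : ball p r x -> `|('D_v G x) 0 j| <= 2^-1 * `|v|.
  move=> Bx; rewrite (derive_row_sum v (smooth_differentiable sG Bx)) summxE.
  apply: (le_trans (ler_norm_sum _ _ _)).
  apply: (@le_trans _ _ (\sum_(i < k) `|v| * (2 * k.+1%:R)^-1)).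
    apply: ler_sum => i _; rewrite mxE normrM ler_pM //; first exact: norm_coord_le.
    exact: HG.
  rewrite sumr_const card_ord.
  rewrite (_ : _ *+ k = (2^-1 * `|v|) * (k%:R / k.+1%:R)).
    by rewrite ler_piMr ?mulr_ge0 ?invr_ge0 // ler_pdivrMr ?ltr0n // mul1r ler_nat.
  by rewrite -mulr_natr; field; rewrite ?pnatr_eq0 //= -natr1 ?paddr_eq0 //; apply/andP.
split=> [x v Bx|x y Bx By].
  by apply: rV_norm_le; [rewrite mulr_ge0 ?invr_ge0|move=> j; exact: Hc].
apply: rV_norm_le; first by rewrite mulr_ge0 ?invr_ge0.
move=> j; rewrite !mxE.
have oB : open (ball p r) by exact: ball_open.
have sGj := smooth_coord 0 j oB sG.
have [|c c01] := @mean_value_line _ _ (fun z => G z 0 j) y (x - y).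
  by move=> t t01; apply: (smooth_differentiable sGj); exact: ball_convex.
rewrite subrK => ->.
have Bz := ball_convex Bx By c01.
rewrite -derive_coord; first exact: Hc.
by apply: diff_derivable; exact: (smooth_differentiable sG Bz).
Qed.

(** After composition with the inverse differential at [p], the map is the identity minus a map [G]
    that contracts by one half near [p]. Solving F x = z then means finding the fixed point of x ->
    z L + G x. *)
Theorem inverse_function (D : set rV) (F : rV -> rV) p : open D -> D p -> smooth D F ->
  (forall v, 'D_v F p = 0 -> v = 0) ->
  exists (V W : set rV) (psi : rV -> rV),
    [/\ [/\ open V, open W, smooth V F & smooth W psi],
        (forall q, V q -> W (F q) /\ psi (F q) = q),
        (forall z, W z -> V (psi z) /\ F (psi z) = z),
        V p & V `<=` D].
Proof.
move=> oD Dp sF injF.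
have dF x : D x -> differentiable F x by move=> Dx; exact: (smooth_differentiable sF Dx).
have uJ := partials_unitmx (dF p Dp) injF.
set L := invmx (partials F p).
pose Ft x := F x *m L.
pose G x := x - Ft x.
have sFt : smooth D Ft by apply: smooth_mulmx => //; exact: smooth_cst.
have sG : smooth D G.
  apply: smooth_mx => // i j; under eq_fun do rewrite mxE [X in _ + X]mxE.
  by apply: smoothB => //; apply: smooth_coord => //; exact: smooth_id.
have DG x v : D x -> 'D_v G x = v - 'D_v F x *m L.
  move=> Dx; have dFt := smooth_differentiable sFt Dx.
  rewrite -(derive_mulmx L v (dF x Dx)) -{2}(derive_id x v).
  by rewrite -deriveB //; exact: diff_derivable.
have DGp v : 'D_v G p = 0.
  by rewrite DG // -mul_partials ?mulmxK ?subrr //; exact: dF.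
pose eps : R := (2 * k.+1%:R)^-1.
have eps0 : 0 < eps by rewrite invr_gt0 mulr_gt0 ?ltr0n.
have nG : \forall x \near p, forall i j, `|('D_(delta_mx 0 i) G x) 0 j| < eps.
  apply: (@filter_forall _ _ _ (nbhs p)) => i; apply: (@filter_forall _ _ _ (nbhs p)) => j.
  have /cvgrPdist_lt/(_ _ eps0) := smooth_continuous (smooth_coord 0 j oD (smooth_derive (delta_mx 0 i) sG)) Dp.
  by apply: filterS => x; rewrite DGp mxE sub0r normrN.
have /nbhs_ballP[r /= r0 Br] : nbhs p (D `&` [set x | forall i j, `|('D_(delta_mx 0 i) G x) 0 j| < eps]).
  by apply: filterI => //; exact: open_nbhs_nbhs.
have BD : ball p r `<=` D by move=> x /Br[].
have sGB := smooth_sub BD sG.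
have [lipD lipG] := lipschitz_ball sGB (fun x i j Bx => ltW ((Br x Bx).2 i j)).
have FtG x : Ft x = x - G x by rewrite /G opprB addrC subrK.
have lipF x y : ball p r x -> ball p r y -> `|x - y| <= 2 * `|Ft x - Ft y|.
  move=> Bx By; have := lipG x y Bx By.
  have : `|x - y| <= `|Ft x - Ft y| + `|G x - G y|.
    apply: le_trans (ler_normD _ _).
    rewrite (_ : x - y = (Ft x - Ft y) + (G x - G y)) //.
    by rewrite !FtG; apply/rowP => j; rewrite !mxE; ring.
  lra.
(* A quarter of the radius: with the contraction by one half, the map x -> z L + G x sends the
   closed ball of radius r / 2 to itself, as r / 4 + (1 / 2) (r / 2) = r / 2. *)
pose W := [set z : rV | `|Ft p - z *m L| < r / 4].
have oW : open W.
  rewrite openE => z Wz; rewrite /interior.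
  have c : {for z, continuous (fun z : rV => `|Ft p - z *m L|)}.
    apply: continuous_comp; last exact: norm_continuous.
    apply: continuousB; first exact: cst_continuous.
    exact: mulmxr_continuous.
  exact: near_open_comp c (@open_lt R (r / 4)) Wz.
pose V := [set x : rV | ball p r x /\ W (F x)].
have VD : V `<=` D by move=> x [/BD].
have pV : V p.
  by split; [exact: ballxx|rewrite /W /= -/(Ft p) subrr normr0 divr_gt0].
have oV : open V.
  rewrite openE => x [Bx Wx]; rewrite /interior; apply: filterI.
    by apply: open_nbhs_nbhs; split => //; exact: ball_open.
  exact: near_open_comp (differentiable_continuous (dF x (BD _ Bx))) oW Wx.
have ex_psi z : exists x, W z -> ball p r x /\ F x = z.
  (* Off [W] the value 0 is arbitrary; [choice] asks for a total function. *)
  have [Wz|nWz] := pselect (W z); last by exists 0.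
  pose B := [set x : rV | `|p - x| <= r / 2].
  have BB x : B x -> ball p r x.
    by rewrite -ball_normE /B /= => /le_lt_trans; apply; lra.
  have TB x : B x -> B (z *m L + G x).
    rewrite /B /= => Bx.
    have -> : p - (z *m L + G x) = (Ft p - z *m L) + (G p - G x).
      by rewrite FtG; apply/rowP => j; rewrite !mxE; ring.
    apply: (le_trans (ler_normD _ _)).
    have := lipG p x (ballxx _ r0) (BB _ Bx); move: Wz; rewrite /W /=; lra.
  have funT : set_fun B B (fun x => z *m L + G x) by exact: TB.
  pose T : {fun B >-> B} := HB.pack (fun x => z *m L + G x) (isFun.Build _ _ _ _ _ funT).
  have cT : is_contraction T.
    exists (2^-1)%:nng; split; first by rewrite /=; lra.
    move=> [x y] [/= Bx By]; rewrite opprD addrACA subrr add0r.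
    exact: lipG (BB _ Bx) (BB _ By).
  have cB : closed B.
    have -> : B = (fun x => `|p - x|) @^-1` [set t | t <= r / 2] by [].
    apply: preimage_closed; last exact: closed_le.
    move=> x _; apply: continuous_comp; last exact: norm_continuous.
    by apply: continuousB; first exact: cst_continuous.
  have [|x Bx Tx] := banach_fixed_point cT cB.
    by exists p; rewrite /B /= subrr normr0 divr_ge0 // ltW.
  exists x => _; split; first exact: BB.
  have : Ft x = z *m L by rewrite FtG {1}Tx /= addrK.
  by move/(congr1 (mulmx^~ (partials F p))); rewrite /Ft /L !mulmxKV.
have [psi psiP] := choice ex_psi.
have psiF x : V x -> psi (F x) = x.
  move=> [Bx Wx]; have [By E] := psiP _ Wx.
  apply/eqP; rewrite -subr_eq0 -normr_le0.
  by apply: le_trans (lipF _ _ By Bx) _; rewrite /Ft E subrr normr0 mulr0.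
have psiB z : W z -> ball p r (psi z) by move=> /psiP[].
have Fpsi z : W z -> F (psi z) = z by move=> /psiP[].
have lcL : continuous (mulmxr L : {linear rV -> rV}) by exact: mulmxr_continuous.
have [C C0 HC] := linear_lipschitz lcL.
have lip_psi z w : W z -> W w -> `|psi z - psi w| <= 2 * C * `|z - w|.
  move=> Wz Ww; apply: le_trans (lipF _ _ (psiB _ Wz) (psiB _ Ww)) _.
  by rewrite /Ft !Fpsi // -mulrA ler_pM2l // -mulmxBl; exact: HC.
(* If the differential of [F] at [x] kills v, then that of [G] fixes v, and the bound by one half
   forces v = 0. *)
have uP x : ball p r x -> partials F x \in unitmx.
  move=> Bx; apply: partials_unitmx; first exact/dF/BD.
  move=> v E; have := lipD x v Bx; rewrite DG ?E ?mul0mx ?subr0; last exact: BD.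
  by move=> H; apply/eqP; rewrite -normr_le0; lra.
have dpsi z : W z -> differentiable psi z /\
    (forall v, 'D_v psi z = v *m invmx (partials F (psi z))).
  move=> Wz; set x := psi z; have Bx := psiB _ Wz.
  set K := invmx (partials F x).
  have lcK : continuous (mulmxr K : {linear rV -> rV}) by exact: mulmxr_continuous.
  have [C' C'0 HC'] := linear_lipschitz lcK.
  have algK (a b : rV) : a - b *m K = (a *m partials F x - b) *m K.
    by rewrite mulmxBl (mulmxK (uP _ Bx)).
  have bound e : 0 < e ->
      \forall v \near (0 : rV), `|psi (v + z) - psi z - mulmxr K v| <= e * `|v|.
    (* The map [psi] is Lipschitz with constant 2 C, and multiplication by the inverse differential
       costs C'; dividing by both makes the final error exactly [e]. *)
    move=> e0; pose e' := e / (C' * (2 * C)).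
    have e'0 : 0 < e' by rewrite divr_gt0 // !mulr_gt0.
    have := differential_bound (dF x (BD _ Bx)) e'0.
    move=> /nbhs_ballP[d /= d0 Hd].
    have nW : \forall v \near (0 : rV), W (v + z).
      have : \forall y \near z, W y by exact: open_nbhs_nbhs.
      by rewrite (near_shift 0 z) subr0.
    have nd : \forall v \near (0 : rV), `|v| < d / (2 * C).
      have c := @norm_continuous _ rV 0.
      apply: (near_open_comp c (@open_lt R (d / (2 * C)))).
      by rewrite /= normr0 divr_gt0 // mulr_gt0.
    near=> v.
    have Wv : W (v + z) by near: v.
    have vd : `|v| < d / (2 * C) by near: v.
    set h := psi (v + z) - psi z.
    have hv : `|h| <= 2 * C * `|v|.
      by have := lip_psi _ _ Wv Wz; rewrite addrK.
    have hd : ball (0 : rV) d h.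
      rewrite -ball_normE /= sub0r normrN (le_lt_trans hv) //.
      by move: vd; rewrite ltr_pdivlMr ?mulr_gt0 // mulrC.
    have := Hd h hd; rewrite /= /h -/x subrK Fpsi // /x Fpsi // addrK -/x -/h.
    rewrite -(deriveE _ (dF x (BD _ Bx))) -mul_partials; last exact/dF/BD.
    move=> Hv.
    rewrite /= algK; apply: (le_trans (HC' _)); rewrite distrC.
    apply: (@le_trans _ _ (C' * (e' * `|h|))); first by rewrite ler_pM2l.
    apply: (@le_trans _ _ (C' * (e' * (2 * C * `|v|)))); first by rewrite !ler_pM2l.
    by rewrite /e' le_eqVlt; apply/orP; left; apply/eqP; field; rewrite !gt_eqF.
  have dz : differentiable psi z := differentiable_linear_bound lcK bound.
  split=> // v; have Wn : \near z, F (psi z) = z.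
    by have := open_nbhs_nbhs (conj oW Wz); apply: filterS => w /Fpsi.
  have dFx := dF x (BD _ Bx).
  have E : v = 'D_v psi z *m partials F x.
    have E1 := near_eq_derive v Wn.
    rewrite -[LHS](derive_id z v) -E1 (mul_partials _ dFx).
    exact: derive_comp dz dFx.
  by rewrite {2}E (mulmxK (uP _ Bx)).
(* Bootstrapping: the derivative of [psi] is a smooth function of [psi], so each order for [psi]
   gives the next. *)
have spsi : smooth W psi.
  move=> n; elim: n => [|n IH]; first by move=> z /dpsi[/differentiable_continuous].
  split=> [z /dpsi[]//|v].
  apply: (@Cn_ext _ _ _ _ _ (fun z => v *m invmx (partials F (psi z)))) => //.
    by move=> z; rewrite inE => /dpsi[_ ->].
  have oB : open (ball p r) by exact: ball_open.
  have sK : smooth (ball p r) (fun x => v *m invmx (partials F x)).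
    apply: smooth_mulmx => //; first exact: smooth_cst.
    by apply: smooth_invmx => //; apply: smooth_sub BD _; exact: smooth_partials.
  apply: Cn_mx => // i j.
  exact: (Cn_comp_rV oW psiB IH (smooth_coord i j oB sK n)).
exists V, W, psi; split=> //.
- by split=> //; exact: smooth_sub sF.
- by move=> q Vq; split; [case: Vq|exact: psiF].
- move=> z Wz; split; last exact: Fpsi.
  by split; [exact: psiB|rewrite Fpsi].
Unshelve. all: by end_near. Qed.


End InverseFunction.

(** * Hadamard division *)

Lemma continuous_norm_comp (R : realType) (V W : normedModType R) (g : V -> W) z :
  {for z, continuous g} -> {for z, continuous (fun x => `|g x|)}.
Proof. by move=> cg; apply: continuous_comp => //; exact: norm_continuous. Qed.

(** * Integrals over the unit interval *)

Section Integral01.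
Context {R : realType}.
Local Notation mu := (@lebesgue_measure R).
Implicit Types (g h : R -> R).

Definition continuous01 g := forall t, 0 <= t <= 1 -> {for t, continuous g}.

Definition int01 g : R := \int[mu]_(t in `[0, 1]) g t.

Lemma continuous01_within g : continuous01 g -> {within `[0, 1], continuous g}.
Proof. by move=> cg; apply: continuous_in_subspaceT => t; rewrite inE /= in_itv; exact: cg. Qed.

Lemma integrable01 g : continuous01 g -> mu.-integrable `[0, 1] (EFin \o g).
Proof.
by move=> /continuous01_within; apply: continuous_compact_integrable; exact: segment_compact.
Qed.

Lemma int01D g h : continuous01 g -> continuous01 h ->
  int01 (fun t => g t + h t) = int01 g + int01 h.
Proof. by move=> cg ch; rewrite /int01 RintegralD //; exact: integrable01. Qed.

Lemma int01Z a g : continuous01 g -> int01 (fun t => a * g t) = a * int01 g.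
Proof. by move=> cg; rewrite /int01 RintegralZl //; exact: integrable01. Qed.

Lemma continuous01D g h : continuous01 g -> continuous01 h -> continuous01 (fun t => g t + h t).
Proof. by move=> cg ch t t01; apply: continuousD; [exact: cg|exact: ch]. Qed.

Lemma continuous01Z a g : continuous01 g -> continuous01 (fun t => a * g t).
Proof. by move=> cg t t01; apply: continuousM; [exact: cst_continuous|exact: cg]. Qed.

Lemma eq_int01 g h : (forall t, 0 <= t <= 1 -> g t = h t) -> int01 g = int01 h.
Proof. by move=> gh; apply: eq_Rintegral => t; rewrite inE /= in_itv; exact: gh. Qed.

Lemma continuous01_sum (I : Type) (r : seq I) (P : pred I) (g : I -> R -> R) :
  (forall i, continuous01 (g i)) -> continuous01 (fun t => \sum_(i <- r | P i) g i t).
Proof.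
move=> cg; elim: r => [|i r IH].
  rewrite (_ : (fun t => _) = cst 0); first by move=> t _; exact: cst_continuous.
  by apply/funext => t; rewrite big_nil.
rewrite (_ : (fun t => _) = fun t => if P i then g i t + \sum_(j <- r | P j) g j t
    else \sum_(j <- r | P j) g j t); last by apply/funext => t; rewrite big_cons.
by case: (P i) => // t t01; apply: continuousD; [exact: cg|exact: IH].
Qed.

Lemma int01_sum (I : Type) (r : seq I) (g : I -> R -> R) :
  (forall i, continuous01 (g i)) ->
  int01 (fun t => \sum_(i <- r) g i t) = \sum_(i <- r) int01 (g i).
Proof.
move=> cg; elim: r => [|i r IH].
  rewrite big_nil -[RHS](mul0r (int01 (cst 1))) -int01Z.
    by apply: eq_int01 => t _; rewrite big_nil mul0r.
  by move=> t _; exact: cst_continuous.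
rewrite big_cons -IH -int01D //; last exact: continuous01_sum.
by apply: eq_int01 => t _; rewrite big_cons.
Qed.

Lemma int01_bound g C : continuous01 g -> (forall t, 0 <= t <= 1 -> `|g t| <= C) ->
  `|int01 g| <= C.
Proof.
move=> cg gC; apply: (le_trans (le_normr_Rintegral _ (integrable01 cg))) => //.
have cC : mu.-integrable `[0, 1] (EFin \o cst C).
  by apply: integrable01 => t _; exact: cst_continuous.
apply: (@le_trans _ _ (\int[mu]_(t in `[0, 1]) (cst C t))).
  apply: le_Rintegral => //.
    by apply: integrable01 => t t01; apply: continuous_comp; [exact: cg|exact: norm_continuous].
by rewrite Rintegral_cst //= lebesgue_measure_itv /= lte_fin ltr01 -EFinD subr0 mulr1.
Qed.

Lemma int01_FTC (g dg : R -> R) : (forall t : R, 0 <= t <= 1 -> is_derive t 1 g (dg t)) ->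
  continuous01 dg -> int01 dg = g 1 - g 0.
Proof.
move=> Dg cdg.
have cg t : 0 <= t <= 1 -> {for t, continuous g}.
  by move=> /Dg[+ _] => /derivable1_diffP/differentiable_continuous.
rewrite /int01 /Rintegral (@continuous_FTC2 _ _ g) //.
- exact: continuous01_within.
- split.
  + by move=> t; rewrite in_itv /= => /andP[t0 t1]; have [] := Dg t; rewrite ?ltW.
  + by apply: cvg_at_right_filter; apply: cg; rewrite lexx ler01.
  + by apply: cvg_at_left_filter; apply: cg; rewrite lexx ler01.
- by move=> t; rewrite in_itv /= => /andP[t0 t1]; have [|_ <-] := Dg t; rewrite ?ltW // derive1E.
Qed.

End Integral01.

(** * Division by a coordinate *)

Section Hadamard.
Context {R : realType} {k : nat} (i : 'I_k) (r : R).
Local Notation rV := 'rV[R]_k.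
Local Notation B := (ball (0 : rV) r).
Local Notation e_ j := (delta_mx 0 j : rV).
Implicit Types (f g : rV -> R) (q x u v : rV).

Let oB : open B. Proof. exact: ball_open. Qed.

Lemma ball0E x : B x = (`|x| < r) :> Prop.
Proof. by rewrite -ball_normE /= sub0r normrN. Qed.

(** Compactness of the closed ball bounds each second partial derivative, and the sum of the bounds
    serves all directions. This uniformity is what differentiation under the integral sign rests
    on. *)
Lemma bounded_second_derivative f rho : 0 <= rho -> rho < r -> smooth B f ->
  exists2 C, 0 <= C & forall z u, `|z| <= rho -> `|'D_u (fun x => 'D_u f x) z| <= C * (`|u| * `|u|).
Proof.
move=> rho0 rhor sf.
pose K := [set x : rV | `|x| <= rho].
have KB x : K x -> B x by rewrite ball0E => /le_lt_trans; apply.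
have cK : compact K.
  apply: bounded_closed_compact.
    exists rho; split; first exact: num_real.
    by move=> M rM x /= /le_trans; apply; exact: ltW.
  have -> : K = (fun x => `|x|) @^-1` [set t | t <= rho] by [].
  by apply: preimage_closed; [move=> x _; exact: norm_continuous | exact: closed_le].
have K0 : K !=set0 by exists 0; rewrite /K /= normr0.
have bd a b : exists2 C, 0 <= C &
    forall z, K z -> `|'D_(e_ b) (fun x => 'D_(e_ a) f x) z| <= C.
  pose G z := `|'D_(e_ b) (fun x => 'D_(e_ a) f x) z|.
  have cG : {within K, continuous G}.
    apply: continuous_in_subspaceT => z; rewrite inE => /KB Bz.
    have cz := smooth_continuous (smooth_derive (e_ b) (smooth_derive (e_ a) sf)) Bz.
    exact: (continuous_norm_comp cz).
  have [c _ Hc] := EVT_max_rV K0 cK cG.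
  by exists (G c); [exact: normr_ge0|move=> z Kz; apply: Hc; rewrite inE].
pose C a b := s2val (cid2 (bd a b)).
have C0 a b : 0 <= C a b by exact: (s2valP (cid2 (bd a b))).
have HC a b z : K z -> `|'D_(e_ b) (fun x => 'D_(e_ a) f x) z| <= C a b.
  exact: (s2valP' (cid2 (bd a b))).
exists (\sum_a \sum_b C a b).
  by apply: sumr_ge0 => a _; apply: sumr_ge0 => b _.
move=> z u Kz; have Bz := KB z Kz.
rewrite (derive_row_sum u (smooth_differentiable (smooth_derive u sf) Bz)).
apply: (le_trans (ler_norm_sum _ _ _)); rewrite exchange_big /= mulr_suml.
apply: ler_sum => b _.
have -> : 'D_(e_ b) (fun x => 'D_u f x) z = \sum_a u 0 a * 'D_(e_ b) (fun x => 'D_(e_ a) f x) z.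
  rewrite (@near_eq_derive _ _ _ _ (fun x => \sum_a u 0 a * 'D_(e_ a) f x)); last first.
    apply: open_near oB Bz _ => x; rewrite inE => Bx.
    by rewrite (derive_row_sum u (smooth_differentiable sf Bx)).
  have da a : derivable (fun x => 'D_(e_ a) f x) z (e_ b).
    exact/diff_derivable/(smooth_differentiable (smooth_derive (e_ a) sf) Bz).
  rewrite (_ : (fun x => \sum_a _) = \sum_a (fun x => u 0 a * 'D_(e_ a) f x)); last first.
    by apply/funext => x; rewrite fct_sumE.
  rewrite derive_sum; last by move=> a; exact: (derivableZ (k := u 0 a) (da a)).
  by apply: eq_bigr => a _; exact: (deriveZ (u 0 a) (da a)).
rewrite normrZ [leRHS]mulrCA; apply: ler_pM => //; first exact: norm_coord_le.
rewrite mulr_suml.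
apply: (le_trans (ler_norm_sum _ _ _)); apply: ler_sum => a _.
by rewrite normrM mulrC ler_pM // ?norm_coord_le // HC.
Qed.

Lemma segment_norm x u t rho : `|x| <= rho -> `|u + x| <= rho -> 0 <= t <= 1 ->
  `|t *: u + x| <= rho.
Proof.
move=> xr ur /andP[t0 t1].
have -> : t *: u + x = t *: (u + x) + (1 - t) *: x.
  by apply/rowP => j; rewrite !mxE; ring.
apply: (le_trans (ler_normD _ _)); rewrite !normrZ !ger0_norm ?subr_ge0 //.
have h1 : t * `|u + x| <= t * rho by rewrite ler_wpM2l.
have h2 : (1 - t) * `|x| <= (1 - t) * rho by rewrite ler_wpM2l ?subr_ge0.
by have := lerD h1 h2; rewrite -mulrDl [t + _]addrC subrK mul1r.
Qed.

(** Two mean value steps stand in for the integral remainder, hence no factor one half. *)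
Lemma taylor2_bound f rho C x u : smooth B f -> rho < r -> 0 <= C ->
  (forall z u, `|z| <= rho -> `|'D_u (fun x => 'D_u f x) z| <= C * (`|u| * `|u|)) ->
  `|x| <= rho -> `|u + x| <= rho -> `|f (u + x) - f x - 'D_u f x| <= C * (`|u| * `|u|).
Proof.
move=> sf rr C0 HC xr uxr.
have seg t : 0 <= t <= 1 -> B (t *: u + x).
  by move=> t01; rewrite ball0E; apply: le_lt_trans rr; exact: segment_norm.
have [|c c01 ->] := @mean_value_line _ _ f x u.
  by move=> t t01; exact: (smooth_differentiable sf (seg t t01)).
have [c0 c1] := andP c01.
have sc t : 0 <= t <= 1 -> 0 <= t * c <= 1.
  by move=> /andP[t0 t1]; rewrite mulr_ge0 //= -[leRHS]mulr1 ler_pM.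
have dD y : B y -> differentiable (fun y => 'D_u f y) y.
  by move=> By; exact: (smooth_differentiable (smooth_derive u sf) By).
have [|d d01 ->] := @mean_value_line _ _ (fun y => 'D_u f y) x (c *: u).
  by move=> t t01; rewrite scalerA; apply: dD; apply: seg; exact: sc.
rewrite scalerA deriveZv; last by apply: dD; apply: seg; exact: sc.
rewrite normrZ ger0_norm //; apply: le_trans (HC _ u (segment_norm xr uxr (sc d d01))).
by rewrite ler_piMl.
Qed.

(** Multiplication of the [i]-th coordinate by [t]: as [t] runs from 0 to 1, a segment from the
    projection of [q] onto the hyperplane where that coordinate vanishes to [q] itself. *)
Definition squeeze (t : R) q : rV := q + ((t - 1) * q 0 i) *: e_ i.

Lemma squeeze_line t q : squeeze t q = t *: (q 0 i *: e_ i) + (q - q 0 i *: e_ i).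
Proof. by apply/rowP => j; rewrite !mxE; ring. Qed.

Lemma squeezeE t q j : (squeeze t q) 0 j = (if j == i then t else 1) * q 0 j.
Proof.
rewrite !mxE eqxx /=; case: eqVneq => [->|ji] /=; rewrite ?mulr1n ?mulr0n; ring.
Qed.

Lemma squeezeD t q v : squeeze t (v + q) = squeeze t v + squeeze t q.
Proof. by apply/rowP => j; rewrite !mxE; ring. Qed.

Lemma squeeze_norm t q : 0 <= t <= 1 -> `|squeeze t q| <= `|q|.
Proof.
move=> /andP[t0 t1]; apply: rV_norm_le => // j; rewrite squeezeE normrM.
apply: le_trans (norm_coord_le q j); rewrite ler_piMl //.
by case: ifP => _; rewrite ?normr1 // ger0_norm.
Qed.

Lemma squeeze_ball t q : 0 <= t <= 1 -> B q -> B (squeeze t q).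
Proof. by rewrite !ball0E => t01; apply: le_lt_trans; exact: squeeze_norm. Qed.

Lemma is_derive_squeeze f q (t : R) : smooth B f -> B q -> 0 <= t <= 1 ->
  is_derive t 1 (fun s => f (squeeze s q)) (q 0 i * 'D_(e_ i) f (squeeze t q)).
Proof.
move=> sf Bq t01; have Bt := squeeze_ball t01 Bq.
have df := smooth_differentiable sf Bt.
have -> : (fun s => f (squeeze s q)) =
    (fun s => f (s *: (q 0 i *: e_ i) + (q - q 0 i *: e_ i))).
  by apply/funext => s; rewrite squeeze_line.
have := @is_derive_line _ _ _ f (q - q 0 i *: e_ i) (q 0 i *: e_ i) t.
rewrite -squeeze_line => /(_ df); rewrite (deriveZv _ _ df); exact.
Qed.

Lemma continuous01_squeeze f q m : smooth B f -> B q ->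
  continuous01 (fun t => t ^+ m * f (squeeze t q)).
Proof.
move=> sf Bq t t01; apply: continuousM; first exact: exprn_continuous.
have [+ _] := is_derive_squeeze sf Bq t01.
by move=> /derivable1_diffP/differentiable_continuous.
Qed.

(** The Hadamard quotient is the case [m = 0] applied to a partial derivative. The weights make the
    family closed under differentiation: differentiating in the squeezed coordinate produces one
    more factor [t]. *)
Definition moment m f q := int01 (fun t => t ^+ m * f (squeeze t q)).

Definition moment_partial m f q : 'cV[R]_k :=
  \col_j moment (if j == i then m.+1 else m) (fun x => 'D_(e_ j) f x) q.

(** Differentiation under the integral sign: the integrand has a quadratic Taylor remainder bounded
    uniformly in [t], because squeezing does not increase the norm. *)
Lemma moment_differential m f q : smooth B f -> B q ->
  differentiable (moment m f) q /\
  forall v, 'D_v (moment m f) q = (v *m moment_partial m f q) 0 0.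
Proof.
move=> sf Bq.
pose L : {linear rV -> R} := coord_mx 0 0 \o mulmxr (moment_partial m f q).
have cL : continuous L.
  by move=> v; apply: continuous_comp; [exact: mulmxr_continuous|exact: coord_mx_continuous].
suff H e : 0 < e -> \forall v \near (0 : rV),
    `|moment m f (v + q) - moment m f q - L v| <= e * `|v|.
  split; first exact: differentiable_linear_bound cL H.
  by move=> v; exact: derive_linear_bound cL H.
move=> e0.
(* Half-way between the norm of [q] and [r], leaving room for the increment inside a closed ball on
   which second derivatives are bounded. *)
pose rho := (`|q| + r) / 2.
have Bq' : `|q| < r by rewrite -ball0E.
have q0 : 0 <= `|q| := normr_ge0 q.
have rho0 : 0 <= rho by rewrite /rho; lra.
have rhor : rho < r by rewrite /rho; lra.
have qrho : `|q| < rho by rewrite /rho; lra.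
have [C C0 HC] := bounded_second_derivative rho0 rhor sf.
have n1 : \forall v \near (0 : rV), `|v| < rho - `|q|.
  apply: (near_open_comp (@norm_continuous _ rV 0) (@open_lt R (rho - `|q|))).
  by rewrite /= normr0 subr_gt0.
have n2 : \forall v \near (0 : rV), `|v| < e / (C + 1).
  apply: (near_open_comp (@norm_continuous _ rV 0) (@open_lt R (e / (C + 1)))).
  by rewrite /= normr0 divr_gt0 // ltr_wpDl.
near=> v.
have v1 : `|v| < rho - `|q| by near: v.
have v2 : `|v| < e / (C + 1) by near: v.
have vq : `|v + q| <= rho.
  by apply: (le_trans (ler_normD _ _)); rewrite ltW // -ltrBrDr.
have Bvq : B (v + q) by rewrite ball0E (le_lt_trans vq).
pose psi t := \sum_j v 0 j * (t ^+ (if j == i then m.+1 else m) * 'D_(e_ j) f (squeeze t q)).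
have cj j : continuous01 (fun t : R =>
    t ^+ (if j == i then m.+1 else m) * 'D_(e_ j) f (squeeze t q)).
  exact: (continuous01_squeeze (smooth_derive (e_ j) sf) Bq).
have cpsi : continuous01 psi by apply: continuous01_sum => j; exact: continuous01Z.
have LE : L v = int01 psi.
  rewrite int01_sum; last by move=> j; exact: continuous01Z.
  rewrite /L /= /coord_mx mxE; apply: eq_bigr => j _.
  by rewrite mxE int01Z.
have psiE t : 0 <= t <= 1 -> psi t = t ^+ m * 'D_(squeeze t v) f (squeeze t q).
  move=> t01; have df := smooth_differentiable sf (squeeze_ball t01 Bq).
  rewrite /psi (derive_row_sum _ df) mulr_sumr; apply: eq_bigr => j _.
  rewrite squeezeE -[_ *: _]/(_ * _); case: eqP => _; rewrite ?exprS; ring.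
have cf1 := continuous01_squeeze (m := m) sf Bvq.
have cf2 := continuous01Z (a := -1) (continuous01_squeeze (m := m) sf Bq).
have cp1 := continuous01Z (a := -1) cpsi.
have -> : moment m f (v + q) - moment m f q - L v =
    int01 (fun t => (t ^+ m * f (squeeze t (v + q)) + -1 * (t ^+ m * f (squeeze t q)))
      + -1 * psi t).
  rewrite int01D //; last exact: continuous01D.
  rewrite int01D // !int01Z //; last exact: continuous01_squeeze.
  by rewrite LE !mulN1r.
apply: (@le_trans _ _ (C * (`|v| * `|v|))).
  apply: int01_bound => [|t t01]; first by apply: continuous01D => //; exact: continuous01D.
  rewrite psiE // squeezeD !mulN1r -!mulrBr normrM.
  have [t0 t1] := andP t01.
  apply: (@le_trans _ _ (C * (`|squeeze t v| * `|squeeze t v|))); last first.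
    by rewrite ler_wpM2l // ler_pM // squeeze_norm.
  rewrite -[leRHS]mul1r; apply: ler_pM => //.
    by rewrite normrX ger0_norm // exprn_ile1.
  apply: (taylor2_bound sf rhor C0 HC).
    by apply: (le_trans (squeeze_norm _ t01)); exact: ltW.
  by rewrite -squeezeD; apply: (le_trans (squeeze_norm _ t01)).
rewrite mulrA ler_wpM2r //.
move: v2; rewrite ltr_pdivlMr ?ltr_wpDl // => /ltW; apply: le_trans.
by rewrite mulrC ler_wpM2l //; lra.
Unshelve. all: by end_near. Qed.

(** The partial derivatives of a moment are again moments, so the induction on the order must keep
    [m] and [f] free. *)
Lemma Cn_moment n m f : smooth B f -> Cn n B (moment m f).
Proof.
elim: n m f => [|n IH] m f sf.
  by move=> q Bq; apply: differentiable_continuous; have [] := moment_differential m sf Bq.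
split=> [q Bq|v]; first by have [] := moment_differential m sf Bq.
apply: (@Cn_ext _ _ _ _ _ (fun q => \sum_j v 0 j *
    moment (if j == i then m.+1 else m) (fun x => 'D_(e_ j) f x) q)) => //.
  move=> q; rewrite inE => Bq; have [_ ->] := moment_differential m sf Bq.
  by rewrite mxE; apply: eq_bigr => j _; rewrite mxE.
apply: Cn_sum => // j; apply: CnM => //; first exact: Cn_cst.
by apply: IH; exact: smooth_derive.
Qed.

(** The fundamental theorem of calculus along [squeeze t q]: this path starts on the hyperplane
    where [f] vanishes, and its velocity is [q 0 i] times the unit vector. *)
Theorem hadamard f : smooth B f -> (forall q, B q -> q 0 i = 0 -> f q = 0) ->
  exists2 g, smooth B g & forall q, B q -> f q = q 0 i * g q.
Proof.
move=> sf f0; exists (moment 0 (fun x => 'D_(e_ i) f x)).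
  by move=> n; apply: Cn_moment; exact: smooth_derive.
move=> q Bq.
have i01 : 0 <= (0 : R) <= 1 by rewrite lexx ler01.
have c1 := continuous01_squeeze (m := 0) (smooth_derive (e_ i) sf) Bq.
rewrite /moment -int01Z //.
rewrite (@eq_int01 _ _ (fun t => q 0 i * 'D_(e_ i) f (squeeze t q))); last first.
  by move=> t _; rewrite expr0 mul1r.
have cD : continuous01 (fun t => q 0 i * 'D_(e_ i) f (squeeze t q)).
  apply: continuous01Z; move: c1; congr continuous01.
  by apply/funext => t; rewrite expr0 mul1r.
have FTC := int01_FTC (fun t t01 => is_derive_squeeze sf Bq t01) cD.
rewrite FTC.
rewrite [f (squeeze 0 q)]f0 ?subr0 ?squeezeE ?eqxx ?mul0r //; last exact: squeeze_ball.
by rewrite /squeeze subrr mul0r scale0r addr0.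
Qed.

Definition iter_partial n f : rV -> R := iter n (fun g x => 'D_(e_ i) g x) f.

Lemma smooth_iter_partial n f : smooth B f -> smooth B (iter_partial n f).
Proof. by move=> sf; elim: n => //= n IH; exact: smooth_derive. Qed.

Lemma iter_partial_mul n f g : smooth B g -> (forall q, B q -> f q = q 0 i * g q) ->
  forall q, B q ->
  iter_partial n.+1 f q = q 0 i * iter_partial n.+1 g q + n.+1%:R * iter_partial n g q.
Proof.
move=> sg fg.
have sc : smooth B (fun q : rV => q 0 i).
  by apply: smooth_coord => //; exact: smooth_id.
have Dc q : 'D_(e_ i) (fun q : rV => q 0 i) q = 1.
  have Hc := smooth_derivable (v := e_ i) (@smooth_id _ rV setT) (I : setT q).
  by have := derive_coord 0 i Hc; rewrite derive_id => <-; rewrite mxE !eqxx.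
have DM h q : smooth B h -> B q ->
    'D_(e_ i) (fun q => q 0 i * h q) q = q 0 i * 'D_(e_ i) h q + h q.
  move=> sh Bq; have dh := smooth_derivable (v := e_ i) sh Bq.
  have dc := smooth_derivable (v := e_ i) sc Bq.
  by have := deriveM dc dh; rewrite Dc -[h q *: 1]/(h q * 1) mulr1.
elim: n => [|n IH] q Bq.
  rewrite /= mul1r -(DM g) //; apply: near_eq_derive.
  by apply: open_near oB Bq _ => x; rewrite inE => /fg.
rewrite [LHS]/= (@near_eq_derive _ _ _ _ (fun q => q 0 i * iter_partial n.+1 g q
    + n.+1%:R * iter_partial n g q)); last first.
  by apply: open_near oB Bq _ => x; rewrite inE => /IH.
have s1 := smooth_iter_partial n.+1 sg; have s0 := smooth_iter_partial n sg.
have d1 : derivable (fun q => q 0 i * iter_partial n.+1 g q) q (e_ i).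
  exact: (smooth_derivable (smoothM oB sc s1) Bq).
have d0 := smooth_derivable (v := e_ i) s0 Bq.
have := deriveD d1 (derivableZ (k := n.+1%:R) d0).
rewrite (deriveZ _ d0) DM // => ->.
rewrite -[n.+1%:R *: _]/(n.+1%:R * _) -addrA; congr (_ + _).
by rewrite -[n.+2%:R]natr1 mulrDl mul1r addrC.
Qed.

(** Dividing by one factor lowers by one the order of each normal derivative known to vanish. The
    second conclusion, a Taylor coefficient, is what later shows that the quotient is non-zero at
    the origin. *)
Theorem hadamard_iter n f : smooth B f ->
  (forall j q, (j < n)%N -> B q -> q 0 i = 0 -> iter_partial j f q = 0) ->
  exists2 g, smooth B g & (forall q, B q -> f q = q 0 i ^+ n * g q) /\
    (forall q, B q -> q 0 i = 0 -> iter_partial n f q = n`!%:R * g q).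
Proof.
elim: n f => [|n IH] f sf f0.
  by exists f => //; split=> q Bq; rewrite ?expr0 ?mul1r.
have [g sg fg] := hadamard sf (fun q Bq => f0 0%N q isT Bq).
have Dfg m q : B q -> q 0 i = 0 -> iter_partial m.+1 f q = m.+1%:R * iter_partial m g q.
  by move=> Bq q0; rewrite (iter_partial_mul m sg fg Bq) q0 mul0r add0r.
have [|h sh [gh Dh]] := IH g sg.
  move=> j q jn Bq q0; have := f0 j.+1 q jn Bq q0; rewrite Dfg // => /eqP.
  by rewrite mulf_eq0 pnatr_eq0 /= => /eqP.
exists h => //; split=> q Bq; first by rewrite fg // gh // exprS mulrA.
by move=> q0; rewrite Dfg // Dh // factS natrM mulrA.
Qed.

End Hadamard.

(** * Derivatives along curves *)

(* Locked: unification otherwise unfolds derivatives down to limits. *)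
HB.lock Definition slope (R : realType) (f : R -> R) (t : R) : R := 'D_1 f t.

Lemma slopeE (R : realType) (f : R -> R) t : slope f t = 'D_1 f t.
Proof. by rewrite slope.unlock. Qed.

Section Jets.
Context {R : realType} (B : set R) (oB : open B).
Implicit Types (f g h : R -> R) (t : R).

Lemma smooth_slope f : smooth B f -> smooth B (slope f).
Proof.
move=> sf; have -> : slope f = (fun t => 'D_1 f t) by apply/funext => t; exact: slopeE.
exact: smooth_derive.
Qed.

Lemma slope_congr f g t : (forall s, B s -> f s = g s) -> B t -> slope f t = slope g t.
Proof.
move=> fg Bt; rewrite !slopeE; apply: near_eq_derive.
by apply: open_near oB Bt _ => s; rewrite inE => /fg.
Qed.

Lemma slope_cst (c : R) t : slope (fun=> c) t = 0.
Proof. by rewrite slopeE derive_cst. Qed.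

Lemma slopeD f g t : smooth B f -> smooth B g -> B t ->
  slope (fun s => f s + g s) t = slope f t + slope g t.
Proof.
move=> sf sg Bt; rewrite !slopeE.
exact: (deriveD (smooth_derivable sf Bt) (smooth_derivable sg Bt)).
Qed.

Lemma slopeM f g t : smooth B f -> smooth B g -> B t ->
  slope (fun s => f s * g s) t = slope f t * g t + f t * slope g t.
Proof.
move=> sf sg Bt; rewrite !slopeE.
rewrite [LHS](deriveM (smooth_derivable sf Bt) (smooth_derivable sg Bt)).
by rewrite addrC [g t *: _]mulrC.
Qed.

Lemma slope2M f g t : smooth B f -> smooth B g -> B t ->
  slope (slope (fun s => f s * g s)) t =
  slope (slope f) t * g t + 2 * (slope f t * slope g t) + f t * slope (slope g) t.
Proof.
move=> sf sg Bt; have sf' := smooth_slope sf; have sg' := smooth_slope sg.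
rewrite (slope_congr (fun s Bs => slopeM sf sg Bs) Bt).
rewrite (slopeD (smoothM oB sf' sg) (smoothM oB sf sg') Bt).
rewrite (slopeM sf' sg Bt) (slopeM sf sg' Bt); ring.
Qed.

Lemma slope2D f g t : smooth B f -> smooth B g -> B t ->
  slope (slope (fun s => f s + g s)) t = slope (slope f) t + slope (slope g) t.
Proof.
move=> sf sg Bt; rewrite (slope_congr (fun s Bs => slopeD sf sg Bs) Bt).
by rewrite (slopeD (smooth_slope sf) (smooth_slope sg) Bt).
Qed.

(* [U] is the size of the gradient along a curve, [e = 1 - l g], and [m] the
   derivative of the eigenvalue [l] along its eigenvector. *)
Lemma gradient_order (U e H th c1 a b kap eta c2 thE g rho l lE m : R -> R) :
  B 0 ->
  smooth B U -> smooth B H -> smooth B th -> smooth B c1 -> smooth B a -> smooth B b ->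
  smooth B kap -> smooth B eta -> smooth B c2 -> smooth B thE -> smooth B g ->
  smooth B rho -> smooth B l -> smooth B lE -> smooth B m -> smooth B e ->
  (forall t, B t -> e t * H t = slope U t * th t + U t * c1 t) ->
  (forall t, B t -> e t * eta t + b t * kap t = slope U t * thE t + U t * c2 t) ->
  (forall t, B t -> e t + l t * g t = 1) ->
  (forall t, B t -> slope g t = U t * rho t) ->
  (forall t, B t -> slope l t = a t * m t + b t * lE t) ->
  H 0 != 0 -> th 0 != 0 -> kap 0 != 0 -> a 0 != 0 -> g 0 != 0 ->
  U 0 = 0 -> e 0 = 0 ->
  [/\ slope U 0 = 0, b 0 = 0, (slope (slope U) 0 = 0 <-> m 0 = 0)
    & m 0 = 0 -> (slope (slope (slope U)) 0 = 0 <-> slope m 0 = 0)].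
Proof.
move=> B0 sU sH sth sc1 sa sb skap seta sc2 sthE sg srho sl slE sm se.
move=> E1 E2 E3 E4 E5 H0 th0 kap0 a0 g0 U0 e0.
have sU' := smooth_slope sU.
have U1 : slope U 0 = 0.
  have := E1 0 B0; rewrite e0 U0 !mul0r addr0 => /esym/eqP.
  by rewrite mulf_eq0 (negbTE th0) orbF => /eqP.
have b0 : b 0 = 0.
  have := E2 0 B0; rewrite e0 U0 U1 !mul0r !add0r => /eqP.
  by rewrite mulf_eq0 (negbTE kap0) orbF => /eqP.
have g1 : slope g 0 = 0 by rewrite (E4 0 B0) U0 mul0r.
have g2 : slope (slope g) 0 = 0.
  by rewrite (slope_congr E4 B0) (slopeM sU srho B0) U0 U1 !mul0r addr0.
have e1 : slope e 0 = - (slope l 0 * g 0).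
  have := slope_congr E3 B0.
  rewrite (slopeD se (smoothM oB sl sg) B0) (slopeM sl sg B0) slope_cst g1 mulr0 addr0 => /eqP.
  by rewrite addr_eq0 => /eqP.
have e2 : slope (slope e) 0 = - (slope (slope l) 0 * g 0).
  have := slope_congr (fun t Bt => slope_congr E3 Bt) B0.
  rewrite (slope2D se (smoothM oB sl sg) B0) (slope2M sl sg B0).
  rewrite (slope_congr (fun t _ => slope_cst 1 t) B0) slope_cst g1 g2 !mulr0 !addr0 => /eqP.
  by rewrite addr_eq0 => /eqP.
have l1 : slope l 0 = a 0 * m 0 by rewrite (E5 0 B0) b0 mul0r addr0.
have sL := smoothM oB sU' sth; have sR := smoothM oB sU sc1.
(* The first relation differentiated once: every other term carries a factor [e], [U] or [slope U],
   all zero at 0. *)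
have F1 : slope e 0 * H 0 = slope (slope U) 0 * th 0.
  have := slope_congr E1 B0.
  rewrite (slopeM se sH B0) (slopeD sL sR B0) (slopeM sU' sth B0) (slopeM sU sc1 B0).
  by rewrite e0 U0 U1 !mul0r !addr0.
have iff2 : slope (slope U) 0 = 0 <-> m 0 = 0.
  split=> E.
    move: F1; rewrite E mul0r e1 l1 => /eqP.
    by rewrite mulf_eq0 (negbTE H0) orbF oppr_eq0 !mulf_eq0 (negbTE a0) (negbTE g0) orbF => /eqP.
  move: F1; rewrite e1 l1 E mulr0 mul0r oppr0 mul0r => /esym/eqP.
  by rewrite mulf_eq0 (negbTE th0) orbF => /eqP.
split => // m0.
have U2 := iff2.2 m0.
have e10 : slope e 0 = 0 by rewrite e1 l1 m0 mulr0 mul0r oppr0.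
(* With U'' = 0, the second relation differentiated once makes the velocity follow the eigenvector
   field to first order, so that [lE] will not enter the second derivative of [l]. *)
have b1 : slope b 0 = 0.
  have := slope_congr E2 B0.
  rewrite (slopeD (smoothM oB se seta) (smoothM oB sb skap) B0) (slopeM se seta B0).
  rewrite (slopeM sb skap B0) (slopeD (smoothM oB sU' sthE) (smoothM oB sU sc2) B0).
  rewrite (slopeM sU' sthE B0) (slopeM sU sc2 B0).
  rewrite e0 e10 U0 U1 U2 b0 !mul0r !addr0 !add0r => /eqP.
  by rewrite mulf_eq0 (negbTE kap0) orbF => /eqP.
have l2 : slope (slope l) 0 = a 0 * slope m 0.
  rewrite (slope_congr E5 B0) (slopeD (smoothM oB sa sm) (smoothM oB sb slE) B0).
  rewrite (slopeM sa sm B0) (slopeM sb slE B0).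
  by rewrite m0 b0 b1 mulr0 !mul0r !addr0 add0r.
have F2 : slope (slope e) 0 * H 0 = slope (slope (slope U)) 0 * th 0.
  have := slope_congr (fun t Bt => slope_congr E1 Bt) B0.
  rewrite (slope2M se sH B0) (slope2D sL sR B0) (slope2M sU' sth B0) (slope2M sU sc1 B0).
  by rewrite e0 e10 U0 U1 U2 !mul0r !mulr0 !addr0.
split=> E.
  move: F2; rewrite E mul0r e2 l2 => /eqP.
  by rewrite mulf_eq0 (negbTE H0) orbF oppr_eq0 !mulf_eq0 (negbTE a0) (negbTE g0) orbF => /eqP.
move: F2; rewrite e2 l2 E mulr0 mul0r oppr0 mul0r => /esym/eqP.
by rewrite mulf_eq0 (negbTE th0) orbF => /eqP.
Qed.

End Jets.

Lemma row2P (T : Type) (u v : 'rV[T]_2) : u 0 0 = v 0 0 -> u 0 1 = v 0 1 -> u = v.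
Proof.
move=> h0 h1; apply/rowP => j; case: j => [[|[|//]] lj].
  by rewrite (_ : Ordinal lj = 0) //; exact/val_inj.
by rewrite (_ : Ordinal lj = 1) //; exact/val_inj.
Qed.

(** * Implicit curves in the plane *)

Section ImplicitCurve.
Context {R : realType}.
Local Notation plane := 'rV[R]_2.
Local Notation e0 := (delta_mx 0 0 : plane).
Local Notation e1 := (delta_mx 0 1 : plane).

Definition row2 (a b : R) : plane := a *: e0 + b *: e1.

Lemma row2_0 a b : (row2 a b) 0 0 = a.
Proof. by rewrite !mxE /= mulr1 mulr0 addr0. Qed.

Lemma row2_1 a b : (row2 a b) 0 1 = b.
Proof. by rewrite !mxE /= mulr1 mulr0 add0r. Qed.

Lemma smooth_row2 (V : normedModType R) (D : set V) (f g : V -> R) : open D ->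
  smooth D f -> smooth D g -> smooth D (fun x => row2 (f x) (g x)).
Proof. by move=> oD sf sg; apply: smoothD => //; exact: smoothZ. Qed.

Lemma differentiable_row2 (V : normedModType R) (f g : V -> R) x :
  differentiable f x -> differentiable g x -> differentiable (fun x => row2 (f x) (g x)) x.
Proof. by move=> df dg; apply: differentiableD; exact: differentiableZl. Qed.

Lemma derive_rowE (V : normedModType R) (f g : V -> R) x v :
  differentiable f x -> differentiable g x ->
  'D_v (fun x => row2 (f x) (g x)) x = row2 ('D_v f x) ('D_v g x).
Proof.
move=> df dg; have dr := diff_derivable (v := v) (differentiable_row2 df dg).
have F0 : (fun y => (row2 (f y) (g y)) 0 0) = f by apply/funext => y; rewrite row2_0.
have F1 : (fun y => (row2 (f y) (g y)) 0 1) = g by apply/funext => y; rewrite row2_1.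
by apply: row2P; rewrite (derive_coord _ _ dr) ?F0 ?F1 ?row2_0 ?row2_1.
Qed.

Definition affine2 (p W E : plane) (x : plane) : plane := p + x 0 0 *: W + x 0 1 *: E.

Lemma smooth_affine2 (D : set plane) (p W E : plane) : open D -> smooth D (affine2 p W E).
Proof.
move=> oD; apply: smoothD => //; [apply: smoothD => //|]; first exact: smooth_cst.
  by apply: smoothZ => //; apply: smooth_coord => //; exact: smooth_id.
by apply: smoothZ => //; apply: smooth_coord => //; exact: smooth_id.
Qed.

Lemma derive_affine2 (p W E x v : plane) : 'D_v (affine2 p W E) x = v 0 0 *: W + v 0 1 *: E.
Proof.
apply: cvg_lim => //; apply: cvg_near_cst; near=> h.
have h0 : h != 0 by near: h; exact: nbhs_dnbhs_neq.
by apply/rowP => j; rewrite !mxE; field.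
Unshelve. all: by end_near. Qed.

(** The inverse function theorem for x -> (x_0, F(p + x_0 W + x_1 E)). Keeping the first coordinate
    presents the zero set as a graph over the direction [W], whose velocity is [W] plus a multiple
    of [E]. *)
Lemma implicit_curve (D : set plane) (F : plane -> R) (p W E : plane) : open D -> D p ->
  smooth D F -> F p = 0 -> 'D_E F p != 0 ->
  exists (eps : R) (Y : R -> R), [/\ 0 < eps, smooth (ball (0 : R) eps) Y, Y 0 = 0
    & forall t : R, ball 0 eps t -> D (p + t *: W + Y t *: E) /\ F (p + t *: W + Y t *: E) = 0].
Proof.
move=> oD Dp sF Fp DEF.
have oT : open [set: plane] := openT.
pose A := affine2 p W E.
have sA : smooth setT A by exact: smooth_affine2.
pose D' := [set x | D (A x)].
have oD' : open D'.
  rewrite openE => x Dx; rewrite /interior.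
  exact: near_open_comp (smooth_continuous sA (I : setT x)) oD Dx.
have A0 : A 0 = p by rewrite /A /affine2 !mxE !scale0r !addr0.
have D'0 : D' 0 by rewrite /D' /= A0.
have sA' : smooth D' A by exact: smooth_sub sA.
have sFA : smooth D' (fun x => F (A x)) by exact: smooth_comp_rV sA' sF.
have s0 : smooth D' (fun x : plane => x 0 0) by apply: smooth_coord => //; exact: smooth_id.
pose Phi (x : plane) := row2 (x 0 0) (F (A x)).
have sPhi : smooth D' Phi by exact: smooth_row2.
have Dco v : 'D_v (fun x : plane => x 0 0) 0 = v 0 0.
  by rewrite -(derive_coord (f := id)) ?derive_id //; exact: derivable_id.
have [|V [Wn [psi [[oV oW _ spsi] psiP Phip V0 VD]]]] := inverse_function oD' D'0 sPhi.
  move=> v; rewrite derive_rowE; try exact: (smooth_differentiable _ D'0).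
  rewrite Dco (derive_comp _ (smooth_differentiable sA' D'0)); last first.
    by rewrite A0; exact: (smooth_differentiable sF Dp).
  rewrite A0 derive_affine2 => Ev.
  have v0 : v 0 0 = 0 by have := congr1 (fun M : plane => M 0 0) Ev; rewrite /= row2_0 mxE.
  have := congr1 (fun M : plane => M 0 1) Ev.
  rewrite /= row2_1 mxE v0 scale0r add0r (deriveZv _ _ (smooth_differentiable sF Dp)).
  move/eqP; rewrite -[_ *: _]/(_ * _) mulf_eq0 (negbTE DEF) orbF => /eqP v1.
  by apply: row2P; rewrite mxE.
have Phi0 : Phi 0 = 0.
  by rewrite /Phi A0 Fp mxE; apply: row2P; rewrite ?row2_0 ?row2_1 mxE.
have [W0 psi0] := psiP 0 V0; rewrite Phi0 in W0 psi0.
pose ax t := row2 t 0.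
have sax : smooth setT ax.
  by apply: smooth_row2; [exact: openT|exact: smooth_id|exact: smooth_cst].
have ax0 : ax 0 = 0 by apply: row2P; rewrite ?row2_0 ?row2_1 mxE.
have /nbhs_ballP[eps /= eps0 Beps] : \forall t \near (0 : R), Wn (ax t).
  apply: near_open_comp oW _; last by rewrite ax0.
  exact: (smooth_continuous sax (I : setT 0)).
have oB : open (ball (0 : R) eps) by exact: ball_open.
exists eps, (fun t => psi (ax t) 0 1); split=> //.
- have sax' : smooth (ball (0 : R) eps) ax by exact: smooth_sub sax.
  exact: (smooth_comp_rV oB Beps sax' (smooth_coord 0 1 oW spsi)).
- by rewrite ax0 psi0 mxE.
move=> t Bt; have [Vpsi PE] := Phip _ (Beps t Bt).
have E0 : psi (ax t) 0 0 = t.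
  by have := congr1 (fun M : plane => M 0 0) PE; rewrite /= /Phi /ax !row2_0.
have EA : p + t *: W + psi (ax t) 0 1 *: E = A (psi (ax t)) by rewrite /A /affine2 E0.
rewrite EA; split; first exact: VD.
by have := congr1 (fun M : plane => M 0 1) PE; rewrite /= /Phi /ax !row2_1.
Qed.

End ImplicitCurve.

(** * Normal form *)

(** A directional derivative sees only the restriction to one line, up to an additive constant; the
    difference quotients themselves coincide. *)
Lemma derive_along (R : realType) (V1 V2 W : normedModType R) (F : V1 -> W) (G : V2 -> W)
    x v y u c :
  (forall h : R, F (h *: v + x) = G (h *: u + y) + c) -> 'D_v F x = 'D_u G y.
Proof.
move=> FG; rewrite /derive; set g1 := fun h => _; set g2 := fun h => _.
suff -> : g1 = g2 by [].
apply/funext => h; have := FG 0; rewrite !scale0r !add0r => F0.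
by rewrite /g1 /g2 /= FG F0 opprD addrACA subrr addr0.
Qed.

Section Frame.
Context {K : fieldType}.
Implicit Types (W E v : 'rV[K]_2).

Definition frame_mx W E : 'M[K]_2 := \matrix_i (if i == 0 then W else E).

Lemma mul_frame_mx W E v : v *m frame_mx W E = v 0 0 *: W + v 0 1 *: E.
Proof.
by rewrite mulmx_sum_row big_ord_recl big_ord1 !rowK /= (_ : lift _ _ = 1) //; exact/val_inj.
Qed.

Lemma frame_unitmx W E : (forall a b : K, a *: W + b *: E = 0 -> a = 0 /\ b = 0) ->
  frame_mx W E \in unitmx.
Proof.
move=> H; apply: unitmx_injective => v; rewrite mul_frame_mx => /H[v0 v1].
by apply: row2P; rewrite mxE.
Qed.

End Frame.

Section NormalForm.
Context {R : realType}.
Local Notation plane := 'rV[R]_2.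
Local Notation e0 := (delta_mx 0 0 : plane).
Local Notation e1 := (delta_mx 0 1 : plane).

Lemma add_e0_0 t (z : plane) : (t *: e0 + z) 0 0 = t + z 0 0.
Proof. by rewrite !mxE /= mulr1. Qed.

Lemma add_e1_0 t (z : plane) : (t *: e1 + z) 0 0 = z 0 0.
Proof. by rewrite !mxE /= mulr0 add0r. Qed.

Lemma add_e1_1 t (z : plane) : (t *: e1 + z) 0 1 = t + z 0 1.
Proof. by rewrite !mxE /= mulr1. Qed.

Lemma pow4_sqrt_sqrt (x : R) : 0 <= x -> Num.sqrt (Num.sqrt x) ^+ 4 = x.
Proof. by move=> x0; rewrite (exprM _ 2 2) !sqr_sqrtr ?sqrtr_ge0. Qed.

Lemma sign_sqr (b : bool) (x : R) : (-1) ^+ b * ((-1) ^+ b * x) = x.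
Proof. by rewrite mulrA -expr2 sqrr_sign mul1r. Qed.

Lemma iter_partial_coord0 (h : R -> R) j z :
  iter_partial 0 j (fun x : plane => h (x 0 0)) z = iter j (@slope R) h (z 0 0).
Proof.
elim: j z => //= j IH z.
rewrite (_ : iter_partial _ _ _ = fun x : plane => iter j (@slope R) h (x 0 0)); last first.
  by apply/funext => x; exact: IH.
rewrite slopeE; apply: (derive_along (c := 0)) => t.
by rewrite addr0 add_e0_0; congr (iter _ _ _ (_ + _)); rewrite [RHS]mulr1.
Qed.

Lemma slope_shift (h : R -> R) c : slope (fun t => h t + c) = slope h.
Proof. by apply/funext => t; rewrite !slopeE; apply: (derive_along (c := c)). Qed.

(** In coordinates where the curve dg(E) = 0 is the first axis, [g] minus its value on the curve
    vanishes with its first normal derivative, hence is z_1^2 H, while the restriction to the curve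
    is a constant plus z_0^4 K. As K and H do not vanish at the origin, a fourth and a square root
    absorb them into the coordinates. *)
Lemma A3_normal_form (D : set plane) (g : plane -> R) (p W E : plane) (eps : R) (Y : R -> R) :
  open D -> D p -> smooth D g -> (forall X, 'D_X g p = 0) ->
  (forall a b : R, a *: W + b *: E = 0 -> a = 0 /\ b = 0) ->
  'D_E (fun q => 'D_E g q) p != 0 ->
  0 < eps -> smooth (ball (0 : R) eps) Y -> Y 0 = 0 ->
  (forall t : R, ball 0 eps t ->
     D (p + t *: W + Y t *: E) /\ 'D_E g (p + t *: W + Y t *: E) = 0) ->
  (forall j, (0 < j < 4)%N -> iter j (@slope R) (fun t => g (p + t *: W + Y t *: E)) 0 = 0) ->
  iter 4 (@slope R) (fun t => g (p + t *: W + Y t *: E)) 0 != 0 ->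
  A_point 3 g p.
Proof.
move=> oD Dp sg crit indep gEE eps0 sY Y0 HY Gj G4.
pose gam t := p + t *: W + Y t *: E.
pose G t := g (gam t).
have oI : open (ball (0 : R) eps) by exact: ball_open.
have sco (i : 'I_2) (A : set plane) : open A -> smooth A (fun z : plane => z 0 i).
  by move=> oA; apply: smooth_coord => //; exact: smooth_id.
pose S0 := [set z : plane | ball (0 : R) eps (z 0 0)].
have oS : open S0.
  rewrite openE => z Sz; rewrite /interior.
  exact: near_open_comp (@coord_continuous _ 1 2 0 0 z) oI Sz.
have S00 : S0 0 by rewrite /S0 /= mxE; exact: ballxx.
have sY0 : smooth S0 (fun z => Y (z 0 0)) by apply: (smooth_compR oS _ (sco 0 _ oS) sY).
(* [pt] is the straightening parametrization, with the curve at z_1 = 0; [gz] projects onto the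
   curve along [E]. *)
pose pt (z : plane) := p + z 0 0 *: W + (Y (z 0 0) + z 0 1) *: E.
pose gz (z : plane) := gam (z 0 0).
have spt : smooth S0 pt.
  apply: smoothD => //; [apply: smoothD => //; first exact: smooth_cst|].
    by apply: smoothZ => //; exact: sco.
  by apply: smoothZ => //; apply: smoothD => //; exact: sco.
have sgz : smooth S0 gz.
  apply: smoothD => //; [apply: smoothD => //; first exact: smooth_cst|exact: smoothZ].
  by apply: smoothZ => //; exact: sco.
have pt0 : pt 0 = p by rewrite /pt !mxE Y0 !addr0 !scale0r !addr0.
have npt : \forall z \near (0 : plane), D (pt z).
  by apply: near_open_comp oD _; [exact: (smooth_continuous spt S00)|rewrite pt0].
have nS : \forall z \near (0 : plane), S0 z by exact: open_nbhs_nbhs.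
have [r r0 Br] := near3_ball nS npt nS.
pose B := ball (0 : plane) r.
have oB : open B by exact: ball_open.
have BS : B `<=` S0 by move=> z /Br[].
have BD z : B z -> D (pt z) by move=> /Br[].
have sk : smooth B (fun z => g (pt z)) by apply: smooth_comp_rV BD (smooth_sub BS spt) sg.
have BDz z : B z -> D (gz z) by move=> /BS Bz; have [] := HY (z 0 0) Bz.
have sG : smooth B (fun z => g (gz z)) by apply: smooth_comp_rV BDz (smooth_sub BS sgz) sg.
(* Its derivatives along the second axis are those of [g] along [E], since [gz] is constant
   there. *)
pose F1 z := g (pt z) - g (gz z).
have sF1 : smooth B F1 by exact: smoothB.
have pt_e1 (h : R) z : pt (h *: e1 + z) = h *: E + pt z.
  rewrite /pt add_e1_0 add_e1_1.
  by apply/rowP => j; rewrite !mxE; ring.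
have gz_e1 (h : R) z : gz (h *: e1 + z) = gz z.
  by rewrite /gz add_e1_0.
have DF1 : iter_partial 1 1 F1 = (fun z => 'D_E g (pt z)).
  apply/funext => z; apply: (derive_along (c := - g (gz z))) => h.
  by rewrite /F1 pt_e1 gz_e1.
have D2F1 z : iter_partial 1 2 F1 z = 'D_E (fun q => 'D_E g q) (pt z).
  rewrite -[LHS]/('D_e1 (iter_partial 1 1 F1) z) DF1.
  by apply: (derive_along (c := 0)) => h; rewrite pt_e1 addr0.
have ptgz (z : plane) : z 0 1 = 0 -> pt z = gz z by rewrite /pt /gz /gam => ->; rewrite addr0.
have [|H sH [F1H H2]] := @hadamard_iter R 2 1 r 2 F1 sF1.
  move=> [|[|//]] z _ Bz z1; first by rewrite /= /F1 ptgz // subrr.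
  by rewrite DF1 ptgz //; have [_] := HY (z 0 0) (BS _ Bz).
have B0 : B 0 by exact: ballxx.
have H0 : H 0 != 0.
  have := H2 0 B0; rewrite mxE D2F1 pt0 => /(_ erefl) Heq.
  by apply: contra gEE => /eqP H00; rewrite Heq H00 mulr0.
pose F0 (z : plane) := G (z 0 0) + - G 0.
have sF0 : smooth B F0 by apply: smoothD => //; exact: smooth_cst.
have F0j j z : (0 < j)%N -> iter_partial 0 j F0 z = iter j (@slope R) G (z 0 0).
  move=> j0; rewrite /F0 (iter_partial_coord0 (fun t => G t + - G 0)).
  by case: j j0 => // j _; rewrite !iterSr slope_shift.
have [|K sK [F0K K4]] := @hadamard_iter R 2 0 r 4 F0 sF0.
  move=> [|j] z j4 Bz z0; first by rewrite /= /F0 z0 subrr.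
  by rewrite F0j // z0 Gj.
have K0 : K 0 != 0.
  have := K4 0 B0; rewrite mxE F0j // mxE => /(_ erefl) Keq.
  by apply: contra G4 => /eqP K00; rewrite [X in X == 0]Keq K00 mulr0.
have gK z : B z -> g (pt z) = G 0 + z 0 0 ^+ 4 * K z + z 0 1 ^+ 2 * H z.
  move=> Bz; rewrite -(F0K z Bz) -(F1H z Bz) /F0 /F1 /gz /G; ring.
(* The booleans serve as exponents of -1 and record the signs of the two quotients. *)
pose s1 := K 0 < 0; pose s2 := H 0 < 0.
have K1 : 0 < (-1) ^+ s1 * K 0 by rewrite /s1 -normrEsign normr_gt0.
have H1 : 0 < (-1) ^+ s2 * H 0 by rewrite /s2 -normrEsign normr_gt0.
have uL := frame_unitmx indep.
pose L := invmx (frame_mx W E).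
pose ell (q : plane) := (q - p) *m L.
have oT : open [set: plane] := openT.
have sell : smooth setT ell.
  apply: smooth_mulmx => //; last exact: smooth_cst.
  by apply: smoothD => //; [exact: smooth_id|exact: smooth_cst].
have ellp : ell p = 0 by rewrite /ell subrr mul0mx.
pose S1 := [set q | S0 (ell q)].
have oS1 : open S1.
  rewrite openE => q Sq; rewrite /interior.
  exact: near_open_comp (smooth_continuous sell (I : setT q)) oS Sq.
have S1p : S1 p by rewrite /S1 /= ellp.
have sl i : smooth S1 (fun q => ell q 0 i).
  by apply: smooth_coord => //; exact: smooth_sub sell.
(* Inverse of [pt]: affine coordinates of [q] in the frame [W], [E], minus the height of the
   curve. *)
pose zq q := row2 (ell q 0 0) (ell q 0 1 - Y (ell q 0 0)).
have sYl : smooth S1 (fun q => Y (ell q 0 0)) by apply: (smooth_compR oS1 _ (sl 0) sY).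
have szq : smooth S1 zq by apply: smooth_row2 => //; exact: smoothB.
have zqp : zq p = 0.
  by rewrite /zq ellp !mxE Y0 subrr; apply: row2P; rewrite ?row2_0 ?row2_1 mxE.
have ptzq q : pt (zq q) = q.
  rewrite /pt /zq row2_0 row2_1 [Y _ + _]addrC subrK -addrA -mul_frame_mx.
  by rewrite /ell mulmxKV // addrC subrK.
have czq := smooth_continuous szq S1p.
have nB : \forall q \near p, S1 q /\ B (zq q).
  apply: filterI; first exact: open_nbhs_nbhs.
  by apply: near_open_comp czq oB _; rewrite zqp.
have pos (s : bool) (h : plane -> R) : smooth B h -> 0 < (-1) ^+ s * h 0 ->
    \forall q \near p, 0 < (-1) ^+ s * h (zq q).
  move=> sh h0; have ch : {for p, continuous (fun q => (-1) ^+ s * h (zq q))}.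
    apply: continuousM; first exact: cst_continuous.
    by apply: continuous_comp => //; rewrite zqp; exact: (smooth_continuous sh B0).
  by apply: (near_open_comp ch (@open_gt R 0)); rewrite /= zqp.
have [rho rho0 Brho] := near3_ball nB (pos s1 K sK K1) (pos s2 H sH H1).
pose Bp := ball p rho.
have oBp : open Bp by exact: ball_open.
have Bpp : Bp p by exact: ballxx.
have BpS : Bp `<=` S1 by move=> q /Brho[[]].
have BpB q : Bp q -> B (zq q) by move=> /Brho[[]].
have szB := smooth_sub BpS szq.
have sz i : smooth Bp (fun q => zq q 0 i) by exact: smooth_coord.
pose kap q := Num.sqrt (Num.sqrt ((-1) ^+ s1 * K (zq q))).
pose eta q := Num.sqrt ((-1) ^+ s2 * H (zq q)).
have sc (s : bool) (h : plane -> R) : smooth B h -> smooth Bp (fun q => (-1) ^+ s * h (zq q)).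
  move=> sh; apply: smoothM => //; first exact: smooth_cst.
  exact: smooth_comp_rV BpB szB sh.
have skap : smooth Bp kap.
  apply: smooth_sqrt_comp => //.
    by move=> q Bq; rewrite sqrtr_gt0; have [_] := Brho q Bq.
  apply: smooth_sqrt_comp => //; last exact: sc.
  by move=> q Bq; have [_] := Brho q Bq.
have seta : smooth Bp eta.
  apply: smooth_sqrt_comp => //; last exact: sc.
  by move=> q Bq; have [_ _] := Brho q Bq.
pose phi q := row2 (zq q 0 0 * kap q) (zq q 0 1 * eta q).
have sphi : smooth Bp phi by apply: smooth_row2 => //; exact: smoothM.
have kapp : kap p != 0.
  by rewrite gt_eqF // !sqrtr_gt0; have [_ +] := Brho p Bpp.
have etap : eta p != 0.
  by rewrite gt_eqF // sqrtr_gt0; have [_ _ +] := Brho p Bpp.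
have Dprod i (h : plane -> R) v : smooth Bp h ->
    'D_v (fun q => zq q 0 i * h q) p = h p * 'D_v (fun q => zq q 0 i) p.
  move=> sh; have := deriveM (smooth_derivable (v := v) (sz i) Bpp) (smooth_derivable (v := v) sh Bpp).
  by move=> ->; rewrite zqp mxE scale0r add0r.
have [|V [Wn [psi [[oV oW sV spsi] psiP phiP Vp VB]]]] := inverse_function oBp Bpp sphi.
  move=> v; have dzp i := smooth_differentiable (sz i) Bpp.
  have dp0 := smooth_differentiable (smoothM oBp (sz 0) skap) Bpp.
  have dp1 := smooth_differentiable (smoothM oBp (sz 1) seta) Bpp.
  rewrite (derive_rowE _ dp0 dp1) Dprod // Dprod // => Ev.
  have /eqP := congr1 (fun M : plane => M 0 0) Ev.
  rewrite /= row2_0 mxE mulf_eq0 (negbTE kapp) => /eqP Ez0.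
  have /eqP := congr1 (fun M : plane => M 0 1) Ev.
  rewrite /= row2_1 mxE mulf_eq0 (negbTE etap) => /eqP Ez1.
  have dz := smooth_differentiable szB Bpp.
  (* The rescaling factors are non-zero, so a vector killed by the differential of [phi] is killed
     by that of [zq]; as [pt] undoes [zq], it is zero. *)
  have Dz : 'D_v zq p = 0.
    by apply: row2P; rewrite (derive_coord _ _ (diff_derivable dz)) ?Ez0 ?Ez1 mxE.
  have dpt : differentiable pt (zq p) by rewrite zqp; exact: (smooth_differentiable spt S00).
  have := derive_comp v dz dpt; rewrite Dz derive0.
  rewrite (_ : (fun y => pt (zq y)) = id) ?derive_id //.
  by apply/funext => q; exact: ptzq.
split; first by split=> //; exact: (smooth_differentiable sg Dp).
exists V, Wn, phi, psi, (G 0), s1, s2; split=> //.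
  by rewrite /phi zqp; apply: row2P; rewrite ?row2_0 ?row2_1 !mxE mul0r.
move=> q Vq; have Bq := VB q Vq; have [_ Kq Hq] := Brho q Bq.
rewrite -{1}(ptzq q) (gK _ (BpB q Bq)) /phi !row2_0 !row2_1 !exprMn.
rewrite pow4_sqrt_sqrt ?ltW // sqr_sqrtr ?ltW //.
rewrite [(-1) ^+ s1 * _]mulrCA sign_sqr [(-1) ^+ s2 * (_ * _)]mulrCA sign_sqr.
by [].
Qed.

End NormalForm.

(** * Ridges and singularities *)

Section Derivatives.
Context {R : realType}.

Lemma derive_pow (V : normedModType R) (f : V -> R) n x v : derivable f x v ->
  'D_v (fun y => f y ^+ n.+1) x = n.+1%:R * f x ^+ n * 'D_v f x.
Proof.
move=> df; have dn m : derivable (fun y => f y ^+ m) x v.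
  elim: m => [|m IH]; first exact: derivable_cst.
  rewrite (_ : (fun y => _) = f * (fun y => f y ^+ m)); first exact: derivableM.
  by apply/funext => y; rewrite exprS.
elim: n => [|n IH].
  by rewrite expr0 !mul1r; congr (derive _ _ _).
rewrite (_ : (fun y => f y ^+ n.+2) = f * (fun y => f y ^+ n.+1)); last first.
  by apply/funext => y; rewrite exprS.
rewrite (deriveM df (dn n.+1)) IH -[X in X + _]/(_ * _) -[X in _ + X]/(_ * _).
by rewrite -[n.+2%:R]natr1 exprS; ring.
Qed.

Lemma slope_pow (c : R) n : slope (fun t => c * t ^+ n.+1) = fun t => c * n.+1%:R * t ^+ n.
Proof.
apply/funext => t; rewrite slopeE.
have dt : derivable (fun t : R => t ^+ n.+1) t 1 by exact: exprn_derivable.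
rewrite [LHS](deriveZ c dt) (@derive_pow R id) ?derive_id; last exact: derivable_id.
by rewrite mulr1 -[LHS]/(_ * _) mulrA.
Qed.

Lemma derive_scale_vector (V W : normedModType R) (f : V -> R) (a : W) x v :
  differentiable f x -> 'D_v (fun y => f y *: a) x = 'D_v f x *: a.
Proof.
by move=> df; rewrite (deriveE _ (differentiableZl a df)) (diffZl a df) (deriveE _ df).
Qed.

Section GraphCurve.
Variables (V : normedModType R) (I : set R) (p W E : V) (Y : R -> R).
Hypotheses (oI : open I) (sY : smooth I Y).

Let smooth_line : smooth I (fun t : R => t *: W).
Proof. by apply: smoothZ => //; exact: smooth_id. Qed.

Lemma smooth_graph_curve : smooth I (fun t => p + t *: W + Y t *: E).
Proof.
apply: smoothD => //; last exact: smoothZ.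
by apply: smoothD => //; exact: smooth_cst.
Qed.

Lemma derive_graph_curve t : I t -> 'D_1 (fun t : R => p + t *: W + Y t *: E) t = W + 'D_1 Y t *: E.
Proof.
move=> It.
have d1 : derivable (fun t : R => p + t *: W) t 1.
  by apply: (smooth_derivable (D := I)) => //; apply: smoothD => //; exact: smooth_cst.
have d2 := smooth_derivable (v := (1 : R)) (smoothZ E oI sY) It.
rewrite [LHS](deriveD d1 d2) (derive_scale_vector _ _ (smooth_differentiable sY It)).
congr (_ + _).
have d3 := smooth_derivable (v := (1 : R)) smooth_line It.
rewrite [LHS](deriveD (derivable_cst p t (1 : R)) d3) derive_cst add0r.
rewrite (derive_scale_vector _ _ (smooth_differentiable (@smooth_id _ _ I) It)).
by rewrite derive_id scale1r.
Qed.

End GraphCurve.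

End Derivatives.

Lemma eigen_frame (K : fieldType) (S : 'M[K]_2) (w E : 'rV[K]_2) l mu : w != 0 -> E != 0 ->
  w *m S = l *: w -> E *m S = mu *: E -> l != mu ->
  forall a b : K, a *: w + b *: E = 0 -> a = 0 /\ b = 0.
Proof.
move=> w0 E0 wS ES lmu a b H.
have HS : (a * l) *: w + (b * mu) *: E = 0.
  by have := congr1 (mulmx^~ S) H; rewrite mulmxDl -!scalemxAl wS ES !scalerA mul0mx.
have b0 : b = 0.
  have : (b * (l - mu)) *: E = 0.
    have -> : (b * (l - mu)) *: E = l *: (a *: w + b *: E) - ((a * l) *: w + (b * mu) *: E).
      by apply/rowP => j; rewrite !mxE; ring.
    by rewrite H HS scaler0 subrr.
  move/eqP; rewrite scaler_eq0 (negbTE E0) orbF mulf_eq0 subr_eq0 (negbTE lmu) orbF.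
  by move/eqP.
split=> //; move: H; rewrite b0 scale0r addr0 => /eqP.
by rewrite scaler_eq0 (negbTE w0) orbF => /eqP.
Qed.

(** * Shape operators that are self-adjoint for a bilinear form *)

Section Shape.
Context {R : realType}.
Implicit Types (S h : 'M[R]_2) (w E X : 'rV[R]_2).

Lemma eval2Zl h X w a : eval2 h (a *: X) w = a * eval2 h X w.
Proof. by rewrite /eval2 -!scalemxAl mxE. Qed.

Lemma eval2Dl h X w E a b : eval2 h (a *: X + b *: w) E = a * eval2 h X E + b * eval2 h w E.
Proof. by rewrite /eval2 !mulmxDl -!scalemxAl !mxE. Qed.

Lemma eval2_shape S h X w l : S *m h = h *m S^T -> w *m S = l *: w ->
  eval2 h (X *m S) w = l * eval2 h X w.
Proof.
move=> Sh wS; rewrite /eval2 -(mulmxA X) Sh -!mulmxA -trmx_mul wS linearZ /=.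
by rewrite -!scalemxAr mxE.
Qed.

Lemma eigen_orthogonal S h w E l mu : S *m h = h *m S^T ->
  w *m S = l *: w -> E *m S = mu *: E -> l != mu ->
  eval2 h w E = 0 /\ eval2 h E w = 0.
Proof.
move=> Sh wS ES lmu.
have aux x y s t : x *m S = s *: x -> y *m S = t *: y -> s != t -> eval2 h x y = 0.
  move=> xS yS st; have := eval2_shape x Sh yS.
  rewrite xS /eval2 -!scalemxAl mxE => /eqP; rewrite -subr_eq0 -mulrBl mulf_eq0 subr_eq0.
  by rewrite (negbTE st) => /eqP.
by split; [exact: aux lmu|apply: aux ES wS _; rewrite eq_sym].
Qed.

Lemma eval2_sub_shape h S X Y c :
  eval2 ((1%:M - c *: S) *m h) X Y = eval2 h X Y - c * eval2 h (X *m S) Y.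
Proof.
rewrite /eval2 mulmxBl mul1mx -scalemxAl mulmxBr mulmxBl -scalemxAr -scalemxAl mulmxA.
by rewrite !mxE.
Qed.

End Shape.

(** * A_3 criterion for a function with Hessian (1 - g S) h up to first-order terms *)

Section Criterion.
Context {R : realType}.
Local Notation plane := 'rV[R]_2.
Local Notation e_ j := (delta_mx 0 j : plane).
Variables (D : set plane) (g lam : plane -> R) (w : plane -> plane).
Variables (S h : plane -> 'M[R]_2) (Gam : 'I_2 -> 'I_2 -> plane -> plane).
Variables (p E : plane) (mu : R).
Hypotheses (oD : open D) (Dp : D p).
Hypotheses (sg : smooth D g) (slam : smooth D lam) (sw : smooth D w).
Hypotheses (sS : smooth D S) (sh : smooth D h) (sGam : forall i j, smooth D (Gam i j)).
Hypothesis hess : forall q i j, D q ->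
  'D_(e_ i) (fun r => 'D_(e_ j) g r) q =
  'D_(Gam i j q) g q + ((1%:M - g q *: S q) *m h q) i j.
Hypothesis self_adjoint : forall q, D q -> S q *m h q = h q *m (S q)^T.
Hypothesis h_unit : h p \in unitmx.
Hypothesis eigen : forall q, D q -> w q *m S q = lam q *: w q.
Hypothesis frame : forall q, D q -> frame_mx (w q) E \in unitmx.
Hypotheses (ES : E *m S p = mu *: E) (lmu : lam p != mu).
Hypothesis crit : forall X, 'D_X g p = 0.
Hypotheses (lam0 : lam p != 0) (gp : g p = (lam p)^-1).

Let ridge_function q := 'D_(w q) lam q.

Lemma frame_inj (x : plane) : x *m frame_mx (w p) E = 0 -> x = 0.
Proof.
by move=> /(congr1 (mulmx^~ (invmx (frame_mx (w p) E)))); rewrite mulmxK ?mul0mx //; exact: frame.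
Qed.

Lemma w_neq0 : w p != 0.
Proof.
apply/eqP => w0; have /frame_inj H : row2 1 0 *m frame_mx (w p) E = 0.
  by rewrite mul_frame_mx w0 row2_1 scaler0 scale0r addr0.
by have /eqP := row2_0 (1 : R) 0; rewrite H mxE eq_sym oner_eq0.
Qed.

Lemma E_neq0 : E != 0.
Proof.
apply/eqP => E0; have /frame_inj H : row2 0 1 *m frame_mx (w p) E = 0.
  by rewrite mul_frame_mx E0 row2_0 scaler0 scale0r addr0.
by have /eqP := row2_1 (0 : R) 1; rewrite H mxE eq_sym oner_eq0.
Qed.

(** Self-adjointness makes eigenvectors for distinct eigenvalues orthogonal. Since [h] may be
    indefinite, the other two claims rest on non-degeneracy: an isotropic [w p] or [E] would be
    orthogonal to the whole frame. *)
Lemma eval2_ww_EE : [/\ eval2 (h p) (w p) E = 0, eval2 (h p) (w p) (w p) != 0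
  & eval2 (h p) E E != 0].
Proof.
have [wE Ew] := eigen_orthogonal (self_adjoint Dp) (eigen Dp) ES lmu.
have key (x : plane) : x != 0 -> eval2 (h p) x (w p) = 0 -> eval2 (h p) x E = 0 -> False.
  move=> x0 xw xE; move/negP: x0; apply.
  have : x *m h p *m (frame_mx (w p) E)^T = 0.
    apply/rowP => j; rewrite mxE [RHS]mxE.
    under eq_bigr do rewrite [_^T _ _]mxE.
    case: (eqVneq j 0) => [->|j0].
      by rewrite -[RHS]xw /eval2 mxE; apply: eq_bigr => k _; rewrite !mxE eqxx.
    by rewrite -[RHS]xE /eval2 mxE; apply: eq_bigr => k _; rewrite !mxE (negbTE j0).
  have uT : (frame_mx (w p) E)^T \in unitmx by rewrite unitmx_tr; exact: frame.
  move=> /(congr1 (mulmx^~ (invmx (frame_mx (w p) E)^T))).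
  rewrite mulmxK // mul0mx => /(congr1 (mulmx^~ (invmx (h p)))).
  by rewrite mulmxK // mul0mx => ->.
split=> //; apply/eqP => H.
  exact: key w_neq0 H wE.
exact: key E_neq0 Ew H.
Qed.

(** The value is (1 - mu / lam) h(E, E). It is the second derivative of [g] along [E], which gives
    both the implicit curve dg(E) = 0 and the quadratic term of the normal form. *)
Lemma eval2_hess_EE : eval2 ((1%:M - g p *: S p) *m h p) E E != 0.
Proof.
have [_ _ EE] := eval2_ww_EE.
rewrite eval2_sub_shape ES gp eval2Zl.
rewrite -[X in X - _]mul1r mulrA -mulrBl mulf_neq0 // subr_eq0.
by apply: contra lmu => /eqP H; rewrite -[X in X == _]mulr1 H mulrA mulfV // mul1r.
Qed.

Lemma hessian_eval2 X Y :
  'D_X (fun r => 'D_Y g r) p = eval2 ((1%:M - g p *: S p) *m h p) X Y.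
Proof.
have d2 j := smooth_differentiable (smooth_derive (e_ j) sg) Dp.
rewrite (@near_eq_derive _ _ _ _ (fun r => \sum_j Y 0 j * 'D_(e_ j) g r)); last first.
  apply: open_near oD Dp _ => r; rewrite inE => Dr.
  by rewrite (derive_row_sum Y (smooth_differentiable sg Dr)).
rewrite (_ : (fun r => \sum_j _) = \sum_j (fun r => Y 0 j * 'D_(e_ j) g r)); last first.
  by apply/funext => r; rewrite fct_sumE.
rewrite derive_sum; last by move=> j; exact: (derivableZ (k := Y 0 j) (diff_derivable (d2 j))).
rewrite /eval2 mxE; apply: eq_bigr => j _.
rewrite [LHS](deriveZ (Y 0 j) (diff_derivable (d2 j))) (derive_row_sum X (d2 j)).
rewrite [Y^T _ _]mxE [RHS]mulrC mxE; congr (_ * _); apply: eq_bigr => i _.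
by rewrite (hess i j Dp) crit add0r.
Qed.

(** Cancelling [h] leaves the eigenvector equation for [lam p]. In an A_3 chart the velocity of the
    axis is known only as a kernel vector of the Hessian; this places it on the principal
    direction. *)
Lemma hessian_degenerate (X : plane) :
  (forall j, \sum_i X 0 i * 'D_(e_ i) (fun r => 'D_(e_ j) g r) p = 0) ->
  exists k, X = k *: w p.
Proof.
move=> HX.
have H1 : X *m ((1%:M - g p *: S p) *m h p) = 0.
  apply/rowP => j; rewrite mxE [RHS]mxE -[RHS](HX j).
  by apply: eq_bigr => i _; rewrite (hess i j Dp) crit add0r.
have H2 : X *m S p = lam p *: X.
  move: H1; rewrite mulmxA => /(congr1 (mulmx^~ (invmx (h p)))).
  rewrite mulmxK // mul0mx mulmxBr mulmx1 -scalemxAr gp => /eqP; rewrite subr_eq0 => /eqP {2}->.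
  by rewrite scalerA mulfV // scale1r.
pose ab := X *m invmx (frame_mx (w p) E).
have XE : X = ab 0 0 *: w p + ab 0 1 *: E by rewrite -mul_frame_mx /ab mulmxKV //; exact: frame.
exists (ab 0 0); have := H2; rewrite {1}XE mulmxDl -!scalemxAl (eigen Dp) ES.
move=> H3; have : (ab 0 1 * (mu - lam p)) *: E = 0.
  have -> : (ab 0 1 * (mu - lam p)) *: E =
    (ab 0 0 *: (lam p *: w p) + ab 0 1 *: (mu *: E)) - lam p *: (ab 0 0 *: w p + ab 0 1 *: E).
    by apply/rowP => j; rewrite !mxE; ring.
  by rewrite -XE H3 subrr.
move/eqP; rewrite scaler_eq0 (negbTE E_neq0) orbF mulf_eq0 subr_eq0 [mu == _]eq_sym (negbTE lmu) orbF.
by move=> /eqP ab1; rewrite XE ab1 scale0r addr0.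
Qed.

Lemma smooth_ridge_function : smooth D ridge_function.
Proof.
apply: (@smooth_ext _ _ _ _ (fun q => \sum_j w q 0 j * 'D_(e_ j) lam q)) => //.
  by move=> q; rewrite inE => Dq; rewrite /ridge_function (derive_row_sum _ (smooth_differentiable slam Dq)).
apply: smooth_sum => // j; apply: smoothM => //; first exact: smooth_coord.
exact: smooth_derive.
Qed.

(** * Order of vanishing of the gradient along a curve *)

Section Curve.
Variables (eps : R) (gam : R -> plane) (U : R -> R) (th : R -> plane) (k : R).
Local Notation I := (ball (0 : R) eps).
Hypotheses (eps0 : 0 < eps) (sgam : smooth I gam) (gamD : forall t, I t -> D (gam t)).
Hypotheses (gam0 : gam 0 = p) (k0 : k != 0) (dgam0 : 'D_1 gam 0 = k *: w p).
Hypotheses (sU : smooth I U) (sth : smooth I th) (U0 : U 0 = 0).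
Hypothesis gradU : forall t j, I t -> 'D_(e_ j) g (gam t) = U t * th t 0 j.
Hypothesis thw : (th 0 *m (w p)^T) 0 0 != 0.

Let oI : open I. Proof. exact: ball_open. Qed.
Let I0 : I 0. Proof. exact: ballxx. Qed.

Lemma slope_comp_curve (f : plane -> R) t : smooth D f -> I t ->
  slope (fun s => f (gam s)) t = 'D_('D_1 gam t) f (gam t).
Proof.
move=> sf It; rewrite slopeE.
have df := smooth_differentiable sf (gamD It).
exact: (derive_comp _ (smooth_differentiable sgam It) df).
Qed.

(** Differentiating dg = U theta along the curve and inserting the Hessian gives an equality of
    covectors; pairing it with [w] and with [E] produces the two scalar relations of
    [gradient_order]. *)
Lemma gradient_order_curve :
  [/\ slope U 0 = 0, (slope (slope U) 0 = 0 <-> ridge_function p = 0)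
    & ridge_function p = 0 ->
      (slope (slope (slope U)) 0 = 0 <-> 'D_(w p) ridge_function p = 0)].
Proof.
pose vel t := 'D_1 gam t.
have svel : smooth I vel by exact: smooth_derive.
have cD (f : plane -> R) : smooth D f -> smooth I (fun t => f (gam t)).
  by move=> sf; exact: smooth_comp_rV gamD sgam sf.
have cM m n (A : plane -> 'M[R]_(m, n)) : smooth D A -> smooth I (fun t => A (gam t)).
  move=> sA; apply: smooth_mx => // i j.
  exact: (cD (fun q => A q i j) (smooth_coord i j oD sA)).
pose wc t := w (gam t); have swc : smooth I wc by exact: cM.
pose hc t := h (gam t); have shc : smooth I hc by exact: cM.
pose Sc t := S (gam t); have sSc : smooth I Sc by exact: cM.
pose gc t := g (gam t); have sgc : smooth I gc by exact: cD.
pose lc t := lam (gam t); have slc : smooth I lc by exact: cD.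
have spair (M : R -> 'M[R]_2) (X Y : R -> plane) : smooth I M -> smooth I X -> smooth I Y ->
    smooth I (fun t => eval2 (M t) (X t) (Y t)).
  move=> sM sX sY; rewrite /eval2; apply: smooth_coord => //; apply: smooth_mulmx => //.
    exact: smooth_mulmx.
  apply: smooth_mx => // i j; under eq_fun do rewrite mxE; exact: smooth_coord.
have sE : smooth I (fun=> E) by exact: smooth_cst.
have sdot (X Y : R -> plane) : smooth I X -> smooth I Y ->
    smooth I (fun t => (X t *m (Y t)^T) 0 0).
  move=> sX sY; apply: smooth_coord => //; apply: smooth_mulmx => //.
  apply: smooth_mx => // i j; under eq_fun do rewrite mxE; exact: smooth_coord.
(* The first-order part of the Hessian is linear in dg, hence also divisible by [U]; it joins the
   derivative of [th] in the coefficient of [U]. *)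
pose kappa t : plane := \row_j (slope (fun s => th s 0 j) t -
  \sum_i vel t 0 i * (Gam i j (gam t) *m (th t)^T) 0 0).
have skappa : smooth I kappa.
  apply: smooth_mx => // i j; under eq_fun do rewrite mxE; apply: smoothB => //.
    by apply: smooth_slope => //; exact: smooth_coord.
  apply: smooth_sum => // i'; apply: smoothM => //; first exact: smooth_coord.
  by apply: sdot => //; exact: cM.
pose ab t : plane := vel t *m invmx (frame_mx (wc t) E).
have sab : smooth I ab.
  apply: smooth_mulmx => //; apply: smooth_invmx => //; last by move=> t It; exact/frame/gamD.
  apply: smooth_mx => // i j; under eq_fun do rewrite mxE.
  by case: (i == 0); exact: smooth_coord.
have velE t : I t -> vel t = ab t 0 0 *: wc t + ab t 0 1 *: E.
  by move=> It; rewrite -mul_frame_mx /ab mulmxKV //; exact/frame/gamD.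
have grad t X : I t -> 'D_X g (gam t) = U t * (th t *m X^T) 0 0.
  move=> It; rewrite (derive_row_sum _ (smooth_differentiable sg (gamD It))).
  rewrite mxE mulr_sumr; apply: eq_bigr => j _.
  by rewrite (gradU j It) [_^T _ _]mxE mulrA; exact: mulrC.
have main t : I t -> vel t *m ((1%:M - gc t *: Sc t) *m hc t) = slope U t *: th t + U t *: kappa t.
  move=> It; apply/rowP => j; rewrite mxE [RHS]mxE !mxE.
  have := slope_comp_curve (smooth_derive (e_ j) sg) It.
  rewrite (slope_congr oI (fun s Is => gradU j Is) It) (slopeM sU (smooth_coord 0 j oI sth) It).
  rewrite (derive_row_sum _ (smooth_differentiable (smooth_derive (e_ j) sg) (gamD It))) => Hj.
  have -> : \sum_i vel t 0 i * ((1%:M - gc t *: Sc t) *m hc t) i j =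
      (\sum_i vel t 0 i * 'D_(e_ i) (fun r => 'D_(e_ j) g r) (gam t)) -
      U t * \sum_i vel t 0 i * (Gam i j (gam t) *m (th t)^T) 0 0.
    rewrite mulr_sumr -sumrB; apply: eq_bigr => i _.
    rewrite (hess i j (gamD It)) grad // mulrDr.
    rewrite (_ : (th t *m _) 0 0 = (Gam i j (gam t) *m (th t)^T) 0 0); last first.
      by rewrite !mxE; apply: eq_bigr => l _; rewrite [X in _ * X]mxE [X in _ = _ * X]mxE mulrC.
    by rewrite [U t * (_ * _)]mulrCA addrAC subrr add0r.
  rewrite [X in X - _](_ : _ = slope U t * th t 0 j + U t * slope (fun s => th s 0 j) t); last first.
    by rewrite Hj.
  by rewrite mulrBr addrA.
have pairI t Y : I t -> eval2 ((1%:M - gc t *: Sc t) *m hc t) (vel t) Y =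
    slope U t * (th t *m Y^T) 0 0 + U t * (kappa t *m Y^T) 0 0.
  by move=> It; rewrite /eval2 main // mulmxDl -!scalemxAl !mxE.
pose e t := 1 - lc t * gc t.
have se : smooth I e by apply: smoothB => //; [exact: smooth_cst|exact: smoothM].
have wS t : I t -> wc t *m Sc t = lc t *: wc t by move=> It; exact/eigen/gamD.
have Sh t : I t -> Sc t *m hc t = hc t *m (Sc t)^T by move=> It; exact/self_adjoint/gamD.
have sM : smooth I (fun t => (1%:M - gc t *: Sc t) *m hc t).
  apply: smooth_mulmx => //; apply: smooth_mx => // i j.
  under eq_fun do rewrite mxE [X in _ + X]mxE [X in _ - X]mxE.
  apply: smoothB => //; first exact: smooth_cst.
  by apply: smoothM => //; exact: smooth_coord.
(* Self-adjointness moves [S] onto [w], an eigenvector along the whole curve, and the factor [e]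
   comes out. *)
have E1 t : I t -> e t * eval2 (hc t) (vel t) (wc t) =
    slope U t * (th t *m (wc t)^T) 0 0 + U t * (kappa t *m (wc t)^T) 0 0.
  move=> It; rewrite -pairI // eval2_sub_shape (eval2_shape _ (Sh t It) (wS t It)) /e; ring.
(* Away from [p] the vector [E] is not assumed to be an eigenvector: the [w]-part of the velocity
   still yields [e], and the [E]-part stays as the Hessian term. *)
have E2 t : I t -> e t * (ab t 0 0 * eval2 (hc t) (wc t) E)
    + ab t 0 1 * eval2 ((1%:M - gc t *: Sc t) *m hc t) E E =
    slope U t * (th t *m E^T) 0 0 + U t * (kappa t *m E^T) 0 0.
  move=> It; rewrite -pairI // (velE t It) eval2Dl; congr (_ + _).
  rewrite eval2_sub_shape (wS t It) eval2Zl /e; ring.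
have E3 t : I t -> e t + lc t * gc t = 1 by move=> _; rewrite /e subrK.
have E4 t : I t -> slope gc t = U t * (th t *m (vel t)^T) 0 0.
  by move=> It; rewrite (slope_comp_curve sg It) grad.
have E5 t : I t -> slope lc t = ab t 0 0 * ridge_function (gam t) + ab t 0 1 * 'D_E lam (gam t).
  move=> It; have dl := smooth_differentiable slam (gamD It).
  rewrite (slope_comp_curve slam It) -/(vel t) (velE t It).
  by rewrite (deriveDv _ _ dl) !(deriveZv _ _ dl).
have [wE ww EE] := eval2_ww_EE.
have vel0 : vel 0 = k *: w p by [].
have ab0 : ab 0 0 0 = k.
  rewrite /ab vel0 /wc gam0.
  have -> : k *: w p = row2 k 0 *m frame_mx (w p) E.
    by rewrite mul_frame_mx row2_0 row2_1 scale0r addr0.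
  by rewrite mulmxK ?row2_0 //; exact: frame.
have sm : smooth I (fun t => ridge_function (gam t)).
  exact: (cD _ smooth_ridge_function).
(* In the notation of [gradient_order], [H] is h(velocity, w), [kap] is (1 - g S) h on [E], [eta] is
   a h(w, E), [rho] is [th] on the velocity, and [a], [b] are the components of the velocity in the
   frame. *)
have [|||||||A1 A2 A3 A4] := gradient_order oI I0 sU (spair _ _ _ shc svel swc)
  (sdot _ _ sth swc) (sdot _ _ skappa swc) (smooth_coord 0 0 oI sab) (smooth_coord 0 1 oI sab)
  (spair _ _ _ sM sE sE) (smoothM oI (smooth_coord 0 0 oI sab) (spair _ _ _ shc swc sE))
  (sdot _ _ skappa sE) (sdot _ _ sth sE) sgc (sdot _ _ sth svel) slc
  (cD _ (smooth_derive E slam)) sm se E1 E2 E3 E4 E5.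
- by rewrite vel0 /hc /wc gam0 eval2Zl mulf_neq0.
- by rewrite /wc gam0.
- by rewrite /hc /Sc /gc gam0; exact: eval2_hess_EE.
- by rewrite ab0.
- by rewrite /gc gam0 gp invr_eq0.
- exact: U0.
- by rewrite /e /lc /gc gam0 gp mulfV // subrr.
rewrite gam0 in A3 A4.
split=> // m0; apply: (iff_trans (A4 m0)).
rewrite (slope_comp_curve smooth_ridge_function I0) gam0 -/(vel 0) vel0.
rewrite (deriveZv _ _ (smooth_differentiable smooth_ridge_function Dp)).
split=> [/eqP|->]; last exact: mulr0.
by rewrite -[_ *: _]/(_ * _) mulf_eq0 (negbTE k0) => /eqP.
Qed.

End Curve.

Lemma frame_independent (a b : R) : a *: w p + b *: E = 0 -> a = 0 /\ b = 0.
Proof.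
move=> H; have /frame_inj E0 : row2 a b *m frame_mx (w p) E = 0.
  by rewrite mul_frame_mx row2_0 row2_1.
by split; [rewrite -(row2_0 a b)|rewrite -(row2_1 a b)]; rewrite E0 mxE.
Qed.

Lemma A3_of_transverse_ridge :
  ridge_function p = 0 -> 'D_(w p) ridge_function p != 0 -> A_point 3 g p.
Proof.
move=> m0 m1.
have gEE : 'D_E (fun q => 'D_E g q) p != 0 by rewrite hessian_eval2 eval2_hess_EE.
have [eps [Y [eps0 sY Y0 HY]]] :=
  implicit_curve (w p) oD Dp (smooth_derive E sg) (crit E) gEE.
pose gam t := p + t *: w p + Y t *: E.
have oI : open (ball (0 : R) eps) by exact: ball_open.
have I0 : ball (0 : R) eps 0 by exact: ballxx.
have sgam : smooth (ball (0 : R) eps) gam by exact: smooth_graph_curve.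
have gamD t : ball (0 : R) eps t -> D (gam t) by move=> /HY[].
have gam0 : gam 0 = p by rewrite /gam Y0 !scale0r !addr0.
have dgam t : ball (0 : R) eps t -> 'D_1 gam t = w p + 'D_1 Y t *: E.
  by move=> It; exact: (derive_graph_curve _ _ _ oI sY It).
(* Differentiating dg(E) = 0 along the curve: [w p] lies in the kernel of the Hessian, so only Y'
   Hess(E, E) remains. *)
have Y1 : 'D_1 Y 0 = 0.
  have := slope_comp_curve sgam gamD (smooth_derive E sg) I0.
  rewrite (slope_congr oI (fun t It => (HY t It).2) I0) slope_cst gam0 hessian_eval2 dgam //.
  rewrite -[w p]scale1r eval2Dl mul1r eval2_sub_shape (eigen Dp) eval2Zl gp.
  rewrite mulrA mulVf // mul1r subrr add0r => /esym/eqP.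
  by rewrite -gp mulf_eq0 (negbTE eval2_hess_EE) orbF => /eqP.
have dgam0 : 'D_1 gam 0 = 1 *: w p by rewrite dgam // Y1 scale0r addr0 scale1r.
pose U t := 'D_(w p) g (gam t).
have sU : smooth (ball (0 : R) eps) U.
  exact: smooth_comp_rV gamD sgam (smooth_derive (w p) sg).
pose L := invmx (frame_mx (w p) E).
(* The first column of the inverse frame, that is the constant covector with value 1 on [w p] and 0
   on [E]. As dg(E) = 0 on the curve, dg is dg(w p) times this covector. *)
pose th (t : R) : plane := \row_j L j 0.
have sth : smooth (ball (0 : R) eps) th by exact: smooth_cst.
have U0 : U 0 = 0 by rewrite /U gam0.
have gradU t j : ball (0 : R) eps t -> 'D_(e_ j) g (gam t) = U t * th t 0 j.
  move=> It; have dg := smooth_differentiable sg (gamD t It).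
  have -> : e_ j = (e_ j *m L) 0 0 *: w p + (e_ j *m L) 0 1 *: E.
    by rewrite -mul_frame_mx mulmxKV //; exact: frame.
  rewrite (deriveDv _ _ dg) !(deriveZv _ _ dg) (HY t It).2 scaler0 addr0.
  by rewrite -rowE !mxE mulrC.
have thw : (th 0 *m (w p)^T) 0 0 != 0.
  suff -> : (th 0 *m (w p)^T) 0 0 = 1 by exact: oner_neq0.
  have <- : (w p *m L) 0 0 = 1.
    have {1}-> : w p = row2 1 0 *m frame_mx (w p) E.
      by rewrite mul_frame_mx row2_0 row2_1 scale1r scale0r addr0.
    by rewrite mulmxK ?row2_0 //; exact: frame.
  by rewrite !mxE; apply: eq_bigr => j _; rewrite !mxE mulrC.
have k1 : (1 : R) != 0 by exact: oner_neq0.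
have [U1 A3 A4] := gradient_order_curve eps0 sgam gamD gam0 k1 dgam0 sU sth U0 gradU thw.
pose G t := g (gam t).
(* The velocity is [w p] plus a multiple of [E], and dg kills [E] here. Derivatives of [g] along the
   curve are therefore those of [U], one order lower. *)
have G1 t : ball (0 : R) eps t -> slope G t = U t.
  move=> It; rewrite (slope_comp_curve sgam gamD sg It) dgam //.
  have dg := smooth_differentiable sg (gamD t It).
  by rewrite (deriveDv _ _ dg) (deriveZv _ _ dg) (HY t It).2 scaler0 addr0.
have GU j t : ball (0 : R) eps t -> iter j.+1 (@slope R) G t = iter j (@slope R) U t.
  elim: j t => [|j IH] t It; first exact: G1.
  exact: (slope_congr oI IH It).
have Gj j : (0 < j < 4)%N -> iter j (@slope R) G 0 = 0.
  case: j => [|[|[|[|//]]]] // _.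
  - exact: (etrans (GU 0%N 0 I0) U0).
  - exact: (etrans (GU 1%N 0 I0) U1).
  - exact: (etrans (GU 2%N 0 I0) (A3.2 m0)).
apply: (A3_normal_form oD Dp sg crit frame_independent gEE eps0 sY Y0 HY Gj).
have -> : iter 4 (@slope R) (fun t => g (p + t *: w p + Y t *: E)) 0 = slope (slope (slope U)) 0.
  exact: GU 3%N 0 I0.
by apply: contra m1 => /eqP H; apply/eqP/(A4 m0).1.
Qed.

Lemma transverse_ridge_of_A3 :
  A_point 3 g p -> ridge_function p = 0 /\ 'D_(w p) ridge_function p != 0.
Proof.
move=> [_ [V [Wn [phi [psi [c [s1 [s2 [[[oV oW sphi spsi] [phiP psiP]] Vp phip gphi]]]]]]]]].
have [W0 psi0] := phiP p Vp; rewrite phip in W0 psi0.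
pose ax t : plane := row2 t 0.
have sax : smooth setT ax.
  by apply: smooth_row2; [exact: openT|exact: smooth_id|exact: smooth_cst].
have ax0 : ax 0 = 0 by apply: row2P; rewrite ?row2_0 ?row2_1 mxE.
have cax := smooth_continuous sax (I : setT 0).
have n1 : \forall t \near (0 : R), Wn (ax t) by apply: near_open_comp cax oW _; rewrite ax0.
have cpsi : {for (0 : R), continuous (fun t => psi (ax t))}.
  by apply: continuous_comp => //; rewrite ax0; exact: (smooth_continuous spsi W0).
have n2 : \forall t \near (0 : R), D (psi (ax t)).
  by apply: near_open_comp cpsi oD _; rewrite ax0 psi0.
have [eps eps0 Beps] := near3_ball n1 n2 n1.
pose gam t := psi (ax t).
have oI : open (ball (0 : R) eps) by exact: ball_open.
have I0 : ball (0 : R) eps 0 by exact: ballxx.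
have IW t : ball (0 : R) eps t -> Wn (ax t) by move=> /Beps[].
have gamD t : ball (0 : R) eps t -> D (gam t) by move=> /Beps[].
have gamV t : ball (0 : R) eps t -> V (gam t) by move=> /IW/psiP[].
have phigam t : ball (0 : R) eps t -> phi (gam t) = ax t by move=> /IW/psiP[].
have saxI : smooth (ball (0 : R) eps) ax by exact: smooth_sub sax.
have sgam : smooth (ball (0 : R) eps) gam.
  by apply: smooth_mx => // i j; exact: smooth_comp_rV IW saxI (smooth_coord i j oW spsi).
have gam0 : gam 0 = p by rewrite /gam ax0 psi0.
pose phi0 q := phi q 0 0; pose phi1 q := phi q 0 1.
have sphi0 : smooth V phi0 by exact: smooth_coord.
have sphi1 : smooth V phi1 by exact: smooth_coord.
(* The factor 1 matches the shape [c * t ^+ n.+1] of [slope_pow]. *)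
pose U (t : R) := 1 * t ^+ 3.
have sU : smooth (ball (0 : R) eps) U.
  apply: smoothM => //; first exact: smooth_cst.
  by apply: smoothX => //; exact: smooth_id.
(* The differential of the quartic term, without its factor t^3; the quadratic term contributes
   nothing because [phi1] vanishes on the axis. *)
pose th t : plane := \row_j (4 * (-1) ^+ s1 * 'D_(e_ j) phi0 (gam t)).
have sth : smooth (ball (0 : R) eps) th.
  apply: smooth_mx => // i j; under eq_fun do rewrite mxE.
  apply: smoothM => //; first exact: smooth_cst.
  exact: smooth_comp_rV gamV sgam (smooth_derive (e_ j) sphi0).
have U0 : U 0 = 0 by rewrite /U expr0n mulr0.
have gradU t j : ball (0 : R) eps t -> 'D_(e_ j) g (gam t) = U t * th t 0 j.
  move=> It; have Vg := gamV t It.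
  rewrite (@near_eq_derive _ _ _ _ (fun q => c + (-1) ^+ s1 * phi0 q ^+ 4 + (-1) ^+ s2 * phi1 q ^+ 2)); last first.
    by apply: open_near oV Vg _ => q; rewrite inE => /gphi.
  have d0 := smooth_derivable (v := e_ j) sphi0 Vg.
  have d1 := smooth_derivable (v := e_ j) sphi1 Vg.
  have e4 := smooth_derivable (v := e_ j) (smoothX 4 oV sphi0) Vg.
  have e2 := smooth_derivable (v := e_ j) (smoothX 2 oV sphi1) Vg.
  have z4 := derivableZ (k := (-1) ^+ s1) e4.
  have z2 := derivableZ (k := (-1) ^+ s2) e2.
  rewrite [LHS](deriveD (derivableD (derivable_cst c _ _) z4) z2).
  rewrite (deriveD (derivable_cst c _ _) z4) derive_cst add0r (deriveZ _ e4) (deriveZ _ e2).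
  rewrite (derive_pow _ d0) (derive_pow _ d1) /phi0 /phi1 phigam // row2_0 row2_1.
  rewrite -[X in X + _]/(_ * _) -[X in _ + X]/(_ * _) mxE /U /phi0; ring.
have dX (f : plane -> R) (t : R) := @slope_comp_curve eps gam sgam gamD f t.
(* The gradient vanishes to third order along the axis, so the Hessian at [p] kills the velocity. *)
have [k dgam0] : exists k, 'D_1 gam 0 = k *: w p.
  apply: hessian_degenerate => j.
  rewrite -(derive_row_sum _ (smooth_differentiable (smooth_derive (e_ j) sg) Dp)).
  have := dX _ _ (smooth_derive (e_ j) sg) I0; rewrite gam0 => <-.
  rewrite (slope_congr oI (fun t It => gradU t j It) I0) (slopeM sU (smooth_coord 0 j oI sth) I0).
  by rewrite U0 mul0r addr0 /U slope_pow expr0n mulr0 mul0r.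
(* On the axis [phi0] is the parameter itself. This one identity shows both that [k] is non-zero and
   that [th] does not kill [w p]. *)
have phi_gam' : 'D_('D_1 gam 0) phi0 p = 1.
  have dphi := smooth_differentiable sphi0 (gamV 0 I0).
  have := derive_comp (1 : R) (smooth_differentiable sgam I0) dphi; rewrite gam0 => <-.
  rewrite -slopeE (slope_congr oI (g := id) _ I0); first by rewrite slopeE derive_id.
  by move=> t It; rewrite /phi0 phigam // row2_0.
have kphi : k * 'D_(w p) phi0 p = 1.
  by rewrite -phi_gam' dgam0 (deriveZv _ _ (smooth_differentiable sphi0 Vp)).
have k0 : k != 0.
  by apply/eqP => k0; move: kphi; rewrite k0 mul0r => /eqP; rewrite eq_sym oner_eq0.
have thw : (th 0 *m (w p)^T) 0 0 != 0.
  have -> : (th 0 *m (w p)^T) 0 0 = 4 * (-1) ^+ s1 * 'D_(w p) phi0 p.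
    rewrite (derive_row_sum _ (smooth_differentiable sphi0 Vp)) mulr_sumr mxE.
    apply: eq_bigr => j _; rewrite !mxE gam0 -[_ *: _]/(_ * _); ring.
  rewrite !mulf_neq0 ?signr_eq0 ?pnatr_eq0 //.
  by apply/eqP => H; move: kphi; rewrite H mulr0 => /eqP; rewrite eq_sym oner_eq0.
have [U1 A3 A4] := gradient_order_curve eps0 sgam gamD gam0 k0 dgam0 sU sth U0 gradU thw.
(* For U = t^3 the second derivative vanishes at 0 and the third is 6. *)
have m0 : ridge_function p = 0.
  by apply: A3.1; rewrite /U !slope_pow expr1 mulr0.
split=> //; apply/eqP => H; have := (A4 m0).2 H.
by rewrite /U !slope_pow expr0 mulr1 => /eqP; rewrite !mulf_eq0 oner_eq0 !pnatr_eq0.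
Qed.

End Criterion.

(** * Equiaffine congruences *)

Section Dot.
Context {R : realType}.
Local Notation space := 'rV[R]_3.
Implicit Types (x y z : space).

Lemma dotDr x y z : dot x (y + z) = dot x y + dot x z.
Proof. by rewrite /dot -big_split; apply: eq_bigr => k _; rewrite mxE mulrDr. Qed.

Lemma dotZr x y a : dot x (a *: y) = a * dot x y.
Proof. by rewrite /dot mulr_sumr; apply: eq_bigr => k _; rewrite mxE mulrCA. Qed.

Lemma dotNr x y : dot x (- y) = - dot x y.
Proof. by rewrite -scaleN1r dotZr mulN1r. Qed.

Lemma row2_dot (A : 'rV[R]_2) x y z :
  (row2 (dot x y) (dot x z) *m A^T) 0 0 = dot x (A 0 0 *: y + A 0 1 *: z).
Proof.
rewrite dotDr !dotZr mxE big_ord_recl big_ord1 (_ : lift _ _ = 1); last exact/val_inj.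
by rewrite row2_0 row2_1 !mxE; congr (_ + _); exact: mulrC.
Qed.

Lemma smooth_dot (V : normedModType R) (D : set V) (a b : V -> space) : open D ->
  smooth D a -> smooth D b -> smooth D (fun q => dot (a q) (b q)).
Proof.
by move=> oD sa sb; apply: smooth_sum => // k; apply: smoothM => //; exact: smooth_coord.
Qed.

Lemma derive_dot (V : normedModType R) (a b : V -> space) q v :
  derivable a q v -> derivable b q v ->
  'D_v (fun r => dot (a r) (b r)) q = dot ('D_v a q) (b q) + dot (a q) ('D_v b q).
Proof.
move=> da db.
have dak k : derivable (fun r => a r 0 k) q v by exact: ((derivable_mxP a q v).1 da).
have dbk k : derivable (fun r => b r 0 k) q v by exact: ((derivable_mxP b q v).1 db).
rewrite (_ : (fun r => dot (a r) (b r)) = \sum_(k < 3) ((fun r => a r 0 k) * (fun r => b r 0 k)));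
  last by apply/funext => r; rewrite /dot fct_sumE.
rewrite derive_sum; last by move=> k; exact: derivableM.
rewrite /dot -big_split; apply: eq_bigr => k _.
rewrite (deriveM (dak k) (dbk k)) -(derive_coord _ _ da) -(derive_coord _ _ db).
by rewrite addrC [X in X + _]mulrC.
Qed.

(** The default value of [nth] supplies the third row. *)
Definition frame3 (a b c : space) : 'M[R]_3 := \matrix_(i < 3) nth c [:: a; b] i.

Definition row3 (a b c : R) : space := \row_(j < 3) nth c [:: a; b] j.

Lemma ord3 (P : 'I_3 -> Prop) : P 0 -> P 1 -> P 2 -> forall i, P i.
Proof.
move=> P0 P1 P2 [[|[|[|//]]] li].
- by rewrite (_ : Ordinal li = 0) //; exact/val_inj.
- by rewrite (_ : Ordinal li = 1) //; exact/val_inj.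
- by rewrite (_ : Ordinal li = 2) //; exact/val_inj.
Qed.

Lemma mul_frame3 (v a b c : space) :
  v *m frame3 a b c = v 0 0 *: a + v 0 1 *: b + v 0 2 *: c.
Proof.
rewrite mulmx_sum_row !big_ord_recl big_ord0 addr0 !rowK /= addrA.
by congr (_ *: _ + _ *: _ + _ *: _); congr (v _ _); exact/val_inj.
Qed.

Lemma row3E a b c : [/\ row3 a b c 0 0 = a, row3 a b c 0 1 = b & row3 a b c 0 2 = c].
Proof. by split; rewrite mxE. Qed.

Lemma smooth_frame3 (V : normedModType R) (D : set V) (a b c : V -> space) : open D ->
  smooth D a -> smooth D b -> smooth D c -> smooth D (fun q => frame3 (a q) (b q) (c q)).
Proof.
move=> oD sa sb sc; apply: smooth_mx => // i j; under eq_fun do rewrite mxE.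
by elim/ord3: i => /=; exact: smooth_coord.
Qed.

End Dot.

Section VectorProduct.
Context {R : realType}.
Variables (V : normedModType R) (n : nat).
Implicit Types (k : V -> R) (u : V -> 'rV[R]_n).

Lemma smooth_scale (D : set V) k u : open D -> smooth D k -> smooth D u ->
  smooth D (fun q => k q *: u q).
Proof.
move=> oD sk su; apply: smooth_mx => // i j; under eq_fun do rewrite mxE.
by apply: smoothM => //; exact: smooth_coord.
Qed.

Lemma derive_scale k u q v : derivable k q v -> derivable u q v ->
  'D_v (fun r => k r *: u r) q = 'D_v k q *: u q + k q *: 'D_v u q.
Proof.
move=> dk du.
have duj j : derivable (fun r => u r 0 j) q v by exact: ((derivable_mxP u q v).1 du).
have dkuj j : derivable (fun r => k r * u r 0 j) q v by exact: (derivableM dk (duj j)).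
have dku : derivable (fun r => k r *: u r) q v.
  apply/derivable_mxP => i j; rewrite (ord1 i).
  by under eq_fun do rewrite mxE; exact: dkuj.
apply/rowP => j; rewrite (derive_coord 0 j dku).
rewrite (_ : (fun r => (k r *: u r) 0 j) = k * (fun r => u r 0 j)); last first.
  by apply/funext => r; rewrite mxE.
rewrite (deriveM dk (duj j)) -(derive_coord 0 j du) !mxE.
by rewrite addrC; congr (_ + _); exact: mulrC.
Qed.

End VectorProduct.

Section EigenLine.
Context {K : fieldType}.
Implicit Types (S : 'M[K]_2) (w u x : 'rV[K]_2).

Lemma eigen_decomposition S w u l mu x : w != 0 -> u != 0 ->
  w *m S = l *: w -> u *m S = mu *: u -> l != mu -> exists a b : K, x = a *: w + b *: u.
Proof.
move=> w0 u0 wS uS lmu.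
have uF : frame_mx w u \in unitmx by apply: frame_unitmx; exact: eigen_frame wS uS lmu.
exists ((x *m invmx (frame_mx w u)) 0 0), ((x *m invmx (frame_mx w u)) 0 1).
by rewrite -mul_frame_mx mulmxKV.
Qed.

Lemma eigen_line S w u l mu x : w != 0 -> u != 0 ->
  w *m S = l *: w -> u *m S = mu *: u -> l != mu -> x *m S = l *: x ->
  exists k : K, x = k *: w.
Proof.
move=> w0 u0 wS uS lmu; have [a [b ->]] := eigen_decomposition x w0 u0 wS uS lmu.
move=> xS; exists a; have : (b * (mu - l)) *: u = 0.
  have -> : (b * (mu - l)) *: u = (a *: w + b *: u) *m S - l *: (a *: w + b *: u).
    rewrite mulmxDl -!scalemxAl wS uS; apply/rowP => j; rewrite !mxE; ring.
  by rewrite xS subrr.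
move/eqP; rewrite scaler_eq0 (negbTE u0) orbF mulf_eq0 subr_eq0 [mu == _]eq_sym (negbTE lmu) orbF.
by move=> /eqP ->; rewrite scale0r addr0.
Qed.

(** By Cayley-Hamilton, S - mu maps every vector into the eigenline for [l]. Applied to a fixed
    vector it gives an eigenvector field as smooth as [S] and mu. *)
Lemma eigen_projection S w u l mu x : w != 0 -> u != 0 ->
  w *m S = l *: w -> u *m S = mu *: u -> l != mu ->
  (x *m (S - mu%:M)) *m S = l *: (x *m (S - mu%:M)).
Proof.
move=> w0 u0 wS uS lmu; have [a [b ->]] := eigen_decomposition x w0 u0 wS uS lmu.
have -> : (a *: w + b *: u) *m (S - mu%:M) = (a * (l - mu)) *: w.
  rewrite mulmxBr mul_mx_scalar mulmxDl -!scalemxAl wS uS.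
  by apply/rowP => j; rewrite !mxE; ring.
by rewrite -scalemxAl wS !scalerA mulrC.
Qed.

End EigenLine.

(** * Co-normal, shape operator and metric of an equiaffine congruence *)

Section Congruence.
Context {R : realType}.
Local Notation plane := 'rV[R]_2.
Local Notation space := 'rV[R]_3.
Local Notation e_ j := (delta_mx 0 j : plane).
Variables (U : set plane) (f xi : plane -> space).
Variables (S : plane -> 'M[R]_2) (tau : plane -> 'cV[R]_2).
Variables (nabla : plane -> plane -> plane -> plane) (h : plane -> 'M[R]_2).
Variable (nu : plane -> space).
Hypotheses (hfxi : line_congruence U f xi) (hstr : structure_equations U f xi S tau nabla h).
Hypotheses (heq : equiaffine U tau h) (hnu : conormal U f xi nu).

Let oU : open U. Proof. by case: hfxi. Qed.
Let sf : smooth U f. Proof. by case: hfxi. Qed.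
Let sxi : smooth U xi. Proof. by case: hfxi. Qed.

Definition moving_frame q := frame3 ('D_(e_ 0) f q) ('D_(e_ 1) f q) (xi q).

Lemma derive_f q X : U q -> 'D_X f q = X 0 0 *: 'D_(e_ 0) f q + X 0 1 *: 'D_(e_ 1) f q.
Proof.
move=> Uq; rewrite (derive_row_sum X (smooth_differentiable sf Uq)) big_ord_recl big_ord1.
by rewrite (_ : lift _ _ = 1) //; exact/val_inj.
Qed.

Lemma tangent_normal_eq0 q X a : U q -> 'D_X f q + a *: xi q = 0 -> X = 0 /\ a = 0.
Proof.
move=> Uq H; have [_ _ _ imm trans] := hfxi.
have df := smooth_differentiable sf Uq.
have a0 : a = 0.
  apply/eqP; apply: contraT => a0; exfalso; apply: (trans q Uq (- a^-1 *: X)).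
  rewrite (deriveZv _ _ df); move/eqP: H; rewrite addr_eq0 => /eqP ->.
  by rewrite scalerN scaleNr opprK scalerA mulVf // scale1r.
split=> //; move: H; rewrite a0 scale0r addr0 => H.
have [_] := imm q Uq; apply; rewrite -(deriveE _ df) H.
by rewrite linear0.
Qed.

Lemma moving_frame_unit q : U q -> moving_frame q \in unitmx.
Proof.
move=> Uq; apply: unitmx_injective => v; rewrite mul_frame3.
have := @derive_f q (row2 (v 0 0) (v 0 1)) Uq; rewrite row2_0 row2_1 => <-.
move=> /(tangent_normal_eq0 Uq)[X0 v2].
apply/rowP; apply: ord3; rewrite [RHS]mxE //.
  by rewrite -(row2_0 (v 0 0) (v 0 1)) X0 mxE.
by rewrite -(row2_1 (v 0 0) (v 0 1)) X0 mxE.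
Qed.

Lemma smooth_moving_frame : smooth U moving_frame.
Proof. by apply: smooth_frame3 => //; exact: smooth_derive. Qed.

Lemma smooth_inv_frame : smooth U (fun q => invmx (moving_frame q)).
Proof. by apply: smooth_invmx => //; [exact: smooth_moving_frame|exact: moving_frame_unit]. Qed.

Lemma derive_xi q X : U q -> 'D_X xi q = - 'D_(X *m S q) f q.
Proof.
move=> Uq; have [-> _ _] := hstr Uq; have [-> _] := heq Uq.
by rewrite /eval1 mulmx0 mxE scale0r addr0.
Qed.

(** The defining equations are a linear system whose matrix, the moving frame, is smooth and
    invertible; its unique solution is smooth. *)
Lemma smooth_conormal : smooth U nu.
Proof.
have smT : smooth U (fun q => invmx (moving_frame q)^T).
  apply: smooth_invmx => //; last by move=> q Uq; rewrite unitmx_tr; exact: moving_frame_unit.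
  apply: smooth_mx => // i j; under eq_fun do rewrite mxE.
  by apply: smooth_coord => //; exact: smooth_moving_frame.
apply: (@smooth_ext _ _ _ _ (fun q => row3 0 0 1 *m invmx (moving_frame q)^T)) => //.
  move=> q; rewrite inE => Uq; have [nf nx] := hnu Uq.
  have <- : nu q *m (moving_frame q)^T = row3 0 0 1.
    apply/rowP => j; rewrite mxE.
    have [r0 r1 r2] := row3E (0 : R) 0 1.
    move: j; apply: ord3.
    - by rewrite r0 -[RHS](nf (e_ 0)); apply: eq_bigr => k _; rewrite !mxE.
    - by rewrite r1 -[RHS](nf (e_ 1)); apply: eq_bigr => k _; rewrite !mxE.
    - by rewrite r2 -[RHS]nx; apply: eq_bigr => k _; rewrite !mxE.
  by rewrite mulmxK // unitmx_tr; exact: moving_frame_unit.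
by apply: smooth_mulmx => //; exact: smooth_cst.
Qed.

(** As tau = 0, the coordinates of - D xi in the moving frame are the rows of [S] completed by 0. *)
Lemma smooth_shape : smooth U S.
Proof.
pose T q i := - 'D_(e_ i) xi q *m invmx (moving_frame q).
have sT i : smooth U (fun q => T q i).
  apply: smooth_mulmx => //; last exact: smooth_inv_frame.
  apply: smooth_mx => // a b; under eq_fun do rewrite mxE; apply: smoothN => //.
  by apply: smooth_coord => //; exact: smooth_derive.
have TE q i : U q -> T q i = row3 (S q i 0) (S q i 1) 0.
  move=> Uq; rewrite /T derive_xi // opprK derive_f // -rowE.
  have [r0 r1 r2] := row3E (S q i 0) (S q i 1) 0.
  apply: (can_inj (mulmxK (moving_frame_unit Uq))).
  by rewrite mulmxKV ?moving_frame_unit // mul_frame3 r0 r1 r2 scale0r addr0 !mxE.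
apply: smooth_mx => // i j.
have [j0|j1] : j = 0 \/ j = 1.
  by case: j => [[|[|//]] lj]; [left|right]; exact/val_inj.
  apply: (@smooth_ext _ _ _ _ (fun q => T q i 0 0)) => //; last exact: smooth_coord.
  by move=> q; rewrite inE => Uq; rewrite TE // j0; have [-> _ _] := row3E (S q i 0) (S q i 1) 0.
apply: (@smooth_ext _ _ _ _ (fun q => T q i 0 1)) => //; last exact: smooth_coord.
by move=> q; rewrite inE => Uq; rewrite TE // j1; have [_ -> _] := row3E (S q i 0) (S q i 1) 0.
Qed.

Lemma dot_nu_DDf q X Y : U q -> dot (nu q) ('D_X (fun r => 'D_Y f r) q) = eval2 (h q) X Y.
Proof.
move=> Uq; have [_ -> _] := hstr Uq; have [nf nx] := hnu Uq.
by rewrite dotDr nf dotZr nx mulr1 add0r.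
Qed.

Lemma eval2_delta (A : 'M[R]_2) i j : eval2 A (e_ i) (e_ j) = A i j.
Proof. by rewrite /eval2 -rowE mxE (bigD1 j) //= big1 ?addr0; [rewrite !mxE !eqxx mulr1|move=> k /negbTE kj; rewrite !mxE kj andbF mulr0]. Qed.

(** The structure equation paired with [nu] expresses h(X, Y) through second derivatives of [f]. *)
Lemma smooth_metric : smooth U h.
Proof.
apply: smooth_mx => // i j.
have := smooth_dot oU smooth_conormal (smooth_derive (e_ i) (smooth_derive (e_ j) sf)).
apply: smooth_ext => // q; rewrite inE => Uq.
by rewrite (dot_nu_DDf _ _ Uq) eval2_delta.
Qed.

Let dnu q v : U q -> derivable nu q v.
Proof. by move=> Uq; exact: (smooth_derivable smooth_conormal Uq). Qed.

Lemma dot_Dnu_Df q X Y : U q -> dot ('D_X nu q) ('D_Y f q) = - eval2 (h q) X Y.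
Proof.
move=> Uq; apply/eqP; rewrite -addr_eq0 -(dot_nu_DDf X Y Uq).
rewrite -(derive_dot (@dnu q X Uq) (smooth_derivable (v := X) (smooth_derive Y sf) Uq)).
rewrite (@near_eq_derive _ _ _ _ (fun=> 0)) ?derive_cst //.
by apply: open_near oU Uq _ => r; rewrite inE => Ur; have [-> _] := hnu Ur.
Qed.

(** Differentiate the normalization of [nu] against [xi]: since tau = 0, the derivative of [xi] is
    tangent and [nu] kills it. *)
Lemma dot_Dnu_xi q X : U q -> dot ('D_X nu q) (xi q) = 0.
Proof.
move=> Uq; have := derive_dot (@dnu q X Uq) (smooth_derivable (v := X) sxi Uq).
rewrite (derive_xi X Uq) dotNr; have [-> _] := hnu Uq; rewrite oppr0 addr0 => <-.
rewrite (@near_eq_derive _ _ _ _ (fun=> (1 : R))) ?derive_cst //.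
by apply: open_near oU Uq _ => r; rewrite inE => Ur; have [_ ->] := hnu Ur.
Qed.

Lemma dot_DDnu_xi q X Y : U q ->
  dot ('D_X (fun r => 'D_Y nu r) q) (xi q) = - eval2 (h q) Y (X *m S q).
Proof.
move=> Uq.
have := derive_dot (smooth_derivable (v := X) (smooth_derive Y smooth_conormal) Uq)
  (smooth_derivable (v := X) sxi Uq).
rewrite (@near_eq_derive _ _ _ _ (fun=> 0)) ?derive_cst; last first.
  by apply: open_near oU Uq _ => r; rewrite inE => Ur; exact: dot_Dnu_xi.
rewrite (derive_xi X Uq) dotNr (dot_Dnu_Df _ _ Uq) opprK => /esym/eqP.
by rewrite addr_eq0 => /eqP.
Qed.

Lemma DDnu_comm q X Y : U q ->
  'D_X (fun r => 'D_Y nu r) q = 'D_Y (fun r => 'D_X nu r) q.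
Proof.
move=> Uq; apply/rowP => j.
have dd A B := smooth_derivable (v := A) (smooth_derive B smooth_conormal) Uq.
have E A B : 'D_A (fun r => ('D_B nu r) 0 j) q = 'D_A (fun r => 'D_B (fun s => nu s 0 j) r) q.
  apply: near_eq_derive; apply: open_near oU Uq _ => r; rewrite inE => Ur.
  exact: (derive_coord 0 j (@dnu r B Ur)).
have snu := smooth_coord 0 j oU smooth_conormal.
apply: (etrans (derive_coord 0 j (dd X Y))); apply: (etrans (E X Y)).
apply: (etrans (derive_comm X Y oU Uq snu)); apply: (etrans (esym (E Y X))).
exact: (esym (derive_coord 0 j (dd Y X))).
Qed.

Lemma metric_sym q : U q -> (h q)^T = h q.
Proof. by move=> Uq; have [_ _] := hstr Uq. Qed.

(** The Ricci equation for tau = 0: second derivatives of [nu] are symmetric, and their pairing with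
    [xi] is - h(Y, S X). *)
Lemma shape_self_adjoint q : U q -> S q *m h q = h q *m (S q)^T.
Proof.
move=> Uq.
have E X Y : eval2 (h q) Y (X *m S q) = eval2 (h q) X (Y *m S q).
  apply: oppr_inj; apply: (etrans (esym (dot_DDnu_xi X Y Uq))).
  exact: (etrans (congr1 (fun v => dot v (xi q)) (DDnu_comm X Y Uq)) (dot_DDnu_xi Y X Uq)).
have -> : S q *m h q = (h q *m (S q)^T)^T by rewrite trmx_mul trmxK metric_sym.
apply/matrixP => i j; rewrite mxE -!eval2_delta.
have aux a b : eval2 (h q *m (S q)^T) (e_ a) (e_ b) = eval2 (h q) (e_ a) (e_ b *m S q).
  by rewrite /eval2 trmx_mul !mulmxA.
by rewrite !aux E.
Qed.

(** * Hessian of the support function *)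

Section Support.
Variable Z : space.

Let g q := support_function f nu q Z.

Let sposition : smooth U (fun q => Z - f q).
Proof.
apply: smooth_mx => // i j; under eq_fun do rewrite !mxE; apply: smoothB => //.
  exact: smooth_cst.
exact: smooth_coord.
Qed.

Let derive_position q X : U q -> 'D_X (fun r => Z - f r) q = - 'D_X f q.
Proof.
move=> Uq; have df := smooth_differentiable sf Uq.
have dfX : derivable f q X by exact: diff_derivable.
by rewrite [LHS](deriveB (derivable_cst Z q X) dfX) derive_cst sub0r.
Qed.

Lemma smooth_support : smooth U g.
Proof. exact: smooth_dot oU smooth_conormal sposition. Qed.

Lemma derive_support q X : U q -> 'D_X g q = dot ('D_X nu q) (Z - f q).
Proof.
move=> Uq.
have -> := derive_dot (@dnu q X Uq) (smooth_derivable (v := X) sposition Uq).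
by rewrite (derive_position X Uq) dotNr; have [-> _] := hnu Uq; rewrite oppr0 addr0.
Qed.

Lemma derive2_support q X Y : U q -> 'D_X (fun r => 'D_Y g r) q =
  dot ('D_X (fun r => 'D_Y nu r) q) (Z - f q) + eval2 (h q) Y X.
Proof.
move=> Uq.
rewrite (@near_eq_derive _ _ _ _ (fun r => dot ('D_Y nu r) (Z - f r))); last first.
  by apply: open_near oU Uq _ => r; rewrite inE => Ur; exact: derive_support.
have -> := derive_dot (smooth_derivable (v := X) (smooth_derive Y smooth_conormal) Uq)
  (smooth_derivable (v := X) sposition Uq).
by rewrite (derive_position X Uq) dotNr (dot_Dnu_Df _ _ Uq) opprK.
Qed.

Lemma position_decomposition q : U q -> exists A : plane, Z - f q = 'D_A f q + g q *: xi q.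
Proof.
move=> Uq; pose x := (Z - f q) *m invmx (moving_frame q).
have xE : Z - f q = 'D_(row2 (x 0 0) (x 0 1)) f q + x 0 2 *: xi q.
  by rewrite (derive_f _ Uq) row2_0 row2_1 -mul_frame3 mulmxKV // moving_frame_unit.
exists (row2 (x 0 0) (x 0 1)); rewrite {1}xE; congr (_ + _ *: _).
have [nf nx] := hnu Uq.
by rewrite /g /support_function xE dotDr nf dotZr nx mulr1 add0r.
Qed.

(** The coefficients expressing second derivatives of [nu] by first ones: D_i D_j nu is the
    derivative of [nu] along this vector plus a multiple of [nu]. Inverting [h] extracts them, as
    the first derivatives of [nu] pair with those of [f] through - h. *)
Definition christoffel i j q : plane :=
  - row2 (dot ('D_(e_ i) (fun r => 'D_(e_ j) nu r) q) ('D_(e_ 0) f q))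
         (dot ('D_(e_ i) (fun r => 'D_(e_ j) nu r) q) ('D_(e_ 1) f q)) *m invmx (h q).

Lemma smooth_christoffel i j : smooth U (christoffel i j).
Proof.
have s2 k : smooth U (fun q => dot ('D_(e_ i) (fun r => 'D_(e_ j) nu r) q) ('D_(e_ k) f q)).
  exact: smooth_dot oU (smooth_derive _ (smooth_derive _ smooth_conormal)) (smooth_derive _ sf).
apply: smooth_mulmx => //.
  apply: smooth_mx => // a b; under eq_fun do rewrite mxE; apply: smoothN => //.
  by apply: smooth_coord => //; exact: (smooth_row2 oU (s2 0) (s2 1)).
apply: smooth_invmx => //; first exact: smooth_metric.
by move=> q Uq; have [] := heq Uq.
Qed.

Lemma dot_derive_f n q A : U q ->
  (row2 (dot n ('D_(e_ 0) f q)) (dot n ('D_(e_ 1) f q)) *m A^T) 0 0 = dot n ('D_A f q).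
Proof.
by move=> Uq; rewrite (derive_f A Uq); exact: row2_dot.
Qed.

Lemma eval2_christoffel i j q A : U q -> eval2 (h q) (christoffel i j q) A =
  - dot ('D_(e_ i) (fun r => 'D_(e_ j) nu r) q) ('D_A f q).
Proof.
move=> Uq; have [_ hu] := heq Uq.
rewrite /eval2 /christoffel mulmxKV // mulNmx mxE; congr (- _).
exact: dot_derive_f.
Qed.

(** Split Z - f into a tangent part and g xi. The tangent part gives the term in dg, the part along
    [xi] gives - g S h, and differentiating Z - f itself gives h. *)
Lemma support_hessian q i j : U q ->
  'D_(e_ i) (fun r => 'D_(e_ j) g r) q =
  'D_(christoffel i j q) g q + ((1%:M - g q *: S q) *m h q) i j.
Proof.
move=> Uq; have [A ZA] := position_decomposition Uq.
rewrite (derive2_support _ _ Uq) (derive_support _ Uq) ZA !dotDr !dotZr.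
rewrite (dot_DDnu_xi _ _ Uq) (dot_Dnu_xi _ Uq) (dot_Dnu_Df _ _ Uq).
rewrite (eval2_christoffel i j A Uq) opprK mulr0 addr0 -addrA; congr (_ + _).
rewrite -[RHS]eval2_delta eval2_sub_shape.
have sym X Y : eval2 (h q) X Y = eval2 (h q) Y X.
  by rewrite /eval2 -[in LHS](trmxK (X *m h q *m Y^T)) mxE !trmx_mul trmxK metric_sym // mulmxA.
by rewrite mulrN addrC (sym (e_ j) (e_ i)) (sym (e_ j)).
Qed.

Lemma support_critical q l X : U q -> Z = f q + l *: xi q -> 'D_X g q = 0 /\ g q = l.
Proof.
move=> Uq ZE; have [_ nx] := hnu Uq.
have pE : Z - f q = l *: xi q by rewrite ZE addrC addKr.
split; first by rewrite (derive_support _ Uq) pE dotZr dot_Dnu_xi // mulr0.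
by rewrite /g /support_function pE dotZr nx mulr1.
Qed.

End Support.

(** * Eigenvector fields, focal maps and ridges *)

Section Focal.
Variable lambda : 'I_2 -> plane -> R.
Hypothesis hlambda : shape_eigenvalues U S lambda.
Local Notation H := (hyperbolic_locus U S).

Lemma open_hyperbolic : open H.
Proof.
have sd : smooth U (fun q => delta (S q)).
  have sS a b : smooth U (fun q => S q a b) by exact: (smooth_coord a b oU smooth_shape).
  apply: smoothD => //.
    by apply: smoothX => //; exact: smoothB.
  apply: smoothM => //; apply: smoothM => //; exact: smooth_cst.
rewrite openE => q [Uq dq]; rewrite /interior.
have n1 : \near q, U q by exact: (open_nbhs_nbhs (conj oU Uq)).
have n2 := near_open_comp (smooth_continuous sd Uq) (@open_gt R 0) dq.
by near=> r; split; near: r.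
Unshelve. all: by end_near. Qed.

Lemma smooth_eigenvalue i : smooth H (lambda i).
Proof. by case: hlambda => sl _ _; exact: sl. Qed.

Lemma eigenvalue_vector q i : H q -> exists2 v : plane, v != 0 & v *m S q = lambda i q *: v.
Proof.
case: hlambda => _ ev _ Hq; have /eigenvalueP[v vS v0] := ev q Hq i.
by exists v.
Qed.

Lemma other_eigenvalue i : exists j, forall q, H q -> lambda i q != lambda j q.
Proof.
case: hlambda => _ _ dis; have [i0|i1] : i = 0 \/ i = 1.
- by case: i => [[|[|//]] li]; [left|right]; exact/val_inj.
- by exists 1 => q Hq; rewrite i0; exact: dis.
by exists 0 => q Hq; rewrite i1 eq_sym; exact: dis.
Qed.

(** The field is S - lambda_j applied to a fixed eigenvector of [S q0]. It may vanish away from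
    [q0], so only the eigenvector equation is claimed on the whole locus, and the frame is claimed
    at [q0]. *)
Lemma eigenframe i j q0 : (forall q, H q -> lambda i q != lambda j q) -> H q0 ->
  exists (w : plane -> plane) (E : plane),
    [/\ smooth H w, forall q, H q -> w q *m S q = lambda i q *: w q,
        frame_mx (w q0) E \in unitmx & E *m S q0 = lambda j q0 *: E].
Proof.
move=> dis Hq0; have [v0 v00 v0S] := eigenvalue_vector i Hq0.
have [E E0 ES] := eigenvalue_vector j Hq0.
have HU : H `<=` U by move=> q [].
exists (fun q => v0 *m (S q - (lambda j q)%:M)), E; split=> //.
- apply: smooth_mulmx => //; [exact: open_hyperbolic|exact: smooth_cst|].
  apply: smooth_mx; first exact: open_hyperbolic.
  move=> a b; under eq_fun do rewrite !mxE; apply: smoothB; first exact: open_hyperbolic.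
    apply: smooth_coord; first exact: open_hyperbolic.
    exact: smooth_sub HU smooth_shape.
  case: (a == b).
    by under eq_fun do rewrite mulr1n; exact: smooth_eigenvalue.
  by under eq_fun do rewrite mulr0n; exact: smooth_cst.
- move=> q Hq; have [w w0 wS] := eigenvalue_vector i Hq.
  have [u u0 uS] := eigenvalue_vector j Hq.
  exact: eigen_projection w0 u0 wS uS (dis q Hq).
apply: frame_unitmx => a b; rewrite mulmxBr mul_mx_scalar v0S -scalerBl scalerA.
move=> /(eigen_frame v00 E0 v0S ES (dis q0 Hq0)) [/eqP].
rewrite mulf_eq0 subr_eq0 (negbTE (dis q0 Hq0)) orbF => /eqP -> ->.
by [].
Qed.

Lemma derive_focal_map i q X : H q -> lambda i q != 0 ->
  differentiable (focal_map f xi (lambda i)) q /\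
  'D_X (focal_map f xi (lambda i)) q =
    'D_(X - (lambda i q)^-1 *: (X *m S q)) f q
    + (- ((lambda i q) ^- 2 * 'D_X (lambda i) q)) *: xi q.
Proof.
move=> Hq l0; have [Uq _] := Hq.
pose D := H `&` [set r | lambda i r != 0].
have oD : open D.
  rewrite openE => r [Hr lr]; rewrite /interior.
  have n1 : \near r, H r by exact: (open_nbhs_nbhs (conj open_hyperbolic Hr)).
  have n2 := near_open_comp (smooth_continuous (@smooth_eigenvalue i) Hr) (@open_neq R 0) lr.
  by near=> s; split; near: s.
have Dq : D q by [].
have sl : smooth D (lambda i) by apply: smooth_sub (@smooth_eigenvalue i) => r [].
have sub : D `<=` U by move=> r [[]].
have sl' : smooth D (fun r => (lambda i r)^-1) by apply: smoothV => // r [].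
have sx : smooth D xi by exact: smooth_sub sub sxi.
have sfD : smooth D f by exact: smooth_sub sub sf.
have s2 := smooth_scale oD sl' sx.
split; first exact: (smooth_differentiable (smoothD oD sfD s2) Dq).
have df := smooth_differentiable sfD Dq.
have -> := deriveD (smooth_derivable (v := X) sfD Dq) (smooth_derivable (v := X) s2 Dq).
rewrite (derive_scale (smooth_derivable (v := X) sl' Dq) (smooth_derivable (v := X) sx Dq)).
rewrite (derive_xi X Uq) (deriveV l0 (smooth_derivable (v := X) sl Dq)).
rewrite -scaleNr (deriveDv _ _ df) (deriveZv _ _ df) scaleNr scalerN.
by rewrite !scaleNr addrA addrAC.
Unshelve. all: by end_near. Qed.

(** The tangent part of the derivative of the focal map vanishes exactly on the eigenline; there the
    part along [xi] is dlambda up to a non-zero factor. *)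
Lemma ridge_eigenvector i j q w : (forall q, H q -> lambda i q != lambda j q) ->
  H q -> lambda i q != 0 -> eigenvector (S q) (lambda i q) w ->
  ridge U S f xi (lambda i) q <-> 'D_w (lambda i) q = 0.
Proof.
move=> dis Hq l0 [w0 wS]; have [Uq _] := Hq.
have dF X := derive_focal_map X Hq l0.
have [diffF _] := dF 0.
split=> [[_ _ nimm]|dl0].
  apply/eqP; apply: contraT => dl; exfalso; apply: nimm; split=> //.
  suff key X : 'D_X (focal_map f xi (lambda i)) q = 0 -> X = 0.
    by apply: raddf_inj => X dX; apply: key; rewrite (deriveE X diffF); exact: dX.
  have [_ ->] := dF X.
  move=> /(tangent_normal_eq0 Uq)[X0 dX].
  have XS : X *m S q = lambda i q *: X.
    move/eqP: X0; rewrite subr_eq0 => /eqP {2}->.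
    by rewrite scalerA mulfV // scale1r.
  have [u u0 uS] := eigenvalue_vector j Hq.
  have [k Xk] := eigen_line w0 u0 wS uS (dis q Hq) XS.
  have dlam := smooth_differentiable (@smooth_eigenvalue i) Hq.
  move/eqP: dX; rewrite oppr_eq0 mulf_eq0 invr_eq0 expf_eq0 /= (negbTE l0) Xk /=.
  rewrite (deriveZv _ _ dlam) -[_ *: _]/(_ * _) mulf_eq0 (negbTE dl) orbF => /eqP ->.
  exact: scale0r.
split=> // -[_ inj]; move/negP: w0; apply; apply/eqP; apply: inj.
rewrite linear0 -(deriveE w diffF); have [_ ->] := dF w.
rewrite wS scalerA mulVf // scale1r subrr dl0 mulr0 oppr0 scale0r addr0.
by rewrite (deriveE 0 (smooth_differentiable sf Uq)) linear0.
Qed.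

End Focal.

End Congruence.

Theorem corollary7p5 (R : realType) (U : set 'rV[R]_2)
  (f xi : 'rV[R]_2 -> 'rV[R]_3)
  (S : 'rV[R]_2 -> 'M[R]_2) (tau : 'rV[R]_2 -> 'cV[R]_2)
  (nabla : 'rV[R]_2 -> 'rV[R]_2 -> 'rV[R]_2 -> 'rV[R]_2)
  (h : 'rV[R]_2 -> 'M[R]_2)
  (lambda : 'I_2 -> 'rV[R]_2 -> R) (nu : 'rV[R]_2 -> 'rV[R]_3)
  (hfxi : line_congruence U f xi)
  (hstr : structure_equations U f xi S tau nabla h)
  (heq : equiaffine U tau h)
  (hlambda : shape_eigenvalues U S lambda)
  (hnu : conormal U f xi nu)
  (p : 'rV[R]_2) (hp : U p) (hdelta : 0 < delta (S p))
  (i : 'I_2) (hi : lambda i p != 0)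
  (hreg : regular_ridge U S (lambda i)) :
  A_point 3 (fun q => support_function f nu q (focal_map f xi (lambda i) p)) p <->
  (ridge U S f xi (lambda i) p /\
   forall w, eigenvector (S p) (lambda i p) w ->
     ~ tangent_vector (ridge U S f xi (lambda i)) p w).
Proof.
have oU : open U by case: hfxi.
have Hp : hyperbolic_locus U S p by [].
have [j dis] := other_eigenvalue hlambda i.
have oH := open_hyperbolic hfxi hstr heq.
have [w [E [sw wS frame ES]]] := eigenframe hfxi hstr heq hlambda dis Hp.
have sl := smooth_eigenvalue hlambda i.
pose H := hyperbolic_locus U S.
have sfr : smooth H (fun q => \det (frame_mx (w q) E)).
  apply: smooth_det => //; apply: smooth_mx => // a b; under eq_fun do rewrite mxE.
  case: (a == 0); last exact: smooth_cst.
  exact: smooth_coord.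
(* On this neighbourhood of [p] the field [w] has no zeros and the ridge is the zero set of [m]. *)
pose D := H `&` [set q | lambda i q != 0 /\ frame_mx (w q) E \in unitmx].
have oD : open D.
  rewrite openE => q [Hq [lq fq]]; rewrite /interior.
  have n1 : \near q, H q by exact: (open_nbhs_nbhs (conj oH Hq)).
  have n2 := near_open_comp (smooth_continuous sl Hq) (@open_neq R 0) lq.
  have n3 : \forall r \near q, \det (frame_mx (w r) E) != 0.
    apply: (near_open_comp (smooth_continuous sfr Hq) (@open_neq R 0)).
    by move: fq; rewrite unitmxE unitfE.
  near=> r; split; first by near: r.
  by split; [near: r|rewrite unitmxE unitfE; near: r].
have Dp : D p by [].
have DH : D `<=` H by move=> q [].
have DU : D `<=` U by move=> q [[]].
have wE q : D q -> eigenvector (S q) (lambda i q) (w q).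
  move=> [Hq [_ fq]]; split; last exact: wS.
  apply/eqP => w0; have /(congr1 (mulmx^~ (invmx (frame_mx (w q) E)))) : row2 1 0 *m frame_mx (w q) E = 0.
    by rewrite mul_frame_mx w0 row2_1 scaler0 scale0r addr0.
  rewrite mulmxK // mul0mx => /(congr1 (fun v : 'rV_2 => v 0 0)).
  by rewrite /= row2_0 mxE => /eqP; rewrite oner_eq0.
pose m q : R := 'D_(w q) (lambda i) q.
have swD : smooth D w by exact: smooth_sub sw.
have slD : smooth D (lambda i) by exact: smooth_sub sl.
have sm : smooth D m by exact: smooth_ridge_function.
have dm q : D q -> differentiable m q by move=> Dq; exact: (smooth_differentiable sm Dq).
have ridgeE q : D q -> ridge U S f xi (lambda i) q <-> m q = 0.
  move=> Dq; have [Hq [lq _]] := Dq.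
  have Hr := ridge_eigenvector hfxi hstr heq hlambda dis Hq lq (wE q Dq).
  exact: Hr.
pose Z := focal_map f xi (lambda i) p.
pose g q : R := support_function f nu q Z.
have sg : smooth D g by exact: smooth_sub DU (smooth_support hfxi hnu Z).
have sS : smooth D S by exact: smooth_sub DU (smooth_shape hfxi hstr heq).
have sh : smooth D h by exact: smooth_sub DU (smooth_metric hfxi hstr hnu).
have sG a b : smooth D (christoffel f h nu a b).
  exact: smooth_sub DU (smooth_christoffel hfxi hstr heq hnu a b).
have hess q a b : D q -> 'D_(delta_mx 0 a) (fun r => 'D_(delta_mx 0 b) g r) q =
    'D_(christoffel f h nu a b q) g q + ((1%:M - g q *: S q) *m h q) a b.
  by move=> Dq; exact: (support_hessian hfxi hstr heq hnu Z a b (DU q Dq)).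
have adj q : D q -> S q *m h q = h q *m (S q)^T.
  by move=> Dq; exact: (shape_self_adjoint hfxi hstr heq hnu (DU q Dq)).
have [_ hu] := heq p hp.
have wS' q : D q -> w q *m S q = lambda i q *: w q by move=> Dq; have [] := wE q Dq.
have fr q : D q -> frame_mx (w q) E \in unitmx by case=> _ [].
have lmu := dis p Hp.
have gp X := support_critical hfxi hstr heq hnu X hp (erefl Z).
have crit X : 'D_X g p = 0 by have [] := gp X.
have gl : g p = (lambda i p)^-1 by have [] := gp 0.
have A3iff : A_point 3 g p <-> m p = 0 /\ 'D_(w p) m p != 0.
  split; first exact: (transverse_ridge_of_A3 oD Dp sg slD swD sS sh sG hess adj hu wS' fr ES lmu crit hi gl).
  case; exact: (A3_of_transverse_ridge oD Dp sg slD swD sS sh sG hess adj hu wS' fr ES lmu crit hi gl).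
(* Shared by both implications: [m] vanishes along a curve in the ridge, so its differential kills
   the velocity. *)
have curve_derivative e (c : R -> 'rV[R]_2) : 0 < e -> smooth (ball 0 e) c -> c 0 = p ->
    (forall t, ball 0 e t -> D (c t) /\ m (c t) = 0) -> 'D_('D_1 c 0) m p = 0.
  move=> e0 sc c0 cm; have I0 : ball (0 : R) e 0 by exact: ballxx.
  have cD t : ball 0 e t -> D (c t) by move=> It; have [] := cm t It.
  have := slope_comp_curve sc cD sm I0; rewrite c0 => <-.
  have oI : open (ball (0 : R) e) by exact: ball_open.
  rewrite (slope_congr (g := fun=> 0) oI _ I0); first exact: slope_cst.
  by move=> t It; have [] := cm t It.
apply: (iff_trans A3iff); split=> [[m0 dm0]|[rid trans]].
  split; first exact/ridgeE.
  move=> v [v0 vS] [e [c [e0 sc cR c0 dc]]].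
  have [u u0 uS] := eigenvalue_vector hlambda j Hp.
  have [w0 _] := wE p Dp.
  have [k vk] := eigen_line w0 u0 (wS' p Dp) uS lmu vS.
  have k0 : k != 0 by apply: contraNneq v0 => k0; rewrite vk k0 scale0r.
  have I0 : ball (0 : R) e 0 by exact: ballxx.
  have n1 : \forall t \near (0 : R), ball 0 e t by exact: nbhsx_ballx.
  have n2 : \forall t \near (0 : R), D (c t).
    by apply: (near_open_comp (smooth_continuous sc I0) oD); rewrite c0.
  (* The given curve may leave [D]; a shorter interval keeps it where the ridge is the zero set of
     [m]. *)
  have [e' e'0 sub] : exists2 e', 0 < e' & forall t, ball (0 : R) e' t -> ball 0 e t /\ D (c t).
    have /nbhs_ballP[e' /= e'0 sub] : \forall t \near (0 : R), ball 0 e t /\ D (c t).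
      exact: filterI n1 n2.
    by exists e'.
  have sc' : smooth (ball 0 e') c by apply: smooth_sub sc => t /sub[].
  have cm t : ball 0 e' t -> D (c t) /\ m (c t) = 0.
    by move=> /sub[It Dt]; split=> //; exact/(ridgeE _ Dt)/cR.
  have /eqP := curve_derivative e' c e'0 sc' c0 cm; rewrite dc vk.
  by rewrite (deriveZv _ _ (dm p Dp)) -[_ *: _]/(_ * _) mulf_eq0 (negbTE k0) (negbTE dm0).
have m0 : m p = 0 by exact/ridgeE.
split=> //; apply/eqP => dm0.
(* Regularity makes the ridge near [p] a graph in direction [X] over [w p]. If dm(w p) = 0, the
   height of this graph has derivative 0, so its velocity is exactly [w p], against the assumed
   transversality. *)
have [X dX] := hreg D w oD DH swD wE p Dp m0.
have [e [Y [e0 sY Y0 YD]]] := implicit_curve (w p) oD Dp sm m0 dX.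
have oI : open (ball (0 : R) e) by exact: ball_open.
have I0 : ball (0 : R) e 0 by exact: ballxx.
pose c t := p + t *: w p + Y t *: X.
have sc : smooth (ball (0 : R) e) c by exact: smooth_graph_curve.
have c0 : c 0 = p by rewrite /c Y0 !scale0r !addr0.
have dc : 'D_1 c 0 = w p + 'D_1 Y 0 *: X by exact: (derive_graph_curve p (w p) X oI sY I0).
have := curve_derivative e c e0 sc c0 YD.
rewrite dc (deriveDv _ _ (dm p Dp)) (deriveZv _ _ (dm p Dp)) dm0 add0r => /eqP.
rewrite -[_ *: _]/(_ * _) mulf_eq0 (negbTE dX) orbF => /eqP Y'0.
have cR t : ball (0 : R) e t -> ridge U S f xi (lambda i) (c t).
  by move=> It; have [Dc mc] := YD t It; exact/(ridgeE _ Dc).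
have dcw : 'D_1 c 0 = w p by rewrite dc Y'0 scale0r addr0.
apply: (trans (w p) (wE p Dp)); exists e, c.
exact: And5 e0 sc cR c0 dcw.
Unshelve. all: by end_near. Qed.
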